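(* Let $n\geq 2$, let $\Omega$ be a bounded, smooth domain in $\mathbb{H}^n$, and let $v\in C^\infty(\Omega)$ be a solution of $$\Delta v=-\frac{1+|\nabla v|^2}{v}\quad\text{in }\Omega$$ satisfying $$-\frac{1}{2n}<v<0\quad\text{in }\Omega.$$ If $\Lambda=\nabla^2v-|\nabla v|\,g\geq 0$ in $\Omega$, then $\Lambda$ has constant rank in $\Omega$.
   Context: $\mathbb{H}^n$ is the $n$-dimensional hyperbolic space of constant sectional curvature $-1$ with metric $g$; $\nabla$, $\nabla^2$ and $\Delta$ denote the gradient, Hessian and Laplace-Beltrami operator (trace of the Hessian) with respect to $g$. A domain is a connected open set; a smooth domain is one with smooth boundary. For a symmetric $2$-tensor $\Lambda$, $\Lambda\geq 0$ means nonnegative definite at every point, and the rank of $\Lambda$ at a point is the number of its nonzero eigenvalues with respect to $g$ there, counted with multiplicity. *)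

(* Defs.v *)
From HB Require Import structures.
From mathcomp Require Import all_boot all_order all_algebra.
From mathcomp Require Import all_classical all_reals all_analysis.

Set Implicit Arguments.
Unset Strict Implicit.
Unset Printing Implicit Defensive.

Import Order.TTheory GRing.Theory Num.Theory.
Import numFieldNormedType.Exports.

Local Open Scope classical_set_scope.
Local Open Scope ring_scope.

(* Tensor calculus in one global chart: points, vectors and covectors are row  *)
(* vectors, 2-tensors are matrices of components, and a metric is a            *)
(* matrix-valued function g.                                                   *)

Section Calculus.
Variables (R : realType) (n : nat).
Implicit Types (f v : 'rV[R]_n -> R) (U : set 'rV[R]_n) (x : 'rV[R]_n).

Definition partial (i : 'I_n) f : 'rV[R]_n -> R :=
  fun x => 'D_(delta_mx 0 i) f x.

Definition iter_partial (s : seq 'I_n) f : 'rV[R]_n -> R := foldr partial f s.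

(* C^infinity on an open set U: the iterated partial derivatives of all orders *)
(* exist and are continuous at every point of U.                               *)
Definition smooth_on U f : Prop :=
  forall (s : seq 'I_n) x, U x ->
    {for x, continuous (iter_partial s f)} /\
    forall i : 'I_n, derivable (iter_partial s f) x (delta_mx 0 i).

Definition differential f x : 'rV[R]_n := \row_i partial i f x.

End Calculus.

Section Riemannian.
Variables (R : realType) (n : nat) (g : 'rV[R]_n -> 'M[R]_n).
Implicit Types (v : 'rV[R]_n -> R) (x w : 'rV[R]_n).

Definition metric_norm x w : R := Num.sqrt ((w *m g x *m w^T) 0 0).

Definition gradient v x : 'rV[R]_n := differential v x *m invmx (g x).

Definition gradient_norm v x : R := metric_norm x (gradient v x).

(* Gamma^k_ij of the Levi-Civita connection of g                               *)
Definition christoffel (k i j : 'I_n) x : R :=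
  2^-1 * \sum_(l < n) invmx (g x) k l *
    (partial i (fun y => g y j l) x + partial j (fun y => g y i l) x
     - partial l (fun y => g y i j) x).

Definition hessian v x : 'M[R]_n :=
  \matrix_(i, j) (partial i (partial j v) x
                  - \sum_(k < n) christoffel k i j x * partial k v x).

(* The endomorphism obtained by raising an index of the 2-tensor L; its        *)
(* eigenvalues are the eigenvalues of L with respect to g.                     *)
Definition raise (L : 'rV[R]_n -> 'M[R]_n) x : 'M[R]_n :=
  invmx (g x) *m L x.

Definition laplacian v x : R := \tr (raise (hessian v) x).

Definition nonneg_tensor_on (U : set 'rV[R]_n) (L : 'rV[R]_n -> 'M[R]_n) :=
  forall x w, U x -> 0 <= (w *m L x *m w^T) 0 0.

(* s lists the eigenvalues of L with respect to g at x, with multiplicity      *)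
Definition eigenvalues_at (L : 'rV[R]_n -> 'M[R]_n) x (s : seq R) : Prop :=
  char_poly (raise L x) = \prod_(a <- s) ('X - a%:P).

Definition has_rank_at (L : 'rV[R]_n -> 'M[R]_n) x (r : nat) : Prop :=
  exists2 s : seq R, eigenvalues_at L x s & count (fun a => a != 0) s = r.

Definition constant_rank_on (U : set 'rV[R]_n) (L : 'rV[R]_n -> 'M[R]_n) :=
  exists r : nat, forall x, U x -> has_rank_at L x r.

End Riemannian.

(* Hyperbolic space as the Poincare ball. The library norm on 'rV[R]_n is the  *)
(* sup norm, hence the explicit Euclidean norm.                                *)
Section Hyperbolic.
Variables (R : realType) (n : nat).
Implicit Types (x y : 'rV[R]_n) (Omega : set 'rV[R]_n).

Definition sqnorm x : R := \sum_(i < n) x 0 i ^+ 2.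

Definition hyp_space : set 'rV[R]_n := [set x | sqnorm x < 1].

Definition hyp_metric x : 'M[R]_n := (4 / (1 - sqnorm x) ^+ 2)%:M.

Definition arcosh (t : R) : R := ln (t + Num.sqrt (t ^+ 2 - 1)).

(* The geodesic distance of hyp_metric                                         *)
Definition hyp_dist x y : R :=
  arcosh (1 + 2 * sqnorm (x - y) / ((1 - sqnorm x) * (1 - sqnorm y))).

Definition hyp_bounded Omega : Prop :=
  exists r : R, forall x y, Omega x -> Omega y -> hyp_dist x y <= r.

(* As hyp_space is open in 'rV[R]_n, open sets of the hyperbolic space are     *)
(* the open sets of 'rV[R]_n contained in it.                                  *)
Definition hyp_domain Omega : Prop :=
  [/\ Omega `<=` hyp_space, open Omega & connected Omega].

Definition hyp_boundary Omega : set 'rV[R]_n :=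
  hyp_space `&` (closure Omega `\` interior Omega).

(* Near each boundary point, Omega is the sublevel set of a smooth function    *)
(* without critical points.                                                    *)
Definition hyp_smooth_boundary Omega : Prop :=
  forall p, hyp_boundary Omega p ->
    exists (U : set 'rV[R]_n) (rho : 'rV[R]_n -> R),
      [/\ open U, U p, smooth_on U rho,
          forall x, U x -> differential rho x != 0
        & forall x, U x -> (Omega x <-> rho x < 0)].

End Hyperbolic.

Arguments hyp_metric {R n}.

(* Main.v *)
(* In the ball chart Lambda is a positive multiple of a symmetric tensor W satisfying a Codazzi equation
   with a lower order defect, and the equation for v prescribes the trace of W as a function of v and
   |grad v|. The rank of W at x is at most n - m iff some m-frame E (an m x n matrix with orthonormal
   rows) at x satisfies tr (E W E^T) = 0, so it suffices to show that, for each m > 0, the set of such x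
   is open and closed in Omega. It is closed by compactness. At such a point grad v does not vanish:
   otherwise the second derivatives of v, hence W, would vanish, contradicting the positivity of tr W.

   For openness let P = E^T E at a minimum of tr (E W E^T) over frames, so that P W = W P. Differentiating
   the equation twice and varying E along well chosen curves E + t C_k, the expression
     tr (P Laplacian W) + sum_k (4 tr (E (D_k W) C_k^T) + 2 tr (C_k W C_k^T))
   equals a quadratic main term, nonpositive up to a multiple of tr (P W) because -1/(2n) < v < 0, plus
   terms bounded by tr (P W) + sum_k |tr (P D_k W)|. A Hopf barrier at a point where the zero set is
   touched from outside by a ball then yields a contradiction, as in the strong maximum principle. *)

Require Import Defs.
From HB Require Import structures.
From mathcomp Require Import all_boot all_order all_algebra.
From mathcomp Require Import all_classical all_reals all_analysis.
From mathcomp Require Import ring lra.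
From mathcomp Require complex.

Set Implicit Arguments.
Unset Strict Implicit.
Unset Printing Implicit Defensive.

Import Order.TTheory GRing.Theory Num.Theory.
Import numFieldNormedType.Exports.

Local Open Scope classical_set_scope.
Local Open Scope ring_scope.

(** The sum of the [m] lowest eigenvalues of W need not be differentiable, so it is never
    differentiated: [tr (E W E^T) - h], with [h] a barrier, is minimised jointly over points and
    frames, and a curve of frames through the minimiser gives a smooth function with a minimum
    there. The error terms may involve only [tr (P W)] and [tr (P D_k W)], because at the minimiser
    the first is at most [h] and the second equals [D_k h].

    Second derivatives of W alone leave contributions of the Codazzi defect [y W] and of the
    gradient of [tr W]. Together with the terms linear and quadratic in C_k they form squares, and
    the C_k are the minimisers up to small terms; the square in the gradient of the trace leaves
    [- 2 A^2 / L]. What remains is compared with [tr (W W) - |eta W|^2], where [eta] is the unit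
    gradient. This good term appears because [y] contains [eta], whose derivative is again expressed
    by W; it is bounded below through [(tr W)^2 / n], and the lower bound on [v] makes it large
    enough. *)

Section Dot.
Variables (R : comPzRingType) (n : nat).
Implicit Types (u v w : 'rV[R]_n) (M : 'M[R]_n).

Definition dot u v : R := \sum_i u 0 i * v 0 i.

Lemma dotC u v : dot u v = dot v u.
Proof. by apply: eq_bigr => i _; rewrite mulrC. Qed.

Lemma dotDl u v w : dot (u + v) w = dot u w + dot v w.
Proof. by rewrite -big_split; apply: eq_bigr => i _; rewrite mxE mulrDl. Qed.

Lemma dotDr u v w : dot w (u + v) = dot w u + dot w v.
Proof. by rewrite !(dotC w) dotDl. Qed.

Lemma dotZl a u v : dot (a *: u) v = a * dot u v.
Proof. by rewrite mulr_sumr; apply: eq_bigr => i _; rewrite mxE mulrA. Qed.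

Lemma dotZr a u v : dot u (a *: v) = a * dot u v.
Proof. by rewrite dotC dotZl dotC. Qed.

Lemma dotNl u v : dot (- u) v = - dot u v.
Proof. by rewrite -scaleN1r dotZl mulN1r. Qed.

Lemma dotNr u v : dot u (- v) = - dot u v.
Proof. by rewrite dotC dotNl dotC. Qed.

Lemma dot0l u : dot 0 u = 0.
Proof. by rewrite /dot big1 // => i _; rewrite mxE mul0r. Qed.

Lemma dot_suml (I : Type) (s : seq I) (Q : pred I) (F : I -> 'rV[R]_n) u :
  dot (\sum_(i <- s | Q i) F i) u = \sum_(i <- s | Q i) dot (F i) u.
Proof. by apply: (big_morph (fun v => dot v u)) => [v w|]; rewrite ?dotDl ?dot0l. Qed.

Lemma dot_mulmx u v M : dot (u *m M) v = dot u (v *m M^T).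
Proof.
transitivity (\sum_i \sum_j u 0 j * M j i * v 0 i).
  by apply: eq_bigr => i _; rewrite mxE mulr_suml.
rewrite exchange_big; apply: eq_bigr => j _ /=.
rewrite mxE mulr_sumr; apply: eq_bigr => i _.
by rewrite mxE -mulrA; congr (_ * _); rewrite mulrC.
Qed.

Lemma dotE u v : dot u v = (u *m v^T) 0 0.
Proof. by rewrite mxE; apply: eq_bigr => i _; rewrite mxE. Qed.

Lemma trmxD p q (A B : 'M[R]_(p, q)) : (A + B)^T = A^T + B^T.
Proof. by apply/matrixP => i j; rewrite !mxE. Qed.

Lemma trmxB p q (A B : 'M[R]_(p, q)) : (A - B)^T = A^T - B^T.
Proof. by apply/matrixP => i j; rewrite !mxE. Qed.

Lemma mxtraceB p (A B : 'M[R]_p) : \tr (A - B) = \tr A - \tr B.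
Proof. by rewrite /mxtrace -sumrB; apply: eq_bigr => i _; rewrite !mxE. Qed.

Lemma mxtraceN p (A : 'M[R]_p) : \tr (- A) = - \tr A.
Proof. by rewrite -[- A]add0r mxtraceB mxtrace0 sub0r. Qed.

Definition dotE_lin := (dotDl, dotDr, dotZl, dotZr, dotNl, dotNr).

Lemma mxtrace_sum m (M : 'M[R]_m) : \tr M = \sum_i M i i. Proof. by []. Qed.

Lemma mxtrace_mul_sum (M N : 'M[R]_n) :
  \tr (M *m N) = \sum_i \sum_j M i j * N j i.
Proof. by apply: eq_bigr => i _; rewrite mxE. Qed.

Lemma mxtrace11 (M : 'M[R]_1) : \tr M = M 0 0.
Proof. by rewrite /mxtrace big_ord1. Qed.

(** The test directions of the second variation are sums of two rank one matrices; symmetry of [W]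
    merges their two cross terms. *)
Lemma trace_rank_two p (a a' : 'cV[R]_p) (u r : 'rV[R]_n) (W : 'M[R]_n) : W^T = W ->
  \tr ((a *m u + a' *m r) *m W *m (a *m u + a' *m r)^T) =
  (a^T *m a) 0 0 * dot (u *m W) u + 2 * (a^T *m a') 0 0 * dot (u *m W) r
  + (a'^T *m a') 0 0 * dot (r *m W) r.
Proof.
move=> symW.
have tr2 (b b' : 'cV[R]_p) (v w : 'rV[R]_n) :
   \tr ((b *m v) *m W *m (b' *m w)^T) = (b'^T *m b) 0 0 * dot (v *m W) w.
  rewrite trmx_mul mulmxA mxtrace_mulC !mulmxA mxtrace11.
  rewrite -!mulmxA [b'^T *m (b *m _)]mulmxA [v *m (W *m _)]mulmxA dotE.
  by rewrite [LHS]mxE big_ord1.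
rewrite trmxD !mulmxDl !mulmxDr !mxtraceD !tr2.
have -> : (a'^T *m a) 0 0 = (a^T *m a') 0 0.
  transitivity ((a'^T *m a)^T 0 0); first by rewrite [RHS]mxE.
  by rewrite trmx_mul trmxK.
have -> : dot (r *m W) u = dot (u *m W) r by rewrite dot_mulmx symW dotC.
ring.
Qed.

End Dot.

(** * Pointwise algebra *)

(* [W] is a symmetric tensor at a point, [T k] its derivative in direction [k], [z] the defect in the
   Codazzi equation, and [P] the projection onto the span of the frame [E]. *)
Section PointwiseJet.
Variables (R : realFieldType) (n m : nat).
Variables (W : 'M[R]_n) (T : 'I_n -> 'M[R]_n) (E : 'M[R]_(m, n)) (y : 'rV[R]_n).
Hypothesis symW : W^T = W.
Hypothesis symT : forall k, (T k)^T = T k.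
Hypothesis EE : E *m E^T = 1%:M.
Variable P : 'M[R]_n.
Hypothesis PE : P = E^T *m E.
Hypothesis PW : P *m W = W *m P.
Variable z : 'rV[R]_n.
Hypothesis zE : z = y *m W.
Hypothesis codazzi : forall i j k,
  T k i j = T j i k + (i == j)%:R * z 0 k - (i == k)%:R * z 0 j.

Let g : 'rV[R]_n := \row_k \tr (P *m T k).
Let tau' : 'rV[R]_n := \row_k \tr (T k).
Let b : 'rV[R]_n := \sum_k row k P *m T k.
Let d : 'rV[R]_n := \sum_k row k (T k).

Lemma projT : P^T = P.
Proof. by rewrite PE trmx_mul trmxK. Qed.

Lemma proj_idem : P *m P = P.
Proof. by rewrite PE mulmxA -[E^T *m E *m E^T]mulmxA EE mulmx1. Qed.

Lemma proj_trace : \tr P = m%:R.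
Proof. by rewrite PE mxtrace_mulC EE mxtrace1. Qed.

Lemma projE : E *m P = E.
Proof. by rewrite PE mulmxA EE mul1mx. Qed.

(** The Codazzi equation moves the index of differentiation inside the matrix, so the divergence
    over the frame becomes the gradient [g] of the trace over it plus the contracted defect. As [g]
    and [z *m P] count as small later, only [- m z] matters. *)
Lemma frame_divergence : b = g + z *m P - m%:R *: z.
Proof.
apply/rowP => j; rewrite summxE !mxE.
under eq_bigr => k _ do rewrite mxE.
transitivity (\sum_k \sum_i P k i * (T j i k + (i == j)%:R * z 0 k - (i == k)%:R * z 0 j)).
  by apply: eq_bigr => k _; apply: eq_bigr => i _; rewrite -codazzi mxE.
transitivity (\sum_k (\sum_i P k i * T j i k + P k j * z 0 k - P k k * z 0 j)).
  apply: eq_bigr => k _.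
  have -> : P k j * z 0 k = \sum_i P k i * ((i == j)%:R * z 0 k).
    rewrite (bigD1 j) //= eqxx mul1r big1 ?addr0// => i /negbTE ->.
    by rewrite mul0r mulr0.
  have -> : P k k * z 0 j = \sum_i P k i * ((i == k)%:R * z 0 j).
    rewrite (bigD1 k) //= eqxx mul1r big1 ?addr0// => i /negbTE ->.
    by rewrite mul0r mulr0.
  under [LHS]eq_bigr => i _ do rewrite mulrBr mulrDr.
  by rewrite sumrB big_split.
rewrite sumrB big_split /=; congr (_ + _ - _).
- by rewrite mxtrace_mul_sum.
- by apply: eq_bigr => k _; rewrite mulrC.
- by rewrite -mulr_suml -mxtrace_sum proj_trace.
Qed.

(** The contraction of [frame_divergence] with the identity in place of [P]; the defect terms add up
    to [(1 - n) z]. *)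
Lemma total_divergence : d = tau' - (n%:R - 1) *: z.
Proof.
apply/rowP => j; rewrite summxE !mxE.
transitivity (\sum_k (T j k k + (k == j)%:R * z 0 k - z 0 j)).
  apply: eq_bigr => k _.
  by rewrite mxE codazzi eqxx mul1r.
rewrite sumrB big_split /= sumr_const card_ord.
have -> : \sum_i (i == j)%:R * z 0 i = z 0 j.
  rewrite (bigD1 j) //= eqxx mul1r big1 ?addr0// => i /negbTE ->.
  by rewrite mul0r.
by rewrite -mulr_natl mxtrace_sum; ring.
Qed.

Variables (c : R).
Let beta : 'rV[R]_n := c *: (tau' *m P).
Let u : 'rV[R]_n := y - y *m P.

(* Derivative, in direction [k], of the moving frame to be tested in the second variation. The first
   term compensates the defect [z] of the Codazzi equation; the second, with [c = - (\tr W)^-1], completes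
   the square in the gradient of the trace. *)
Definition test_direction (k : 'I_n) : 'M[R]_(m, n) :=
  col k E *m u + (E *m beta^T) *m row k (1%:M - P).

(** All rows lie in the range of [1 - P]. Orthogonality to the frame is what [frame_correction] asks
    of a variation. *)
Lemma test_direction_orthogonal k : E *m (test_direction k)^T = 0.
Proof.
have h : E *m (1%:M - P)^T = 0.
  by rewrite trmxB trmx1 projT mulmxBr mulmx1 projE subrr.
have uE : u = y *m (1%:M - P) by rewrite /u mulmxBr mulmx1.
rewrite trmxD !trmx_mul !mulmxDr uE !trmx_mul !mulmxA h tr_row.
by rewrite [col k (_ - _)^T]colE !mulmxA h !mul0mx addr0.
Qed.

Lemma betaP : beta *m P = beta.
Proof. by rewrite -scalemxAl -mulmxA proj_idem. Qed.

(** Summing over the rows of [E] contracts with [P]: the first summand of the direction meets the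
    divergence [b] over the frame, the second, through its factor [1 - P], the complementary
    divergence [d - b]. *)
Lemma first_order_sum :
  \sum_k \tr (E *m T k *m (test_direction k)^T) = dot b u + dot beta (d - b).
Proof.
have -> : d - b = \sum_k row k (1%:M - P) *m T k.
  rewrite -sumrB; apply: eq_bigr => k _.
  by rewrite linearB /= mulmxBl row1 -rowE.
rewrite [dot beta _]dotC !dot_suml -big_split; apply: eq_bigr => k _ /=.
rewrite trmxD mulmxDr mxtraceD !trmx_mul trmxK; congr (_ + _).
  rewrite mulmxA mxtrace_mulC mxtrace11 dotE tr_col !mulmxA.
  by rewrite PE row_mul.
rewrite !mulmxA -[_ *m beta *m _]mulmxA -mulmxA mxtrace_mulC -mulmxA mxtrace_mulC.
rewrite mxtrace11 mulmxA -[beta *m _ *m E]mulmxA -PE betaP.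
by rewrite dotC -[X in dot _ (_ *m X)]symT -dot_mulmx dotE.
Qed.

(** The mixed terms cancel in the sum over [k], since [beta] lies in the range of [P] and its
    partner in that of [1 - P]. Weighted by 2 and added to 4 times [first_order_sum], this gives
    quadratic functions of [u] and of [beta]; up to small terms, [y - y P] and [- (tr W)^-1 tau' P]
    are their minimisers. *)
Lemma second_order_sum :
  \sum_k \tr (test_direction k *m W *m (test_direction k)^T) =
  m%:R * dot (u *m W) u + dot beta beta * (\tr W - \tr (P *m W)).
Proof.
have EbP : (E *m beta^T)^T *m E = beta.
  by rewrite trmx_mul trmxK -mulmxA -PE betaP.
have expand k : \tr (test_direction k *m W *m (test_direction k)^T) =
   P k k * dot (u *m W) u
   + 2 * (beta 0 k * (u *m W *m (1%:M - P)) 0 k)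
   + dot beta beta * ((1%:M - P) *m W *m (1%:M - P)) k k.
  rewrite /test_direction trace_rank_two//; set r := row k (1%:M - P).
  have -> : ((col k E)^T *m col k E) 0 0 = P k k.
    by rewrite PE !mxE; apply: eq_bigr => i _; rewrite !mxE.
  have -> : ((col k E)^T *m (E *m beta^T)) 0 0 = beta 0 k.
    rewrite mulmxA tr_col -row_mul -PE -[in RHS]betaP -dotE dotC [RHS]mxE; apply: eq_bigr => i _.
    by congr (_ * _); rewrite -[in RHS]projT !mxE.
  have -> : ((E *m beta^T)^T *m (E *m beta^T)) 0 0 = dot beta beta.
    by rewrite mulmxA EbP dotE.
  have -> : dot (u *m W) r = (u *m W *m (1%:M - P)) 0 k.
    by rewrite /dot [RHS]mxE; apply: eq_bigr => i _; rewrite /r -[in LHS]projT !mxE eq_sym.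
  have -> : dot (r *m W) r = ((1%:M - P) *m W *m (1%:M - P)) k k.
    rewrite /r -row_mul /dot [RHS]mxE; apply: eq_bigr => i _.
    rewrite [in X in X * _]mxE; congr (_ * _).
    by rewrite -[in LHS]projT !mxE eq_sym.
  by rewrite mulrA.
rewrite (eq_bigr _ (fun k _ => expand k)) !big_split /= -mulr_suml -mxtrace_sum proj_trace.
rewrite -!mulr_sumr -mxtrace_sum.
have -> : \sum_i beta 0 i * (u *m W *m (1%:M - P)) 0 i = 0.
  rewrite -/(dot _ _) dotC dot_mulmx trmxB trmx1 projT mulmxBr mulmx1 betaP subrr.
  by rewrite dotC dot0l.
rewrite mulr0 addr0; congr (_ + _ * _).
rewrite -mulmxA mxtrace_mulC -mulmxA.
have -> : (1%:M - P) *m (1%:M - P) = 1%:M - P.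
  by rewrite mulmxBr mulmx1 mulmxBl mul1mx proj_idem subrr subr0.
by rewrite mulmxBr mulmx1 linearB /= -PW.
Qed.

End PointwiseJet.

(* In the chart, [DW] is the Laplacian of [W], [H] the Hessian of its trace, [v] the differential, [y] the
   test vector, [eta] the unit gradient, [dy] and [deta] their Jacobians. *)
Section JetIdentity.
Variables (R : realFieldType) (n m : nat).
Variables (W : 'M[R]_n) (T : 'I_n -> 'M[R]_n) (E : 'M[R]_(m, n)) (P : 'M[R]_n).
Variables (x y z eta v w dF : 'rV[R]_n) (H dy deta DW : 'M[R]_n) (r p L F A A1 K : R).
Hypothesis symW : W^T = W.
Hypothesis symT : forall k, (T k)^T = T k.
Hypothesis EE : E *m E^T = 1%:M.
Hypothesis PE : P = E^T *m E.
Hypothesis PW : P *m W = W *m P.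
Hypothesis zE : z = y *m W.
Hypothesis wE : w = eta *m W.
Hypothesis codazzi : forall i j k,
  T k i j = T j i k + (i == j)%:R * z 0 k - (i == k)%:R * z 0 j.

Let g : 'rV[R]_n := \row_k \tr (P *m T k).
Let tau' : 'rV[R]_n := \row_k \tr (T k).
Let contract (a : 'rV[R]_n) : 'M[R]_n := \matrix_(j, i) (a *m T j) 0 i.
Let dz : 'M[R]_n := contract y + dy *m W.

Hypothesis r0 : r != 0.
Hypothesis p0 : p != 0.
Hypothesis L0 : L != 0.
Hypothesis rE : r * (1 - dot x x) = 2.
Hypothesis eta1 : dot eta eta = 1.
Hypothesis vE : v = p *: eta.
Hypothesis yE : y = r *: (x - eta).
Hypothesis trW : \tr W = r * L.
Hypothesis dyE : dy = y^T *m y - (dot y y / 2)%:M - (r ^+ 2 / p) *: (W - w^T *m eta).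
Hypothesis tau'E : tau' = (L * r ^+ 2) *: x + r *: (F *: w + A *: v).
Hypothesis DWE : DW = H^T - (n%:R - 1) *: dz^T + (\tr dz)%:M - dz.
Hypothesis HE : H = r ^+ 2 *: ((F *: w + A *: v)^T *m x) + (2 * L * r ^+ 3) *: (x^T *m x)
  + (L * r ^+ 2)%:M + (r ^+ 2 * F) *: (x^T *m w) + r *: (dF^T *m w)
  + (r * F) *: (contract eta + deta *m W) + (r ^+ 2 * A) *: (x^T *m v)
  + r *: ((A1 *: w + K *: v)^T *m v)
  + (r * A * r) *: (W + x^T *m v + v^T *m x - (dot x v - p)%:M).

Let C k := test_direction T E y P (- (r * L)^-1) k.
Let G := \tr (P *m W).
Let beta : 'rV[R]_n := - (r * L)^-1 *: (tau' *m P).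
Let zeta := z *m P.
Let theta := w *m P.

Lemma trace_contract (a : 'rV[R]_n) :
  \tr (P *m contract a) = dot (\sum_k row k P *m T k) a.
Proof.
rewrite mxtrace_mul_sum dot_suml exchange_big /=; apply: eq_bigr => j _.
rewrite dot_mulmx symT; apply: eq_bigr => i _.
by rewrite [X in _ * X]mxE -[in LHS](projT PE) !mxE.
Qed.

Lemma trace_contract1 (a : 'rV[R]_n) :
  \tr (contract a) = dot (\sum_k row k (T k)) a.
Proof.
rewrite dot_suml; apply: eq_bigr => j _.
rewrite dotE [LHS]mxE -row_mul; transitivity ((a *m (T j)^T) 0 j).
  by rewrite symT.
by rewrite !mxE; apply: eq_bigr => i _; rewrite !mxE mulrC.
Qed.

Lemma trace_proj_outer (a b : 'rV[R]_n) : \tr (P *m (a^T *m b)) = dot (a *m P) b.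
Proof.
rewrite mulmxA mxtrace_mulC mulmxA mxtrace11 -mulmxA.
by rewrite dotC dotE trmx_mul (projT PE).
Qed.

(* Each term contains some [\tr (P *m T k)] or the product [P *m W], whose entries are bounded by its
   trace when [W] is nonnegative and commutes with [P]. *)
Definition jet_remainder : R :=
  4 * dot g (y - y *m P) + 4 * dot zeta (y - y *m P) + 2 * m%:R * dot zeta y
  + 4 * ((m%:R - n%:R) * dot beta zeta - dot beta g)
  - 2 * G * (dot (tau' *m P) tau' / (r * L) ^+ 2)
  - n%:R * (dot g y + dot zeta y + \tr (P *m (dy *m W)))
  + 2 * r ^+ 2 * F * dot theta x + r * dot theta dF
  + r * F * (dot g eta + dot zeta eta + \tr (P *m (deta *m W)))
  + r * A1 * dot theta v + r ^+ 2 * A * G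
  - 2 / (r * L) * (2 * L * r ^+ 3 * F * dot theta x + 2 * r ^+ 2 * F * A * dot theta v
                   + r ^+ 2 * F ^+ 2 * dot theta w).

(** After the two divergence formulas everything is a scalar contraction, and the terms in [x], [y]
    and [z] that are not small cancel because [r (1 - |x|^2) = 2]. The surviving [K] comes from
    differentiating [A], and [tr (W W) - |w|^2] from the last term of [dy], through [m * tr dz]. *)
Lemma jet_identity :
  \tr (P *m DW) + \sum_k (4 * \tr (E *m T k *m (C k)^T) + 2 * \tr (C k *m W *m (C k)^T))
  = r * dot (v *m P) v * (K - 2 * A ^+ 2 / L)
    - m%:R * (r ^+ 2 / p) * (\tr (W *m W) - dot w w) + jet_remainder.
Proof.
rewrite big_split /= -!mulr_sumr.
rewrite (first_order_sum y symT EE PE) (second_order_sum T y symW EE PE PW).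
have P2 := proj_idem EE PE.
have PT := projT PE.
have symP (a b : 'rV[R]_n) : dot (a *m P) b = dot (b *m P) a.
  by rewrite dot_mulmx PT dotC.
have symW' (a b : 'rV[R]_n) : dot (a *m W) b = dot (b *m W) a.
  by rewrite dot_mulmx symW dotC.
have trPT (M : 'M[R]_n) : \tr (P *m M^T) = \tr (P *m M).
  by rewrite -mxtrace_tr trmx_mul trmxK PT mxtrace_mulC.
have trPdz : \tr (P *m dz) = dot g y + dot zeta y - m%:R * dot z y + \tr (P *m (dy *m W)).
  by rewrite /dz mulmxDr mxtraceD trace_contract (frame_divergence EE PE codazzi) !dotE_lin.
have trdz : \tr dz = dot tau' y - (n%:R - 1) * dot z y + dot z y - dot y y / 2 * (r * L)
    - r ^+ 2 / p * (\tr (W *m W) - dot w w).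
  rewrite /dz mxtraceD trace_contract1 (total_divergence codazzi) !dotE_lin dyE.
  rewrite !mulmxBl mul_scalar_mx -scalemxAl mulmxBl !mxtraceB !mxtraceZ mxtraceB trW.
  have -> : \tr (y^T *m y *m W) = dot z y.
    by rewrite -mulmxA mxtrace_mulC mxtrace11 dotE zE.
  have -> : \tr (w^T *m eta *m W) = dot w w.
    by rewrite -mulmxA mxtrace_mulC mxtrace11 dotE wE.
  ring.
have trPDW : \tr (P *m DW) = \tr (P *m H) - n%:R * \tr (P *m dz) + m%:R * \tr dz.
  rewrite DWE mulmxBr mulmxDr mulmxBr mxtraceB mxtraceD mxtraceB trPT -scalemxAr mxtraceZ trPT.
  rewrite mul_mx_scalar mxtraceZ (proj_trace EE PE); ring.
have P1 : \tr P = m%:R := proj_trace EE PE.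
have trPH : \tr (P *m H) = r ^+ 2 * (F * dot theta x + A * dot (v *m P) x)
    + 2 * L * r ^+ 3 * dot (x *m P) x + m%:R * (L * r ^+ 2)
    + r ^+ 2 * F * dot theta x + r * dot theta dF
    + r * F * (dot g eta + dot zeta eta - m%:R * dot z eta + \tr (P *m (deta *m W)))
    + r ^+ 2 * A * dot (v *m P) x
    + r * (A1 * dot theta v + K * dot (v *m P) v)
    + r * A * r * (G + 2 * dot (v *m P) x - m%:R * (dot x v - p)).
  rewrite HE !mulmxDr !mxtraceD -!scalemxAr !mulmxDr !mxtraceZ !mul_mx_scalar.
  rewrite !mxtraceD !trace_proj_outer.
  rewrite trace_contract (frame_divergence EE PE codazzi) mulmxN mul_mx_scalar mxtraceN !mxtraceZ P1.
  rewrite !mulmxDl -!scalemxAl !dotE_lin.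
  rewrite (symP x w) (symP dF w) (symP x v) -/theta -/zeta -/G; ring.
rewrite trPDW trPdz trdz trPH.
have bP : beta *m P = beta by rewrite /beta -scalemxAl -mulmxA P2.
have zy2 : dot (z *m P) (y *m P) = dot zeta y.
  by rewrite (symP z) -[y *m P *m P]mulmxA P2 symP.
have zyP : dot z (y *m P) = dot zeta y by rewrite dotC symP.
have bz : dot beta z = dot beta zeta by rewrite -bP symP dotC bP.
rewrite (frame_divergence EE PE codazzi) (total_divergence codazzi) -/beta -/zeta.
have uu : dot ((y - y *m P) *m W) (y - y *m P) = dot z y - dot zeta y.
  rewrite mulmxBl -[y *m P *m W]mulmxA PW mulmxA -zE !dotE_lin zyP zy2 -/zeta; ring.
(* The square gained from [beta]: its part along [v] becomes [- 2 A^2 / L], and its parts along [x]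
   cancel against those of [trPH]. *)
have NE : dot (tau' *m P) tau' = L ^+ 2 * r ^+ 4 * dot (x *m P) x
    + 2 * L * A * r ^+ 3 * dot (v *m P) x + r ^+ 2 * A ^+ 2 * dot (v *m P) v
    + 2 * L * r ^+ 3 * F * dot theta x + 2 * r ^+ 2 * F * A * dot theta v
    + r ^+ 2 * F ^+ 2 * dot theta w.
  rewrite tau'E !mulmxDl -!scalemxAl mulmxDl -!scalemxAl !dotE_lin -/theta.
  by rewrite (symP x w) (symP v w) (symP x v) -/theta; ring.
have bt : dot beta tau' = - (r * L)^-1 * dot (tau' *m P) tau' by rewrite dotZl.
have bb : dot beta beta = (r * L)^-1 ^+ 2 * dot (tau' *m P) tau'.
  rewrite dotZl dotZr -[tau' *m P in X in _ * (_ * dot _ X)]mulmx1.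
  rewrite mulmx1 (symP tau') -mulmxA P2; ring.
have ty : dot tau' y = L * r ^+ 2 * dot x y + r * (F * dot z eta + A * dot v y).
  rewrite tau'E !dotE_lin; congr (_ + _ * (_ * _ + _)).
  by rewrite wE symW' -zE.
have vy : dot v y = p * r * (dot x eta - 1).
  by rewrite vE yE !dotE_lin eta1 (dotC eta); ring.
have xv : dot x v = p * dot x eta by rewrite vE dotE_lin.
have xy : dot x y = r * (dot x x - dot x eta) by rewrite yE !dotE_lin.
have yy : dot y y = r ^+ 2 * (dot x x - 2 * dot x eta + 1).
  by rewrite yE !dotE_lin eta1 (dotC eta); ring.
have xx : dot x x = 1 - 2 / r by move/(canRL (mulKf r0)): rE => E1; rewrite mulrC -E1; ring.
rewrite uu /jet_remainder trW -/g -/tau' -/beta -/zeta -/G -/theta.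
move: bt bb bz ty NE zy2 zyP; rewrite -/zeta -/theta.
move: (beta) (tau') (g) (zeta) (theta) (G) => be ta gg ze th GG bt bb bz ty NE zy2 zyP.
rewrite !dotE_lin zy2 zyP bz bt bb ty vy xv xy yy xx NE.
field.
by rewrite r0 p0 L0.
Qed.

End JetIdentity.

(** * Trace inequalities for symmetric matrices *)

Section QuadraticEstimates.
Variables (R : realFieldType) (n : nat).
Implicit Types (a b : 'rV[R]_n) (M W P : 'M[R]_n).

Lemma dot_ge0 a : 0 <= dot a a.
Proof. by apply: sumr_ge0 => i _; rewrite -expr2 sqr_ge0. Qed.

Lemma dot_eq0 a : dot a a = 0 -> a = 0.
Proof.
move=> /eqP; rewrite psumr_eq0 => [/allP h|i _]; last by rewrite -expr2 sqr_ge0.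
apply/rowP => i; rewrite mxE; apply/eqP.
by have := h i (mem_index_enum i); rewrite /= mulf_eq0 orbb.
Qed.

Lemma cauchy_schwarz a b : dot a b ^+ 2 <= dot a a * dot b b.
Proof.
have [/dot_eq0->|b0] := eqVneq (dot b b) 0.
  by rewrite dotC !dot0l expr0n mulr0.
have bp : 0 < dot b b by rewrite lt_def b0 dot_ge0.
have h := dot_ge0 (dot b b *: a - dot a b *: b).
rewrite -subr_ge0 -(pmulr_rge0 _ bp); apply: le_trans h _.
rewrite !dotE_lin (dotC b a) le_eqVlt; apply/orP; left; apply/eqP; ring.
Qed.

Lemma trace_sqr W : W^T = W -> \tr (W *m W) = \sum_i \sum_j W i j ^+ 2.
Proof.
move=> sW; rewrite mxtrace_mul_sum; apply: eq_bigr => i _; apply: eq_bigr => j _.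
by rewrite -[in W j i]sW mxE expr2.
Qed.

(** Operator norm against Frobenius norm, by Cauchy-Schwarz on each column. *)
Lemma dot_mulmx_le a M : M^T = M -> dot (a *m M) (a *m M) <= dot a a * \tr (M *m M).
Proof.
move=> sM; rewrite trace_sqr// exchange_big mulr_sumr; apply: ler_sum => j _.
rewrite -expr2; have -> : (a *m M) 0 j = dot a (col j M)^T.
  by rewrite mxE; apply: eq_bigr => i _; rewrite !mxE.
apply: le_trans (cauchy_schwarz _ _) _; rewrite ler_wpM2l ?dot_ge0//.
by apply: ler_sum => i _; rewrite !mxE expr2.
Qed.

(** Cauchy-Schwarz for the diagonal against the all-ones vector; the off-diagonal squares are
    dropped. *)
Lemma trace_sqr_le W : W^T = W -> \tr W ^+ 2 <= n%:R * \tr (W *m W).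
Proof.
move=> sW; have := cauchy_schwarz (const_mx 1) (\row_i W i i).
have -> : dot (const_mx 1) (\row_i W i i) = \tr W.
  by apply: eq_bigr => i _; rewrite !mxE mul1r.
have -> : dot (const_mx 1 : 'rV[R]_n) (const_mx 1) = n%:R.
  by rewrite /dot; under eq_bigr do rewrite !mxE mul1r; rewrite sumr_const card_ord.
move=> /le_trans; apply; rewrite ler_wpM2l ?ler0n// trace_sqr//.
apply: ler_sum => i _; rewrite (bigD1 i) //= mxE expr2 lerDl.
by apply: sumr_ge0 => j _; exact: sqr_ge0.
Qed.

(** Split [W = O + D] with [O = P W] and [D] killed by [P]. The part [O] contributes nonnegatively
    by the Frobenius bound, and for [D] the fraction [dot (a *m P) a] of [tr (D D)] remains, to
    which [trace_sqr_le] applies. *)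
Lemma trace_gap W P a : W^T = W -> P^T = P -> P *m P = P -> P *m W = W *m P ->
  dot a a = 1 ->
  dot (a *m P) a * (\tr W - \tr (P *m W)) ^+ 2
  <= n%:R * (\tr (W *m W) - dot (a *m W) (a *m W)).
Proof.
move=> sW sP PP PW a1.
pose D := W - P *m W; pose O := P *m W.
have sO : O^T = O by rewrite trmx_mul sP sW -PW.
have sD : D^T = D by rewrite trmxB sW -/O sO.
have WE : W = O + D by rewrite /D addrC subrK.
have PO : P *m O = O by rewrite mulmxA PP.
have PD : P *m D = 0 by rewrite mulmxBr -/O PO subrr.
have OD : O *m D = 0 by rewrite /O PW -mulmxA PD mulmx0.
have DO : D *m O = 0 by rewrite -[LHS]trmxK trmx_mul sD sO OD trmx0.
have DP : D *m P = 0 by rewrite -[LHS]trmxK trmx_mul sD sP PD trmx0.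
have -> : \tr W - \tr (P *m W) = \tr D by rewrite mxtraceB.
clearbody O D.
have -> : \tr (W *m W) = \tr (O *m O) + \tr (D *m D).
  by rewrite WE mulmxDl !mulmxDr OD DO addr0 add0r mxtraceD.
have -> : dot (a *m W) (a *m W) = dot (a *m O) (a *m O) + dot (a *m D) (a *m D).
  rewrite WE mulmxDr !dotE_lin.
  have -> : dot (a *m D) (a *m O) = 0 by rewrite dotC dot_mulmx sO -mulmxA DO mulmx0 dotC dot0l.
  have -> : dot (a *m O) (a *m D) = 0 by rewrite dot_mulmx sO -mulmxA DO mulmx0 dotC dot0l.
  by rewrite addr0 add0r.
have h1 := dot_mulmx_le a sO; rewrite a1 mul1r in h1.
(* [D] only sees the component [a - a P], whose squared length is [1 - dot (a *m P) a]. *)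
have h2 : dot (a *m D) (a *m D) <= (1 - dot (a *m P) a) * \tr (D *m D).
  have -> : a *m D = (a - a *m P) *m D.
    by rewrite mulmxBl -mulmxA PD mulmx0 subr0.
  apply: le_trans (dot_mulmx_le _ sD) _; rewrite le_eqVlt; apply/orP; left; apply/eqP.
  congr (_ * _); rewrite !dotE_lin a1 (dotC a).
  have -> : dot (a *m P) (a *m P) = dot (a *m P) a by rewrite dot_mulmx sP -mulmxA PP dotC.
  ring.
have t0 : 0 <= dot (a *m P) a.
  by rewrite -PP mulmxA dot_mulmx sP dot_ge0.
have h3 := ler_wpM2l t0 (trace_sqr_le sD).
apply: le_trans h3 _; rewrite mulrCA ler_wpM2l ?ler0n//.
move: h1 h2; set A := \tr _; set B := \tr _; set C := dot (a *m O) _; set E := dot (a *m D) _.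
set t := dot _ a; clear; lra.
Qed.

End QuadraticEstimates.

(** * The scalar inequality behind the sign of the main term *)

Section ScalarInequality.
Variables (R : realFieldType).

(* The only place where the full strength of [- 1 / (2 n) < v] enters, with [s = - v]. *)
Lemma cubic_estimate (N q s : R) : 2 <= N -> 0 < q -> 0 < s -> s < (2 * N)^-1 ->
  let D := 1 + q ^+ 2 - N * q * s in
  let P := 1 + q ^+ 2 + 2 * q * s in
  0 < D /\ 2 * N * q ^+ 3 * (P * ((2 * N + 1) * s - (N + 2) * q)) <= D ^+ 3.
Proof.
move=> N2 q0 s0 s1 D P.
have N0 : 0 < N by lra.
have Ns : N * s < 2^-1.
  move: s1; rewrite invfM -(ltr_pM2l N0) => /lt_le_trans; apply.
  by rewrite mulrCA divff ?gt_eqF// mulr1.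
have Ds : 1 + q ^+ 2 - q / 2 <= D.
  rewrite /D lerD2l lerN2 mulrAC [leRHS]mulrC ler_wpM2r// ltW//.
have D0 : 0 < D.
  apply: lt_le_trans Ds; have := sqr_ge0 (q - 4^-1); rewrite sqrrB; lra.
split => //.
set e := (2 * N + 1) * s - (N + 2) * q.
(* A nonpositive factor [e] makes the left side nonpositive. Otherwise [q < 2 s], hence [q < 1 / 2]
   since [s < 1 / 4], and every factor can be bounded by a number. *)
have [e0|e0] := lerP e 0.
  apply: (@le_trans _ _ 0); last by rewrite exprn_ge0// ltW.
  have P0 : 0 <= P by rewrite /P !addr_ge0 ?mulr_ge0 ?sqr_ge0// ltW.
  apply: mulr_ge0_le0; last exact: mulr_ge0_le0.
  by rewrite !mulr_ge0 ?exprn_ge0// ltW.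
have qs : q < 2 * s.
  rewrite -(@ltr_pM2l _ (N + 2)); last lra.
  have : 0 < s * 3 by rewrite mulr_gt0.
  move: e0; rewrite /e; lra.
have aN : 2 * s <= N * s by rewrite ler_wpM2r// ltW.
have s4 : s < 4^-1 by lra.
have P1 : P <= 3 / 2.
  have h1 : q ^+ 2 <= 4^-1.
    have -> : 4^-1 = 2^-1 ^+ 2 :> R by rewrite expr2; field.
    by rewrite lerXn2r ?nnegrE ?ltW// ?invr_gt0// (lt_trans qs)//; lra.
  have h2 : q * s <= 2^-1 * 4^-1 by apply: ler_pM; rewrite ltW//; lra.
  rewrite /P; lra.
have P0 : 0 <= P by rewrite /P !addr_ge0 ?mulr_ge0 ?sqr_ge0// ltW.
have D3 : 27 / 64 <= D ^+ 3.
  have -> : 27 / 64 = (3 / 4) ^+ 3 :> R by field.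
  have D34 : 3 / 4 <= D by apply: le_trans Ds; have := sqr_ge0 (q - 4^-1); rewrite sqrrB; lra.
  by apply: lerXn2r => //; rewrite nnegrE; lra.
(* As a function of [q], the product [q * e] is largest at [2 (N + 2) q = (2 N + 1) s]; this
   completes the square there. *)
have X1 : 4 * (N + 2) * (q * e) <= ((2 * N + 1) * s) ^+ 2.
  have := sqr_ge0 ((2 * N + 1) * s - 2 * (N + 2) * q).
  rewrite -subr_ge0 => h; rewrite -subr_ge0; apply: le_trans h _.
  by rewrite /e le_eqVlt; apply/orP; left; apply/eqP; ring.
have X2 : ((2 * N + 1) * s) ^+ 2 <= 25 / 16.
  have -> : 25 / 16 = (5 / 4) ^+ 2 :> R by field.
  have m0 : 0 <= (2 * N + 1) * s by apply: mulr_ge0; lra.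
  by apply: lerXn2r; rewrite ?nnegrE; lra.
have Y1 : 2 * N * q ^+ 2 <= 1.
  have h1 : q ^+ 2 <= 2 * s * (2 * s).
    by rewrite expr2 ler_pM ?ltW.
  have h2 : 2 * N * q ^+ 2 <= 2 * N * (2 * s * (2 * s)).
    by rewrite ler_wpM2l// mulr_ge0// ltW.
  apply: le_trans h2 _.
  have -> : 2 * N * (2 * s * (2 * s)) = 4 * (N * s) * (2 * s) by ring.
  have h3 : 4 * (N * s) * (2 * s) <= 2 * 2^-1.
    apply: ler_pM; [|by rewrite mulr_ge0// ltW|lra|lra].
    by rewrite mulr_ge0// mulr_ge0// ltW.
  apply: le_trans h3 _; lra.
have qe : 0 <= q * e by rewrite mulr_ge0 ?ltW.
have Z : 16 * (q * e) <= 25 / 16.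
  apply: le_trans X2; apply: le_trans X1; rewrite ler_wpM2r//; lra.
have -> : 2 * N * q ^+ 3 * (P * e) = 2 * N * q ^+ 2 * (q * e * P) by ring.
(* The numbers leave ample room: [25 / 256 * (3 / 2) = 75 / 512], against [27 / 64 = 216 / 512]. *)
have U1 : q * e * P <= 25 / 256 * (3 / 2) by apply: ler_pM => //; lra.
have U2 : 2 * N * q ^+ 2 * (q * e * P) <= 1 * (25 / 256 * (3 / 2)).
  apply: ler_pM => //; rewrite ?mulr_ge0 ?sqr_ge0// ltW//.
lra.
Qed.

(** Here [q] is the norm of the gradient, [s = - v], and [L] the trace of Lambda. With [D = s L],
    clearing the denominator [s^3 D] leaves the cubic of [cubic_estimate] and two terms of
    favourable sign, which are dropped. *)
Lemma bracket_estimate (N q s : R) : 2 <= N -> 0 < q -> 0 < s -> s < (2 * N)^-1 ->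
  let F := 2 * q / s - N in
  let A := F + (1 + q ^+ 2) / s ^+ 2 in
  let K := 2 / s + 4 * q / s ^+ 2 + 2 * (1 + q ^+ 2) / s ^+ 3 in
  let L := (1 + q ^+ 2) / s - N * q in
  0 < L /\ q ^+ 2 * (K - 2 * A ^+ 2 / L) <= L ^+ 2 / (q * N).
Proof.
move=> N2 q0 s0 s1 F A K L.
have [D0 cub] := cubic_estimate N2 q0 s0 s1.
set D := (1 + q ^+ 2 - N * q * s) in D0 cub; set P := (1 + _ + _) in cub.
have N0 : 0 < N by lra.
have LE : L = D / s by rewrite /L /D; field; rewrite gt_eqF.
have P0 : 0 <= P by rewrite /P !addr_ge0 ?mulr_ge0 ?sqr_ge0// ltW.
split; first by rewrite LE divr_gt0.
have KE : q ^+ 2 * (K - 2 * A ^+ 2 / L) =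
  2 * q ^+ 2 * (P * s * ((2 * N + 1) * s - (N + 2) * q) - N ^+ 2 * s ^+ 4 - (N + 2) * q * s ^+ 3) / (s ^+ 3 * D).
  by rewrite LE /K /A /F /P /D; field; rewrite -/D !gt_eqF.
have -> : L ^+ 2 / (q * N) = D ^+ 3 * s / (q * N) / (s ^+ 3 * D).
  by rewrite LE; field; rewrite !gt_eqF.
rewrite KE; apply: ler_wpM2r; first by rewrite invr_ge0 mulr_ge0 ?exprn_ge0 ?ltW.
rewrite ler_pdivlMr ?mulr_gt0//.
have h := ler_wpM2r (ltW s0) cub.
apply: le_trans h.
rewrite -subr_ge0.
have -> : 2 * N * q ^+ 3 * (P * ((2 * N + 1) * s - (N + 2) * q)) * s -
  2 * q ^+ 2 * (P * s * ((2 * N + 1) * s - (N + 2) * q) - N ^+ 2 * s ^+ 4 - (N + 2) * q * s ^+ 3) * (q * N)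
  = 2 * N * q ^+ 3 * (N ^+ 2 * s ^+ 4 + (N + 2) * q * s ^+ 3) by ring.
have N20 : 0 <= N + 2 by lra.
by rewrite !mulr_ge0 ?addr_ge0 ?mulr_ge0 ?exprn_ge0// ?ltW.
Qed.

End ScalarInequality.

(** Put [t = |eta P|^2] and [G = tr (P W)]. As [q = p / r], [bracket_estimate] bounds the first term
    by [(r^2 / p) t (tr W)^2 / n], while [trace_gap] bounds the subtracted one below by
    [(r^2 / p) t (tr W - G)^2 / n]. The difference of the squares is at most linear in [G], and
    [t <= 1 <= n]. *)
Lemma main_term_le (R : realFieldType) (n m : nat) (W P : 'M[R]_n) (eta v w : 'rV[R]_n)
    (r p s q F A K L : R) : (2 <= n)%N -> (0 < m)%N ->
  W^T = W -> P^T = P -> P *m P = P -> P *m W = W *m P -> dot eta eta = 1 ->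
  v = p *: eta -> w = eta *m W -> 0 < p -> 0 < r -> 0 < s -> s < (2 * n%:R)^-1 ->
  q = p / r -> F = 2 * q / s - n%:R -> A = F + (1 + q ^+ 2) / s ^+ 2 ->
  K = 2 / s + 4 * q / s ^+ 2 + 2 * (1 + q ^+ 2) / s ^+ 3 ->
  L = (1 + q ^+ 2) / s - n%:R * q -> \tr W = r * L -> 0 <= \tr (P *m W) ->
  r * dot (v *m P) v * (K - 2 * A ^+ 2 / L)
    - m%:R * (r ^+ 2 / p) * (\tr (W *m W) - dot w w)
  <= 2 * r ^+ 3 * L / p * \tr (P *m W).
Proof.
move=> n2 m0 sW sP PP PW e1 vE wE p0 r0 s0 s1 qE FE AE KE LE trW G0.
have N2 : (2 : R) <= n%:R by rewrite ler_nat.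
have N0 : (0 : R) < n%:R by apply: lt_le_trans N2.
have q0 : 0 < q by rewrite qE divr_gt0.
have [L0 ineq] := bracket_estimate N2 q0 s0 s1.
rewrite -LE -FE -AE -KE in L0 ineq.
have gap := trace_gap sW sP PP PW e1.
rewrite -wE trW in gap.
set t := dot (eta *m P) eta in gap; set G := \tr (P *m W) in gap G0 *.
set Y := (\tr (W *m W) - _) in gap *.
have t0 : 0 <= t by rewrite /t -PP mulmxA dot_mulmx sP dot_ge0.
have t1 : t <= 1.
  have := dot_ge0 (eta - eta *m P); rewrite !dotE_lin e1 (dotC eta).
  have -> : dot (eta *m P) (eta *m P) = t by rewrite dot_mulmx sP -mulmxA PP dotC.
  rewrite -/t; lra.
have Y0 : 0 <= Y.
  rewrite -(pmulr_rge0 _ N0); apply: le_trans gap; by rewrite mulr_ge0 ?sqr_ge0.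
have -> : dot (v *m P) v = r ^+ 2 * q ^+ 2 * t.
  by rewrite vE -scalemxAl !dotE_lin -/t qE; field; rewrite gt_eqF.
set X := K - _ in ineq *.
have h1 : r * (r ^+ 2 * q ^+ 2 * t) * X <= r ^+ 3 * t * (L ^+ 2 / (q * n%:R)).
  have -> : r * (r ^+ 2 * q ^+ 2 * t) * X = r ^+ 3 * t * (q ^+ 2 * X) by ring.
  by rewrite ler_wpM2l// mulr_ge0// exprn_ge0// ltW.
have rp : 0 <= r ^+ 2 / p by rewrite divr_ge0 ?exprn_ge0// ltW.
have h2 : r ^+ 2 / p * (t * (r * L - G) ^+ 2 / n%:R) <= m%:R * (r ^+ 2 / p) * Y.
  rewrite (mulrC m%:R) -[leRHS]mulrA; apply: ler_wpM2l => //.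
  apply: (@le_trans _ _ Y); first by rewrite ler_pdivrMr// [leRHS]mulrC.
  by rewrite ler_peMl// ler1n.
have h3 : r ^+ 3 * t * (L ^+ 2 / (q * n%:R)) = r ^+ 2 / p * (t * (r * L) ^+ 2 / n%:R).
  by rewrite qE; field; rewrite !gt_eqF.
have h4 : r ^+ 2 / p * (t * (r * L) ^+ 2 / n%:R) - r ^+ 2 / p * (t * (r * L - G) ^+ 2 / n%:R)
   <= r ^+ 2 / p * (2 * r * L * G).
  rewrite -mulrBr; apply: ler_wpM2l => //.
  rewrite -mulrBl -mulrBr ler_pdivrMr//.
  have -> : (r * L) ^+ 2 - (r * L - G) ^+ 2 = 2 * r * L * G - G ^+ 2 by ring.
  have Z0 : 0 <= 2 * r * L * G by rewrite !mulr_ge0// ltW.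
  have Z1 : t * (2 * r * L * G - G ^+ 2) <= 2 * r * L * G.
    apply: (@le_trans _ _ (t * (2 * r * L * G))).
      by rewrite ler_wpM2l// gerBl sqr_ge0.
    by rewrite ler_piMl.
  apply: le_trans Z1 _; rewrite ler_peMr//; lra.
have -> : 2 * r ^+ 3 * L / p * G = r ^+ 2 / p * (2 * r * L * G).
  by field; rewrite gt_eqF.
rewrite h3 in h1; move: h1 h2 h4; clear.
set a := r * _ * _; set b := m%:R * _ * _; set c := r ^+ 2 / p * (t * _ / _).
set d := r ^+ 2 / p * (t * _ / _); lra.
Qed.

(** * Uniformly bounded and uniformly small families *)

Section BoundedFamilies.
Variables (R : realFieldType) (I : Type) (S : I -> Prop) (delta : I -> R).

Implicit Types f g : I -> R.

Definition bounded_on f := exists C, forall i, S i -> `|f i| <= C.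
(** [delta] stands for the quantity allowed on the right of the differential inequality; smallness
    is linear in it, with one constant for all indices. *)
Definition small_on f := exists C, forall i, S i -> `|f i| <= C * delta i.

Lemma bounded_cst c : bounded_on (fun=> c).
Proof. by exists `|c|. Qed.

Lemma boundedD f g : bounded_on f -> bounded_on g -> bounded_on (fun i => f i + g i).
Proof.
move=> [C hC] [D hD]; exists (C + D) => i Si.
by rewrite (le_trans (ler_normD _ _))// lerD ?hC ?hD.
Qed.

Lemma boundedN f : bounded_on f -> bounded_on (fun i => - f i).
Proof. by move=> [C hC]; exists C => i Si; rewrite normrN hC. Qed.

Lemma boundedM f g : bounded_on f -> bounded_on g -> bounded_on (fun i => f i * g i).
Proof.
move=> [C hC] [D hD]; exists (C * D) => i Si.
by rewrite normrM ler_pM ?hC ?hD.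
Qed.

Lemma boundedX f k : bounded_on f -> bounded_on (fun i => f i ^+ k).
Proof.
move=> [C hC]; exists (C ^+ k) => i Si.
by rewrite normrX lerXn2r ?nnegrE ?hC// (le_trans _ (hC i Si)).
Qed.

Lemma bounded_sum (J : finType) (F : J -> I -> R) :
  (forall j, bounded_on (F j)) -> bounded_on (fun i => \sum_j F j i).
Proof.
move=> h; have {h}[C hC] := @boolp.choice _ _ _ h.
exists (\sum_j C j) => i Si; rewrite (le_trans (ler_norm_sum _ _ _))//.
by apply: ler_sum => j _; exact: hC.
Qed.

Lemma smallD f g : small_on f -> small_on g -> small_on (fun i => f i + g i).
Proof.
move=> [C hC] [D hD]; exists (C + D) => i Si.
by rewrite (le_trans (ler_normD _ _))// mulrDl lerD ?hC ?hD.
Qed.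

Lemma smallN f : small_on f -> small_on (fun i => - f i).
Proof. by move=> [C hC]; exists C => i Si; rewrite normrN hC. Qed.

Lemma smallMl f g : bounded_on f -> small_on g -> small_on (fun i => f i * g i).
Proof.
move=> [C hC] [D hD]; exists (C * D) => i Si.
by rewrite normrM -mulrA ler_pM ?hC ?hD.
Qed.

Lemma smallMr f g : small_on f -> bounded_on g -> small_on (fun i => f i * g i).
Proof.
move=> [C hC] [D hD]; exists (C * D) => i Si.
by rewrite normrM mulrAC ler_pM ?hC ?hD.
Qed.

Lemma small_sum (J : finType) (F : J -> I -> R) :
  (forall j, small_on (F j)) -> small_on (fun i => \sum_j F j i).
Proof.
move=> h; have {h}[C hC] := @boolp.choice _ _ _ h.
exists (\sum_j C j) => i Si; rewrite (le_trans (ler_norm_sum _ _ _))// mulr_suml.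
by apply: ler_sum => j _; exact: hC.
Qed.

Definition bounded_mx_on m n (M : I -> 'M[R]_(m, n)) :=
  forall a b, bounded_on (fun i => M i a b).
Definition small_mx_on m n (M : I -> 'M[R]_(m, n)) :=
  forall a b, small_on (fun i => M i a b).

Lemma bounded_ext f g : (forall i, S i -> f i = g i) -> bounded_on f -> bounded_on g.
Proof. by move=> fg [C h]; exists C => i Si; rewrite -fg// h. Qed.

Lemma small_ext f g : (forall i, S i -> f i = g i) -> small_on f -> small_on g.
Proof. by move=> fg [C h]; exists C => i Si; rewrite -fg// h. Qed.

Lemma bounded_mulmx m n p (M : I -> 'M[R]_(m, n)) (N : I -> 'M[R]_(n, p)) :
  bounded_mx_on M -> bounded_mx_on N -> bounded_mx_on (fun i => M i *m N i).
Proof.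
move=> hM hN a b; apply: (@bounded_ext (fun i => \sum_j M i a j * N i j b)).
  by move=> i _; rewrite mxE.
by apply: bounded_sum => j; apply: boundedM.
Qed.

Lemma small_mulmxr m n p (M : I -> 'M[R]_(m, n)) (N : I -> 'M[R]_(n, p)) :
  bounded_mx_on M -> small_mx_on N -> small_mx_on (fun i => M i *m N i).
Proof.
move=> hM hN a b; apply: (@small_ext (fun i => \sum_j M i a j * N i j b)).
  by move=> i _; rewrite mxE.
by apply: small_sum => j; apply: smallMl.
Qed.

Lemma small_trace n (M : I -> 'M[R]_n) : small_mx_on M -> small_on (fun i => \tr (M i)).
Proof. by move=> hM; apply: small_sum. Qed.

Lemma bounded_dot n (a b : I -> 'rV[R]_n) :
  bounded_mx_on a -> bounded_mx_on b -> bounded_on (fun i => dot (a i) (b i)).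
Proof. by move=> ha hb; apply: bounded_sum => j; apply: boundedM. Qed.

Lemma small_dotl n (a b : I -> 'rV[R]_n) :
  small_mx_on a -> bounded_mx_on b -> small_on (fun i => dot (a i) (b i)).
Proof. by move=> ha hb; apply: small_sum => j; apply: smallMr. Qed.

Lemma small_dotr n (a b : I -> 'rV[R]_n) :
  bounded_mx_on a -> small_mx_on b -> small_on (fun i => dot (a i) (b i)).
Proof. by move=> ha hb; apply: small_sum => j; apply: smallMl. Qed.

Lemma bounded_mxB m n (M N : I -> 'M[R]_(m, n)) :
  bounded_mx_on M -> bounded_mx_on N -> bounded_mx_on (fun i => M i - N i).
Proof.
move=> hM hN a b; apply: (@bounded_ext (fun i => M i a b - N i a b)).
  by move=> i _; rewrite !mxE.
by apply: boundedD => //; apply: boundedN.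
Qed.

Lemma bounded_mxZ m n f (N : I -> 'M[R]_(m, n)) :
  bounded_on f -> bounded_mx_on N -> bounded_mx_on (fun i => f i *: N i).
Proof.
move=> hf hN a b; apply: (@bounded_ext (fun i => f i * N i a b)).
  by move=> i _; rewrite !mxE.
exact: boundedM.
Qed.

End BoundedFamilies.

Section RemainderEstimate.
Variables (R : realFieldType) (I : Type) (S : I -> Prop) (n m : nat).
Variables (W : I -> 'M[R]_n) (T : I -> 'I_n -> 'M[R]_n) (P : I -> 'M[R]_n).
Variables (x y z eta v w dF : I -> 'rV[R]_n) (dy deta : I -> 'M[R]_n) (r rL ip L F A A1 : I -> R).

Let delta i : R := \tr (P i *m W i) + \sum_k `|\tr (P i *m T i k)|.

Hypothesis smallPW : forall i a b, S i -> `|(P i *m W i) a b| <= \tr (P i *m W i).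
Hypothesis trPW0 : forall i, S i -> 0 <= \tr (P i *m W i).
Hypothesis PW : forall i, S i -> P i *m W i = W i *m P i.
Hypothesis zE : forall i, S i -> z i = y i *m W i.
Hypothesis wE : forall i, S i -> w i = eta i *m W i.
Hypothesis bW : bounded_mx_on S W.
Hypothesis bP : bounded_mx_on S P.
Hypothesis bx : bounded_mx_on S x.
Hypothesis by_ : bounded_mx_on S y.
Hypothesis beta_ : bounded_mx_on S eta.
Hypothesis bv : bounded_mx_on S v.
Hypothesis bdF : bounded_mx_on S dF.
Hypothesis bdy : bounded_mx_on S dy.
Hypothesis bdeta : bounded_mx_on S deta.
Hypothesis bT : forall k, bounded_mx_on S (fun i => T i k).
Hypothesis br : bounded_on S r.
Hypothesis bip : bounded_on S (fun i => (ip i)^-1).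
Hypothesis bL : bounded_on S L.
Hypothesis brL : bounded_on S (fun i => (r i * L i)^-1).
Hypothesis bF : bounded_on S F.
Hypothesis bA : bounded_on S A.
Hypothesis bA1 : bounded_on S A1.

Lemma delta_ge0 i : S i -> 0 <= delta i.
Proof. by move=> Si; rewrite addr_ge0 ?trPW0// sumr_ge0. Qed.

(** The multiple of [tr (P W)] left over by [main_term_le] is included, so that a single constant
    absorbs everything without a definite sign. *)
Lemma remainder_estimate : exists C, forall i, S i ->
  2 * r i ^+ 3 * L i / ip i * \tr (P i *m W i)
  + jet_remainder m (W i) (T i) (P i) (x i) (y i) (z i) (eta i) (v i) (w i) (dF i) (dy i) (deta i)
     (r i) (L i) (F i) (A i) (A1 i)
  <= C * delta i.
Proof.
have d0 := delta_ge0.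
have sPW : small_mx_on S delta (fun i => P i *m W i).
  move=> a b; exists 1 => i Si; rewrite mul1r (le_trans (smallPW _ _ Si))//.
  by rewrite lerDl sumr_ge0.
have sG : small_on S delta (fun i => \tr (P i *m W i)) by exact: small_trace.
have sg : small_mx_on S delta (fun i => \row_k \tr (P i *m T i k)).
  move=> a k; exists 1 => i Si; rewrite mul1r mxE /delta (bigD1 k) //= addrCA lerDl addr_ge0 ?trPW0//.
  by rewrite sumr_ge0.
(* The projection commutes with [W] and can be moved next to it: [z P = y (P W)], and likewise for
   [w]. *)
have szeta : small_mx_on S delta (fun i => z i *m P i).
  move=> a b; apply: (small_ext _ (small_mulmxr by_ sPW a b)) => i Si.
  by rewrite zE// PW// mulmxA.
have stheta : small_mx_on S delta (fun i => w i *m P i).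
  move=> a b; apply: (small_ext _ (small_mulmxr beta_ sPW a b)) => i Si.
  by rewrite wE// PW// mulmxA.
have bw : bounded_mx_on S w.
  by move=> a b; apply: (bounded_ext _ (bounded_mulmx beta_ bW a b)) => i Si; rewrite wE.
have bt : bounded_mx_on S (fun i => \row_k \tr (T i k)).
  move=> a k; apply: (@bounded_ext _ _ _ (fun i => \sum_j T i k j j)).
    by move=> i _; rewrite mxE.
  by apply: bounded_sum => j; exact: bT.
have btP := bounded_mulmx bt bP.
have bbeta : bounded_mx_on S (fun i => - (r i * L i)^-1 *: ((\row_k \tr (T i k)) *m P i)).
  by apply: bounded_mxZ => //; exact: boundedN.
have byP : bounded_mx_on S (fun i => y i - y i *m P i).
  by apply: bounded_mxB => //; exact: bounded_mulmx.
have str (M : I -> 'M[R]_n) : bounded_mx_on S M ->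
    small_on S delta (fun i => \tr (P i *m (M i *m W i))).
  move=> bM; apply: (small_ext _ (small_trace (small_mulmxr bM sPW))) => i Si.
  by rewrite PW// mulmxA mxtrace_mulC.
suff [C hC] : small_on S delta (fun i => 2 * r i ^+ 3 * L i / ip i * \tr (P i *m W i)
  + jet_remainder m (W i) (T i) (P i) (x i) (y i) (z i) (eta i) (v i) (w i) (dF i) (dy i) (deta i)
     (r i) (L i) (F i) (A i) (A1 i)).
  by exists C => i Si; apply: le_trans (hC i Si); exact: ler_norm.
rewrite /jet_remainder.
have bc c := @bounded_cst R I S c.
have bd2 : bounded_on S (fun i => dot ((\row_k \tr (T i k)) *m P i) (\row_k \tr (T i k)) / (r i * L i) ^+ 2).
  apply: (@bounded_ext _ _ _ (fun i =>
    dot ((\row_k \tr (T i k)) *m P i) (\row_k \tr (T i k)) * (r i * L i)^-1 ^+ 2)).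
    by move=> i _; rewrite exprVn.
  by apply: boundedM; [exact: bounded_dot|exact: boundedX].
have b2 : bounded_on S (fun i => 2 / (r i * L i)) by exact: boundedM.
repeat (first [ exact: sG | exact: str
 | apply: smallD | apply: smallN
 | apply: small_dotl; [assumption|assumption]
 | apply: small_dotr; [assumption|assumption]
 | apply: smallMl; [ solve [repeat first [assumption | apply: bc | apply: boundedM | apply: boundedX
      | apply: boundedD | apply: boundedN]] | ]
 | apply: smallMr; [ | solve [repeat first [assumption | apply: bc | apply: boundedM | apply: boundedX]]]]).
Qed.

End RemainderEstimate.

Lemma mul_row_outer (R : comNzRingType) (n : nat) (a b c : 'rV[R]_n) :
  a *m (b^T *m c) = dot a b *: c.
Proof.
rewrite mulmxA; apply/rowP => k; rewrite !mxE big_ord1.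
by rewrite dotE.
Qed.

Section EntryRules.
Variables (R : comNzRingType) (m n : nat).

Lemma addmx_entry (A B : 'M[R]_(m, n)) i j : (A + B) i j = A i j + B i j.
Proof. by rewrite mxE. Qed.

Lemma oppmx_entry (A : 'M[R]_(m, n)) i j : (- A) i j = - A i j.
Proof. by rewrite mxE. Qed.

Lemma scalemx_entry a (A : 'M[R]_(m, n)) i j : (a *: A) i j = a * A i j.
Proof. by rewrite mxE. Qed.

Lemma outer_entry (a b : 'rV[R]_n) i j : (a^T *m b) i j = a 0 i * b 0 j.
Proof. by rewrite !mxE big_ord1 !mxE. Qed.

Lemma scalar_mx_entry (a : R) (i j : 'I_n) : (a%:M : 'M[R]_n) i j = a * (i == j)%:R.
Proof. by rewrite mxE mulr_natr. Qed.

Lemma trmx_entry (A : 'M[R]_(m, n)) i j : A^T i j = A j i.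
Proof. by rewrite mxE. Qed.

Definition mx_entry :=
  (addmx_entry, oppmx_entry, scalemx_entry, outer_entry, scalar_mx_entry, trmx_entry).
End EntryRules.

(** * Pointwise identities in the ball chart *)

Section PointwiseGeometry.
Variables (R : realFieldType) (n : nat) (x eta v y w : 'rV[R]_n) (V2 W : 'M[R]_n) (h p r : R).
Hypothesis h0 : h != 0.
Hypothesis p0 : p != 0.
Hypothesis rE : r = h^-1.
Hypothesis xx : dot x x = 1 - 2 * h.
Hypothesis eta1 : dot eta eta = 1.
Hypothesis vE : v = p *: eta.
Hypothesis WE : W = h *: V2 - x^T *m v - v^T *m x + (dot x v - p)%:M.
Hypothesis yE : y = r *: (x - eta).
Hypothesis wE : w = eta *m W.

(** [eta *m V2] is the gradient of the Euclidean length of the differential of [v], so this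
    expresses that gradient through the tensor. *)
Lemma scaled_unit_gradient_image : h *: (eta *m V2) = w + p *: x + v.
Proof.
rewrite wE WE mulmxDr !mulmxBr !mul_row_outer -scalemxAr mul_mx_scalar vE !dotE_lin eta1 (dotC eta).
by apply/rowP => k; rewrite ![_ 0 k]mxE; move: (h * _) => a; rewrite !mxE; ring.
Qed.

(** The terms along [x] cancel, and [|x|^2 = 1 - 2 h] turns the coefficient of [v] into 2. The
    result is the defect that appears when the tensor is differentiated. *)
Lemma test_vector_image : y *m W = 2 *: v + (x - eta) *m V2.
Proof.
rewrite yE -scalemxAl WE mulmxDr !mulmxBr !mul_row_outer -!scalemxAr !mul_mx_scalar vE !dotE_lin.
rewrite eta1 (dotC eta) xx rE; move: (dot x eta) (x *m V2) (eta *m V2) => c a b.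
by apply/rowP => k; rewrite !mxE; field.
Qed.

Lemma hessian_from_tensor k l :
  V2 k l = r * (W k l + x 0 k * v 0 l + v 0 k * x 0 l - (dot x v - p) * (k == l)%:R).
Proof. by rewrite WE !mx_entry rE; field; exact: h0. Qed.

(** Second derivatives of the function enter only through the derivative of [eta]. Replacing them by
    [W] isolates [W - w^T eta], the source of the good term [tr (W W) - |w|^2]. *)
Lemma test_vector_derivative (dy : 'M[R]_n) :
  (forall k l, dy k l = x 0 k * r ^+ 2 * (x 0 l - eta 0 l)
     + r * ((k == l)%:R - p^-1 * (V2 k l - eta 0 l * (eta *m V2) 0 k))) ->
  dy = y^T *m y - (dot y y / 2)%:M - (r ^+ 2 / p) *: (W - w^T *m eta).
Proof.
move=> dyE; apply/matrixP => k l; rewrite dyE.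
have e1 : (eta *m V2) 0 k = r * (w 0 k + p * x 0 k + v 0 k).
  move: scaled_unit_gradient_image; move: (eta *m V2) => a /rowP/(_ k).
  by rewrite !mxE => <-; rewrite rE mulKf.
have yy : dot y y = r ^+ 2 * (2 - 2 * h - 2 * dot x eta).
  by rewrite yE !dotE_lin eta1 xx (dotC eta); ring.
have xv : dot x v = p * dot x eta by rewrite vE dotE_lin.
rewrite e1 hessian_from_tensor !mxE !big_ord1 !mxE -[(dot y y / 2) *+ (k == l)]mulr_natr yy xv.
have -> : v 0 l = p * eta 0 l by rewrite vE mxE.
have -> : v 0 k = p * eta 0 k by rewrite vE mxE.
have ya a : y 0 a = r * (x 0 a - eta 0 a) by rewrite yE !mxE.
rewrite !ya.
move: (W k l) (w 0 k) (dot x eta) ((k == l)%:R) (x 0 k) (x 0 l) (eta 0 k) (eta 0 l).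
rewrite rE => a b c d e f g i; field.
by rewrite h0 p0.
Qed.

End PointwiseGeometry.

(** * Orthonormal frames and nonnegative forms *)

Section Frames.
Variables (R : rcfType) (n : nat).

Definition psdmx k (M : 'M[R]_k) := forall a : 'rV[R]_k, 0 <= dot (a *m M) a.

Lemma psdmx_congr k l (M : 'M[R]_k) (B : 'M[R]_(l, k)) : psdmx M -> psdmx (B *m M *m B^T).
Proof.
move=> psd a; rewrite !mulmxA.
have -> : dot (a *m B *m M *m B^T) a = dot (a *m B *m M) (a *m B).
  by rewrite [RHS]dotE trmx_mul mulmxA dotE.
exact: psd.
Qed.

Lemma trace_gram k l (E : 'M[R]_(l, k)) (M : 'M[R]_k) :
  \tr (E *m M *m E^T) = \sum_i dot (row i E *m M) (row i E).
Proof.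
apply: eq_bigr => i _; rewrite mxE; apply: eq_bigr => j _.
by rewrite -row_mul !mxE.
Qed.

Lemma trace_gram_ge0 k l (E : 'M[R]_(l, k)) (M : 'M[R]_k) : psdmx M -> 0 <= \tr (E *m M *m E^T).
Proof. by move=> psd; rewrite trace_gram sumr_ge0. Qed.

(** Orthonormalisation is recorded as a left factor, which keeps the rows in the original span: rows
    killed by a matrix stay so, and a Gram matrix changes by congruence. *)
Lemma gram_schmidt m (E : 'M[R]_(m, n)) : (forall a : 'rV[R]_m, a *m E = 0 -> a = 0) ->
  exists T : 'M[R]_m, (T *m E) *m (T *m E)^T = 1%:M.
Proof.
elim: m E => [|m IH] E inj; first by exists 0; apply/matrixP => -[].
move: E inj; rewrite -[m.+1]/(1 + m)%N => E inj.
rewrite -[E](@vsubmxK _ 1 m n) in inj *.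
move: (usubmx _) (dsubmx _) inj => e E' inj.
have [T' orth] : exists T : 'M[R]_m, (T *m E') *m (T *m E')^T = 1%:M.
  apply: IH => a aE; have := inj (row_mx 0 a); rewrite mul_row_col mul0mx add0r => /(_ aE).
  by move=> /(congr1 (@rsubmx _ 1 1 m)); rewrite row_mxKr linear0.
set F := T' *m E' in orth.
pose c : 'rV[R]_m := e *m F^T.
pose e1 := e - c *m F.
have e1F : e1 *m F^T = 0 by rewrite mulmxBl -mulmxA orth mulmx1 subrr.
have e1n0 : dot e1 e1 != 0.
  apply/eqP => /dot_eq0 h; have := inj (row_mx 1%:M (- (c *m T'))).
  rewrite mul_row_col mul1mx mulNmx -mulmxA -/F => /(_ h).
  move=> /(congr1 (@lsubmx _ 1 1 m)); rewrite row_mxKl linear0 => /matrixP/(_ 0 0).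
  by rewrite !mxE => /eqP; rewrite oner_eq0.
have e1p : 0 < dot e1 e1 by rewrite lt_def e1n0 dot_ge0.
pose s := (Num.sqrt (dot e1 e1))^-1.
have ss : s * (s * dot e1 e1) = 1.
  rewrite mulrA -invfM -expr2 sqr_sqrtr ?ltW// mulVf//.
exists (block_mx s%:M (- (s *: (c *m T'))) 0 T').
rewrite mul_block_col mul_scalar_mx mul0mx add0r mulNmx -scalemxAl -mulmxA -/F -scalerBr -/e1.
rewrite tr_col_mx mul_col_row.
have -> : (s *: e1) *m (s *: e1)^T = 1%:M.
  apply/matrixP => i j; by rewrite !ord1 -dotE dotZl dotZr ss mxE eqxx.
have -> : s *: e1 *m F^T = 0 by rewrite -scalemxAl e1F scaler0.
have -> : F *m (s *: e1)^T = 0.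
  by rewrite -[LHS]trmxK trmx_mul trmxK -scalemxAl e1F scaler0 trmx0.
by rewrite orth -scalar_mx_block.
Qed.

Variable m : nat.

(* As [E *m C^T = 0], the Gram matrix of [E + C] is [1 + C *m C^T >= 1], so that orthonormalising its rows
   can only decrease the trace against a nonnegative [M]. *)
Lemma frame_correction (E C : 'M[R]_(m, n)) (M : 'M[R]_n) :
  E *m E^T = 1%:M -> E *m C^T = 0 -> psdmx M ->
  exists2 F : 'M[R]_(m, n), F *m F^T = 1%:M &
    \tr (F *m M *m F^T) <= \tr ((E + C) *m M *m (E + C)^T).
Proof.
move=> EE EC psd; set D := E + C.
have CE : C *m E^T = 0 by rewrite -[LHS]trmxK trmx_mul trmxK EC trmx0.
pose N := C *m C^T.
have DD : D *m D^T = 1%:M + N.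
  by rewrite /D trmxD mulmxDl !mulmxDr EE EC CE addr0 add0r.
have [a aD|T orth] := @gram_schmidt _ D.
  have : dot (a *m D *m D^T) a = 0 by rewrite aD mul0mx dot0l.
  rewrite -mulmxA DD mulmxDr mulmx1 dotDl.
  have -> : dot (a *m N) a = dot (a *m C) (a *m C) by rewrite [RHS]dotE trmx_mul !mulmxA dotE.
  move=> h; apply: dot_eq0; move: h (dot_ge0 a) (dot_ge0 (a *m C)).
  by move: (dot a a) (dot _ _) => ? ? ? ? ?; apply/eqP; rewrite eq_le; apply/andP; split; lra.
exists (T *m D) => //.
set S := D *m M *m D^T.
have SE : (T *m D) *m M *m (T *m D)^T = T *m S *m T^T by rewrite trmx_mul !mulmxA.
have psdS : psdmx S by exact: psdmx_congr.
rewrite SE; pose Y := T^T *m T.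
have TKT : T *m ((1%:M + N) *m T^T) = 1%:M by rewrite -DD -orth trmx_mul !mulmxA.
have KY : (1%:M + N) *m Y = 1%:M by rewrite mulmxA; exact: mulmx1C.
have sY : Y^T = Y by rewrite trmx_mul trmxK.
have sN : N^T = N by rewrite trmx_mul trmxK.
have YK : Y *m (1%:M + N) = 1%:M by exact: mulmx1C.
have YN : N *m Y = Y *m N.
  apply: (addrI Y); rewrite -[X in X + _]mul1mx -mulmxDl KY -[X in X + _]mulmx1.
  by rewrite -mulmxDr YK.
have Y1 : Y + N *m Y = 1%:M by rewrite -[X in X + _]mul1mx -mulmxDl.
(* Since [Y] is the inverse of [1 + N], this writes the excess [1 - Y = N Y] as a sum of two
   products, each giving a nonnegative trace against [S]. *)
have NY : N *m Y = Y *m N *m Y + (N *m Y) *m (N *m Y).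
  by rewrite -[LHS]mulmx1 -[in LHS]Y1 mulmxDr -[in RHS]YN.
have -> : \tr (T *m S *m T^T) = \tr (S *m Y).
  by rewrite -mulmxA mxtrace_mulC -mulmxA.
have -> : \tr S = \tr (S *m Y) + \tr (S *m (N *m Y)).
  by rewrite -mxtraceD -mulmxDr Y1 mulmx1.
rewrite lerDl NY mulmxDr mxtraceD addr_ge0//.
  have := trace_gram_ge0 (C^T *m Y) psdS.
  have -> : (C^T *m Y)^T = Y *m C by rewrite trmx_mul trmxK sY.
  have -> : C^T *m Y *m S *m (Y *m C) = C^T *m (Y *m (S *m (Y *m C))) by rewrite !mulmxA.
  rewrite mxtrace_mulC.
  have -> : Y *m (S *m (Y *m C)) *m C^T = Y *m (S *m (Y *m N)) by rewrite /N !mulmxA.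
  by rewrite mxtrace_mulC !mulmxA.
have := trace_gram_ge0 (N *m Y) psdS.
have -> : (N *m Y)^T = N *m Y by rewrite trmx_mul sY sN YN.
by rewrite -mulmxA mxtrace_mulC -!mulmxA.
Qed.

Lemma linear_term_eq0 (a b : R) : 0 <= b -> (forall t, 0 <= 2 * t * a + t ^+ 2 * b) -> a = 0.
Proof.
move=> b0 key; apply/eqP; apply/negPn/negP => an0.
have b1 : 0 < b + 1 by lra.
(* The minimiser would be [- a / b]; adding 1 keeps the denominator positive when [b = 0]. *)
have := key (- a / (b + 1)).
have -> : 2 * (- a / (b + 1)) * a + (- a / (b + 1)) ^+ 2 * b = - (a ^+ 2 * (b + 2) / (b + 1) ^+ 2).
  by field; rewrite gt_eqF.
rewrite oppr_ge0 leNgt => /negP; apply.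
by rewrite divr_gt0 ?exprn_gt0// mulr_gt0 ?exprn_even_gt0//; lra.
Qed.

(** Vary [E] along [C = E M (1 - P)], the part of the gradient orthogonal to the frame. The first
    variation is [tr (C C^T)], which must vanish, so the span of [E] is invariant under [M]. *)
Lemma minimal_frame_stationary (E : 'M[R]_(m, n)) (M : 'M[R]_n) :
  E *m E^T = 1%:M -> M^T = M -> psdmx M ->
  (forall F : 'M[R]_(m, n), F *m F^T = 1%:M -> \tr (E *m M *m E^T) <= \tr (F *m M *m F^T)) ->
  (E^T *m E) *m M = M *m (E^T *m E).
Proof.
move=> EE sM psd Emin; set P := E^T *m E.
have PP : P *m P = P := proj_idem EE (erefl _).
have sP : P^T = P := projT (erefl P).
have EP : E *m P = E by rewrite mulmxA EE mul1mx.
pose C := E *m M *m (1%:M - P).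
have EC : E *m C^T = 0.
  rewrite /C !trmx_mul trmxB trmx1 sP !mulmxA.
  by rewrite mulmxBr mulmx1 EP subrr !mul0mx.
pose a := \tr (E *m M *m C^T); pose b := \tr (C *m M *m C^T).
have key t : 0 <= 2 * t * a + t ^+ 2 * b.
  have tC : (t *: C)^T = t *: C^T by apply/matrixP => i j; rewrite !mxE.
  have EtC : E *m (t *: C)^T = 0 by rewrite tC -scalemxAr EC scaler0.
  have [F FF h] := frame_correction EE EtC psd.
  have := le_trans (Emin F FF) h.
  rewrite trmxD tC !mulmxDl !mulmxDr !mxtraceD -!scalemxAl -!scalemxAr !mxtraceZ.
  have -> : \tr (C *m M *m E^T) = a.
    by rewrite -mxtrace_tr trmx_mul trmxK [(C *m M)^T]trmx_mul sM mulmxA.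
  rewrite -/a -/b -subr_ge0 => h'; apply: le_trans h' _; rewrite le_eqVlt; apply/orP; left.
  by apply/eqP; ring.
have b0 : 0 <= b by exact: trace_gram_ge0.
have a0 : a = 0 := linear_term_eq0 b0 key.
have CC : \tr (C *m C^T) = a.
  rewrite /a {1}/C /C !trmx_mul trmxB trmx1 sP !mulmxA.
  rewrite -[_ *m (1%:M - P) *m (1%:M - P)]mulmxA.
  have -> : (1%:M - P) *m (1%:M - P) = 1%:M - P.
    by rewrite mulmxBr mulmx1 mulmxBl mul1mx PP subrr subr0.
  by [].
have C0 : C = 0.
  apply/row_matrixP => i; rewrite row0; apply: dot_eq0.
  have : \sum_i dot (row i C) (row i C) = 0.
    apply: etrans (etrans CC a0); apply: eq_bigr => k _; rewrite mxE; apply: eq_bigr => j _.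
    by rewrite !mxE.
  move=> /eqP; rewrite psumr_eq0 => [/allP h|j _]; last exact: dot_ge0.
  by have /eqP := h i (mem_index_enum i).
have EM : E *m M = E *m M *m P.
  by apply/eqP; rewrite -subr_eq0 -[X in X - _]mulmx1 -mulmxBr -/C C0.
have h1 : P *m M = P *m M *m P by rewrite /P -!mulmxA [E *m (M *m _)]mulmxA -EM.
(* [P M P] is symmetric, so transposing [P M = P M P] gives the commutation. *)
have := congr1 trmx h1; rewrite [(P *m M)^T]trmx_mul [(P *m M *m P)^T]trmx_mul [(P *m M)^T]trmx_mul sP sM.
by rewrite mulmxA -h1.
Qed.

End Frames.

(** * Rank and eigenvalues of a symmetric matrix *)

Section Spectrum.
Import complex.
Local Open Scope complex_scope.

Lemma mxrank_diag (F : fieldType) n (d : 'rV[F]_n) :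
  \rank (diag_mx d) = count (fun a => a != 0) [seq d 0 i | i <- enum 'I_n].
Proof.
elim: n d => [|n IH] d; first by rewrite (size0nil (size_enum_ord 0)) [diag_mx d]flatmx0 mxrank0.
rewrite enum_ordSl /= -map_comp.
have -> : \rank (diag_mx d) =
    (\rank (diag_mx (lsubmx (d : 'rV_(1 + n)))) + \rank (diag_mx (rsubmx (d : 'rV_(1 + n)))))%N.
  by rewrite -rank_diag_block_mx -diag_mx_row hsubmxK.
congr (_ + _)%N.
  have -> : diag_mx (lsubmx (d : 'rV_(1 + n))) = (d 0 ord0)%:M.
    apply/matrixP => a b; rewrite !ord1 !mxE eqxx; congr (d _ _ *+ _); exact/val_inj.
  have [->|d0] := eqVneq (d 0 ord0) 0; first by rewrite raddf0 mxrank0.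
  by rewrite -scalemx1 mxrank_scale_nz// mxrank1.
rewrite IH; congr count; apply: eq_map => i /=.
by rewrite !mxE; congr (d _ _); apply: val_inj.
Qed.

Lemma char_poly_similar (F : fieldType) n (P A : 'M[F]_n) : P \in unitmx ->
  char_poly (invmx P *m A *m P) = char_poly A.
Proof.
move=> uP; rewrite /char_poly /char_poly_mx.
have PP : map_mx polyC (invmx P) *m map_mx polyC P = 1%:M by rewrite -map_mxM mulVmx// map_mx1.
have -> : 'X%:M - map_mx polyC (invmx P *m A *m P) =
    map_mx polyC (invmx P) *m ('X%:M - map_mx polyC A) *m map_mx polyC P.
  rewrite mulmxBr mulmxBl !map_mxM; congr (_ - _).
  by rewrite scalar_mxC -mulmxA PP mulmx1.
rewrite !det_mulmx mulrC mulrA -det_mulmx.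
by rewrite (mulmx1C PP) det1 mul1r.
Qed.

(** Over [R[i]] the matrix is Hermitian, hence unitarily diagonalisable with real diagonal;
    characteristic polynomial and rank are unchanged by the field extension. This links matrix rank
    to the count of eigenvalues in [has_rank_at]. *)
Lemma symmetric_eigenvalues (R : rcfType) n (M : 'M[R]_n) : M^T = M ->
  exists2 s : seq R, char_poly M = \prod_(a <- s) ('X - a%:P) & count (fun a => a != 0) s = \rank M.
Proof.
move=> sM; pose f := real_complex R; pose A : 'M[R[i]]_n := map_mx f M.
have herm : A \is hermsymmx.
  apply: realsym_hermsym.
    by apply/is_hermitianmxP; rewrite expr0 scale1r map_mx_id// /A map_trmx sM.
  by apply/mxOverP => i j; rewrite mxE; apply/Creal_ImP; rewrite -complexIm.
have /mxOverP real := hermitian_spectral_diag_real herm.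
have /orthomx_spectralP := hermitian_normalmx herm.
have uP := spectral_unit A.
move: (spectralmx A) (spectral_diag A) real uP => P d real uP AE.
pose s := [seq complex.Re (d 0 i) | i <- enum 'I_n].
have sE i : f (complex.Re (d 0 i)) = d 0 i.
  by apply: RRe_real; exact: real.
exists s.
  apply: (map_poly_inj f); rewrite map_char_poly -/A AE char_poly_similar//.
  rewrite char_poly_trig ?diag_mx_is_trig// rmorph_prod big_map big_enum /=.
  by apply: eq_bigr => i _; rewrite rmorphB /= map_polyX map_polyC mxE eqxx; congr ('X - _%:P); exact/esym/sE.
rewrite -(mxrank_map f) -/A AE.
rewrite -mulmxA eqmxMfull ?row_full_unit ?unitmx_inv// mxrankMfree ?row_free_unit//.
rewrite mxrank_diag !count_map; apply: eq_count => i /=.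
by rewrite -[in RHS]sE fmorph_eq0.
Qed.

End Spectrum.

Section Nullity.
Variables (R : rcfType) (n : nat).

(** Along [a + t (a M)] the form is [2 t |a M|^2] plus a multiple of [t^2], and it stays nonnegative
    for both signs of [t]. *)
Lemma psdmx_null (M : 'M[R]_n) (a : 'rV[R]_n) : M^T = M -> psdmx M -> dot (a *m M) a = 0 -> a *m M = 0.
Proof.
move=> sM psd a0; apply: dot_eq0.
pose b := a *m M; apply: (@linear_term_eq0 _ _ (dot (b *m M) b)) => [|t]; first exact: psd.
have := psd (a + t *: b); rewrite mulmxDl -scalemxAl !dotE_lin a0 -/b.
have -> : dot (b *m M) a = dot b b.
  by rewrite dot_mulmx sM dotC.
by move: (dot b b) (dot _ _) => c e; congr (0 <= _); ring.
Qed.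

(** The rows of a null frame are null vectors of a nonnegative form, hence lie in the kernel;
    conversely independent kernel vectors are orthonormalised. Rank thus becomes a condition suited
    to minimisation. *)
Lemma null_frame m (M : 'M[R]_n) : M^T = M -> psdmx M ->
  (exists E : 'M[R]_(m, n), E *m E^T = 1%:M /\ \tr (E *m M *m E^T) = 0) <-> (m <= n - \rank M)%N.
Proof.
move=> sM psd; split=> [[E [EE E0]]|].
  have EM : E *m M = 0.
    apply/row_matrixP => i; rewrite row0 row_mul; apply: psdmx_null => //.
    move/eqP: E0; rewrite trace_gram psumr_eq0 => [/allP h|j _]; last exact: psd.
    by have /eqP := h i (mem_index_enum i).
  rewrite -mxrank_ker -(_ : \rank E = m); first by apply: mxrankS; exact/sub_kermxP.
  by apply/eqP; apply/row_freeP; exists E^T.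
move=> mr.
have [B [freeB BM]] : exists B : 'M[R]_(m, n), row_free B /\ B *m M = 0.
  rewrite -mxrank_ker in mr.
  exists (pid_mx m *m row_base (kermx M)); split.
    rewrite /row_free mxrankMfree ?row_base_free// rank_pid_mx//.
  by rewrite -mulmxA (_ : row_base _ *m M = 0) ?mulmx0//; apply/sub_kermxP; rewrite eq_row_base.
have [|T orth] := @gram_schmidt _ _ _ B.
  move=> a aB; have [B' BB'] := row_freeP freeB.
  by rewrite -[a]mulmx1 -BB' mulmxA aB mul0mx.
exists (T *m B); split => //.
by rewrite -[T *m B *m M]mulmxA BM mulmx0 mul0mx mxtrace0.
Qed.

End Nullity.

(** * Calculus on open sets of coordinate space *)

Section Lines.
Variables (R : realType) (V : normedModType R).
Implicit Types (f : V -> R) (a v : V).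

Lemma is_derive_line f a v (t : R) : derivable f (a + t *: v) v ->
  is_derive t 1 (fun t => f (a + t *: v)) ('D_v f (a + t *: v)).
Proof.
have E : (fun h : R => h^-1 *: (((fun t => f (a + t *: v)) \o shift t) (h *: 1) - f (a + t *: v)))
  = (fun h : R => h^-1 *: ((f \o shift (a + t *: v)) (h *: v) - f (a + t *: v))).
  apply/funext => h /=; rewrite [h *: 1]mulr1 scalerDl.
  by rewrite addrCA.
by move=> df; split; rewrite /derivable /derive E.
Qed.

(** Restriction to the line through [a] along [v] reduces this to the chain rule in one variable. *)
Lemma is_derive_comp_line (F : R -> R) f (a v : V) (df dF : R) :
  is_derive a v f df -> is_derive (f a) 1 F dF ->
  is_derive a v (F \o f) (dF * df).
Proof.
move=> [f1 f2] FdF; pose g h : R := f (h *: v + a).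
have E (k : V -> R) : derivable k a v -> 'D_v k a = derive1 (fun h : R => k (h *: v + a)) 0.
  move=> dk; rewrite derive1E /derive.
  suff -> : (fun h : R => h^-1 *: ((k \o shift a) (h *: v) - k a)) =
    (fun h : R => h^-1 *: (((fun h : R => k (h *: v + a)) \o shift 0) (h *: 1) - k (0 *: v + a))) by [].
  by apply/funext => h /=; rewrite [h *: 1]mulr1 addr0 scale0r add0r.
have g0 : g 0 = f a by rewrite /g scale0r add0r.
have gdf : is_derive (0 : R) 1 g df.
  have d1 : derivable g 0 1 := (derivable1P f a v).1 f1.
  by split => //; rewrite -derive1E; exact: etrans (esym (E f f1)) f2.
have Fg : is_derive (g 0) 1 F dF by rewrite g0.
have [D1 D2] := is_derive1_comp Fg gdf.
have D3 : derivable (F \o f) a v := (derivable1P (F \o f) a v).2 D1.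
split => //; apply: etrans (E (F \o f) D3) _.
by rewrite derive1E; exact: D2.
Qed.

End Lines.

Section Smoothness.
Variables (R : realType) (n : nat) (U : set 'rV[R]_n).
Hypothesis openU : open U.
Implicit Types (f g : 'rV[R]_n -> R) (i j : 'I_n).

(** A finite order is kept because the tensor involves two derivatives of [v] and is itself
    differentiated twice: order 4 for [v] gives order 2 for the tensor away from critical points. *)
Fixpoint Ck (k : nat) f : Prop :=
  (forall x, U x -> {for x, continuous f}) /\
  if k is k'.+1 then
    (forall i x, U x -> derivable f x (delta_mx 0 i)) /\
    (forall i, Ck k' (partial i f))
  else True.

Lemma Ck_continuous k f x : Ck k f -> U x -> {for x, continuous f}.
Proof. by case: k => [|k] [] + _; apply. Qed.

Lemma Ck_derivable k f x i : Ck k.+1 f -> U x -> derivable f x (delta_mx 0 i).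
Proof. by move=> [_ [+ _]]; apply. Qed.

Arguments Ck_continuous {k f x}.
Arguments Ck_derivable {k f x} i.

Lemma Ck_partial k f i : Ck k.+1 f -> Ck k (partial i f).
Proof. by move=> [_ [_]]; apply. Qed.

Lemma CkW k f : Ck k.+1 f -> Ck k f.
Proof.
elim: k f => [|k IH] f [cf [df pf]]; split => //.
by split => // i; apply: IH; exact: pf.
Qed.

Lemma Ck_le k l f : (k <= l)%N -> Ck l f -> Ck k f.
Proof.
elim: l => [|l IH]; first by rewrite leqn0 => /eqP ->.
by rewrite leq_eqVlt => /orP[/eqP->//|/IH] + /CkW; apply.
Qed.

Lemma Ck_smooth k f : smooth_on U f -> Ck k f.
Proof.
have H s : smooth_on U f -> Ck k (iter_partial s f).
  move=> sf; elim: k s => [|k IH] s; split; try by move=> x /(sf s)[].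
    by [].
  split => [i x /(sf s)[_]|i]; first exact.
  exact: (IH (i :: s)).
exact: (H [::]).
Qed.

Let near_U x g h : U x -> (forall y, U y -> g y = h y) ->
  {near x, (g : 'rV[R]_n -> R) =1 h}.
Proof.
move=> Ux gh; have : nbhs x U by exact: open_nbhs_nbhs.
by apply: filterS.
Qed.

Lemma partial_ext f g i x : (forall y, U y -> f y = g y) -> U x ->
  partial i f x = partial i g x.
Proof. by move=> fg Ux; apply: near_eq_derive; exact: near_U. Qed.

Lemma Ck_ext k f g : (forall y, U y -> f y = g y) -> Ck k f -> Ck k g.
Proof.
elim: k f g => [|k IH] f g fg.
  move=> [cf _]; split => // x Ux.
  move: (cf _ Ux); rewrite /prop_for/continuous_at (fg _ Ux) => h.
  by apply: cvg_trans h; exact: near_eq_cvg (near_U Ux fg).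
move=> [cf [df pf]]; split.
  move=> x Ux; move: (cf _ Ux); rewrite /prop_for/continuous_at (fg _ Ux) => h.
  by apply: cvg_trans h; exact: near_eq_cvg (near_U Ux fg).
split => [i x Ux|i].
  by apply: (@near_eq_derivable _ _ _ f) (df i x Ux); exact: near_U.
apply: IH (pf i) => y Uy; exact: partial_ext.
Qed.

(** The partial derivatives need only be given by formulas valid on [U]; this drives the inductions
    on the order below. *)
Lemma CkS k f (df : 'I_n -> 'rV[R]_n -> R) :
  (forall i x, U x -> is_derive x (delta_mx 0 i) f (df i x)) ->
  (forall x, U x -> {for x, continuous f}) ->
  (forall i, Ck k (df i)) -> Ck k.+1 f.
Proof.
move=> h cf hk; split => //; split => [i x /(h i)[]//|i].
by apply: Ck_ext (hk i) => y /(h i)[_] <-.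
Qed.

Lemma Ck_is_derive k f i x : Ck k.+1 f -> U x ->
  is_derive x (delta_mx 0 i) f (partial i f x).
Proof. by move=> kf Ux; apply/derivableP; exact: (Ck_derivable i kf Ux). Qed.

Lemma Ck_cst k (c : R) : Ck k (fun=> c).
Proof.
elim: k c => [|k IH] c.
  by split => // x _; exact: cst_continuous.
apply: (@CkS k _ (fun _ _ => 0)).
- by move=> x _; exact: cst_continuous.
- by move=> *; exact: IH.
Qed.

Lemma is_derive_coord (x w : 'rV[R]_n) i :
  is_derive x w (fun y : 'rV[R]_n => y 0 i : R) (w 0 i).
Proof.
have E (h : R) : h \in [set h | h != 0] ->
  h^-1 *: (((fun y : 'rV[R]_n => y 0 i : R) \o shift x) (h *: w) - x 0 i) = w 0 i.
  by rewrite inE /= => h0; rewrite !mxE addrK [LHS]mulrA mulVf// mul1r.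
have H : (fun h : R => h^-1 *: (((fun y : 'rV[R]_n => y 0 i : R) \o shift x) (h *: w) - x 0 i)) @ 0^' --> w 0 i.
  apply: (@cvg_trans _ ((fun=> w 0 i) @ 0^')); last exact: cvg_cst.
  apply: near_eq_cvg; near=> h; rewrite E// inE /=.
  by near: h; exact: nbhs_dnbhs_neq.
split; first by apply/cvg_ex; exists (w 0 i).
exact: cvg_lim H.
Unshelve. all: by end_near. Qed.

Lemma Ck_coord k i : Ck k (fun x : 'rV[R]_n => x 0 i).
Proof.
case: k => [|k]; first by split => // x _; exact: coord_continuous.
apply: (@CkS k _ (fun j _ => (i == j)%:R)) => [j x Ux|x _|j].
- have := is_derive_coord x (delta_mx 0 j) i.
  by rewrite !mxE eqxx /=.
- exact: coord_continuous.
- exact: Ck_cst.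
Qed.

Lemma partial_coord i j x : partial j (fun x : 'rV[R]_n => x 0 i) x = (i == j)%:R.
Proof.
by have [_] := is_derive_coord x (delta_mx 0 j) i; rewrite mxE eqxx.
Qed.

Lemma CkD k f g : Ck k f -> Ck k g -> Ck k (fun x => f x + g x).
Proof.
elim: k f g => [|k IH] f g kf kg.
  by split => // x Ux; apply: continuousD; [exact: (Ck_continuous kf)|exact: (Ck_continuous kg)].
apply: (@CkS k _ (fun i x => partial i f x + partial i g x)) => [i x Ux|x Ux|i].
- apply: is_deriveD; exact: (@Ck_is_derive k).
- by apply: continuousD; [exact: (Ck_continuous kf)|exact: (Ck_continuous kg)].
- by apply: IH; exact: Ck_partial.
Qed.

Lemma partialD f g i x : Ck 1 f -> Ck 1 g -> U x ->
  partial i (fun x => f x + g x) x = partial i f x + partial i g x.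
Proof. by move=> kf kg Ux; rewrite /partial deriveD//; apply: (@Ck_derivable 0 _ _ i). Qed.

Lemma CkN k f : Ck k f -> Ck k (fun x => - f x).
Proof.
elim: k f => [|k IH] f kf.
  by split => // x Ux; exact: continuousN (Ck_continuous kf Ux).
apply: (@CkS k _ (fun i x => - partial i f x)) => [i x Ux|x Ux|i].
- by apply: is_deriveN; exact: (@Ck_is_derive k).
- by apply: continuousN; exact: (Ck_continuous kf).
- by apply: IH; exact: Ck_partial.
Qed.

Lemma partialN f i x : Ck 1 f -> U x ->
  partial i (fun x => - f x) x = - partial i f x.
Proof. by move=> kf Ux; rewrite /partial deriveN//; apply: (@Ck_derivable 0 _ _ i). Qed.

Lemma CkB k f g : Ck k f -> Ck k g -> Ck k (fun x => f x - g x).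
Proof. by move=> kf kg; apply: CkD => //; exact: CkN. Qed.

Lemma partialB f g i x : Ck 1 f -> Ck 1 g -> U x ->
  partial i (fun x => f x - g x) x = partial i f x - partial i g x.
Proof. by move=> kf kg Ux; rewrite /partial deriveB//; apply: (@Ck_derivable 0 _ _ i). Qed.

Lemma CkM k f g : Ck k f -> Ck k g -> Ck k (fun x => f x * g x).
Proof.
elim: k f g => [|k IH] f g kf kg.
  by split => // x Ux; apply: continuousM; [exact: (Ck_continuous kf)|exact: (Ck_continuous kg)].
apply: (@CkS k _ (fun i x => f x * partial i g x + g x * partial i f x)) => [i x Ux|x Ux|i].
- apply: is_deriveM; exact: (@Ck_is_derive k).
- by apply: continuousM; [exact: (Ck_continuous kf)|exact: (Ck_continuous kg)].
- by apply: CkD; apply: IH; [exact: CkW|exact: Ck_partial|exact: CkW|exact: Ck_partial].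
Qed.

Lemma partialM f g i x : Ck 1 f -> Ck 1 g -> U x ->
  partial i (fun x => f x * g x) x = partial i f x * g x + f x * partial i g x.
Proof.
move=> kf kg Ux; rewrite /partial deriveM; try exact: (@Ck_derivable 0 _ _ i).
by rewrite addrC mulrC.
Qed.

Lemma Ck_sum k (I : Type) (s : seq I) (P : pred I) (F : I -> 'rV[R]_n -> R) :
  (forall a, Ck k (F a)) -> Ck k (fun x => \sum_(i <- s | P i) F i x).
Proof.
move=> kF; elim: s => [|a s IH].
  by apply: Ck_ext (@Ck_cst k 0) => y _; rewrite big_nil.
have [Pa|Pa] := boolP (P a).
  by apply: Ck_ext (CkD (kF a) IH) => y _; rewrite big_cons Pa.
by apply: Ck_ext IH => y _; rewrite big_cons (negbTE Pa).
Qed.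

Lemma partial_sum (I : Type) (s : seq I) (P : pred I) (F : I -> 'rV[R]_n -> R) i x :
  (forall a, Ck 1 (F a)) -> U x ->
  partial i (fun x => \sum_(j <- s | P j) F j x) x = \sum_(j <- s | P j) partial i (F j) x.
Proof.
move=> kF Ux; elim: s => [|a s IH].
  rewrite big_nil /partial.
  by under eq_fun do rewrite big_nil; exact: derive_cst.
rewrite big_cons.
under eq_fun do rewrite big_cons.
have [Pa|Pa] := boolP (P a); last exact: IH.
by rewrite partialD ?IH//; exact: Ck_sum.
Qed.

Lemma Ck_comp_cvg (F : R -> R) f x : {for f x, continuous F} ->
  {for x, continuous f} -> {for x, continuous (F \o f)}.
Proof. by move=> cF cf; exact: continuous_comp. Qed.

Lemma CkV k f : (forall x, U x -> f x != 0) -> Ck k f -> Ck k (fun x => (f x)^-1).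
Proof.
move=> f0.
have c g : Ck 0 g -> (forall x, U x -> g x != 0) -> (forall x, U x -> {for x, continuous (fun x => (g x)^-1)}).
  by move=> kg g0 x Ux; apply: continuousV; [exact: g0|exact: (Ck_continuous kg)].
elim: k f f0 => [|k IH] f f0 kf; first by split => //; exact: c.
apply: (@CkS k _ (fun i x => - ((f x)^-1 * (f x)^-1) * partial i f x)) => [i x Ux|x Ux|i].
- have df := Ck_derivable i kf Ux; split; first by apply: derivableV => //; exact: f0.
  rewrite deriveV; [|exact: f0|exact: (Ck_derivable i kf Ux)].
  by rewrite expr2 invfM.
- by apply: c => //; apply: Ck_le kf.
- apply: CkM; last exact: Ck_partial.
  by apply: CkN; apply: CkM; apply: IH => //; exact: CkW.
Qed.

Lemma partialV f i x : Ck 1 f -> (forall x, U x -> f x != 0) -> U x ->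
  partial i (fun x => (f x)^-1) x = - partial i f x / f x ^+ 2.
Proof.
move=> kf f0 Ux; rewrite /partial deriveV; [|exact: f0|exact: (@Ck_derivable 0 _ _ i)].
by rewrite scaleNr mulNr; congr (- _); rewrite [RHS]mulrC.
Qed.

Lemma Ck_sqrt k f : (forall x, U x -> 0 < f x) -> Ck k f -> Ck k (fun x => Num.sqrt (f x)).
Proof.
move=> f0 kf.
have c : (forall x, U x -> {for x, continuous (fun x => Num.sqrt (f x))}).
  move=> x Ux; apply: (@Ck_comp_cvg Num.sqrt); last exact: (Ck_continuous kf).
  exact: sqrt_continuous.
elim: k kf => [|k IH] kf //.
apply: (@CkS k _ (fun i x => (2 * Num.sqrt (f x))^-1 * partial i f x)) => [i x Ux|//|i].
- apply: (@is_derive_comp_line _ _ Num.sqrt); first exact: (@Ck_is_derive k).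
  by apply: is_derive1_sqrt; exact: f0.
- apply: CkM; last exact: Ck_partial.
  apply: CkV => [x Ux|].
    by rewrite mulf_neq0 ?pnatr_eq0// gt_eqF// sqrtr_gt0 f0.
  by apply: CkM; [exact: Ck_cst|apply: IH; exact: CkW].
Qed.

Lemma Ck_expR k f : Ck k f -> Ck k (fun x => expR (f x)).
Proof.
move=> kf.
have c : (forall x, U x -> {for x, continuous (fun x => expR (f x))}).
  move=> x Ux; apply: (@Ck_comp_cvg expR); last exact: (Ck_continuous kf).
  exact: continuous_expR.
elim: k kf => [|k IH] kf; first by split.
apply: (@CkS k _ (fun i x => expR (f x) * partial i f x)) => [i x Ux|//|i].
- apply: (@is_derive_comp_line _ _ expR); first exact: (@Ck_is_derive k).
- by apply: CkM; [apply: IH; exact: CkW|exact: Ck_partial].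
Qed.

Lemma partial_expR f i x : Ck 1 f -> U x ->
  partial i (fun x => expR (f x)) x = expR (f x) * partial i f x.
Proof.
move=> kf Ux.
have [|_ <-//] := @is_derive_comp_line _ _ expR f x (delta_mx 0 i) (partial i f x) (expR (f x)).
exact: (@Ck_is_derive 0).
Qed.

End Smoothness.

Arguments Ck_continuous {R n U k f x}.
Arguments Ck_derivable {R n U k f x} i.
Arguments Ck_is_derive {R n U k f} i {x}.
Arguments Ck_partial {R n U k f} i.

(** * Symmetry of second derivatives and the second derivative test *)

Section Second.
Variables (R : realType) (n : nat) (U : set 'rV[R]_n).
Hypothesis openU : open U.
Implicit Types (f g : 'rV[R]_n -> R) (i j : 'I_n).

Lemma open_parallelogram (A : set 'rV[R]_n) x (v w : 'rV[R]_n) : open A -> A x -> exists2 e : R, 0 < e & forall s t : R,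
  `|s| < e -> `|t| < e -> A (x + s *: v + t *: w).
Proof.
move=> oA Ax; have : nbhs x A by exact: open_nbhs_nbhs.
move=> /nbhs_ballP[e /= e0 he].
pose M := `|v| + `|w| + 1.
have M0 : 0 < M by rewrite ltr_wpDl// addr_ge0.
exists (e / M); first by rewrite divr_gt0.
move=> s t hs ht; apply: he; rewrite -ball_normE /= -addrA opprD addrA subrr add0r normrN.
rewrite (le_lt_trans (ler_normD _ _))// !normrZ.
have h1 : `|s| * `|v| <= e / M * `|v| by rewrite ler_wpM2r// ltW.
have h2 : `|t| * `|w| <= e / M * `|w| by rewrite ler_wpM2r// ltW.
rewrite (le_lt_trans (lerD h1 h2))// -mulrDr.
rewrite -[ltRHS](@divfK _ M) ?gt_eqF//.
by rewrite ltr_pM2l ?divr_gt0// /M ltrDl.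
Qed.

Lemma MVT_line f x v (h : R) : 0 < h ->
  (forall t, 0 <= t <= h -> derivable f (x + t *: v) v) ->
  exists2 c, 0 < c < h & f (x + h *: v) - f x = 'D_v f (x + c *: v) * h.
Proof.
move=> h0 df.
have [||c] := @MVT R (fun t => f (x + t *: v)) (fun t => 'D_v f (x + t *: v)) 0 h h0.
- move=> t; rewrite in_itv /= => /andP[t0 th]; apply: is_derive_line; apply: df.
  by rewrite !ltW.
- apply: derivable_within_continuous => t; rewrite in_itv /= => th.
  by have [] := is_derive_line (df t th).
by rewrite in_itv /= scale0r addr0 subr0 => c0 e; exists c.
Qed.

(** The mean value theorem is used twice: along [i] for the increment [g] in direction [j], then
    along [j] for [partial i f]. *)
Let second_difference f x i j (e : R) : Ck U 2 f -> U x -> 0 < e ->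
  (forall s t : R, `|s| < e -> `|t| < e -> U (x + s *: delta_mx 0 i + t *: delta_mx 0 j)) ->
  forall h, 0 < h < e -> exists s t, [/\ 0 < s < h, 0 < t < h &
    (f (x + h *: delta_mx 0 i + h *: delta_mx 0 j) - f (x + h *: delta_mx 0 i))
    - (f (x + h *: delta_mx 0 j) - f x) =
    partial j (partial i f) (x + s *: delta_mx 0 i + t *: delta_mx 0 j) * h * h].
Proof.
move=> f2 Ux e0 hU h /andP[h0 he].
set ei := delta_mx 0 i; set ej := delta_mx 0 j.
have bd (t : R) : 0 <= t <= h -> `|t| < e.
  by move=> /andP[t0 th]; rewrite ger0_norm// (le_lt_trans th).
have n0 : `|0 : R| < e by rewrite normr0.
have hh : `|h| < e by rewrite gtr0_norm.
pose g y := f (y + h *: ej) - f y.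
have dg (t : R) : 0 <= t <= h -> is_derive (x + t *: ei) ei g
    (partial i f (x + t *: ei + h *: ej) - partial i f (x + t *: ei)).
  move=> /bd ht; apply: is_deriveB; last first.
    by apply: (Ck_is_derive i f2); have := hU t 0 ht n0; rewrite scale0r addr0.
  have d := Ck_is_derive i f2 (hU t h ht hh).
  case: d => d1 d2.
  have E : (fun h0 : R => h0^-1 *: (((fun y => f (y + h *: ej)) \o shift (x + t *: ei)) (h0 *: ei) - f (x + t *: ei + h *: ej)))
     = (fun h0 : R => h0^-1 *: ((f \o shift (x + t *: ei + h *: ej)) (h0 *: ei) - f (x + t *: ei + h *: ej))).
    by apply/funext => u /=; rewrite !addrA.
  by split; rewrite /derivable /derive E.
have [|s s0h es] := @MVT_line g x ei h h0.
  by move=> t /dg[].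
have sh : 0 <= s <= h by case/andP: s0h => ? ?; rewrite !ltW.
have [_ ds] := dg s sh; rewrite ds in es.
have [|t t0h et] := @MVT_line (partial i f) (x + s *: ei) ej h h0.
  move=> t /bd ht; have [//] := Ck_is_derive j (Ck_partial i f2) (hU s t (bd s sh) ht).
exists s, t; split => //.
by rewrite -/ei -/ej -[LHS]/(g (x + h *: ei) - g x) es et.
Qed.

Let close_halves (a b c e : R) : `|a - c| < e / 2 -> `|b - c| < e / 2 -> `|a - b| <= e.
Proof.
by rewrite !ltr_norml ler_norml => /andP[? ?] /andP[? ?]; apply/andP; split; lra.
Qed.

(** A second difference is symmetric in the two directions, so the two mixed derivatives agree at
    two points near [x]; continuity at [x] makes their difference arbitrarily small. *)
Lemma schwarz f i j x : Ck U 2 f -> U x ->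
  partial i (partial j f) x = partial j (partial i f) x.
Proof.
move=> f2 Ux.
pose ei : 'rV[R]_n := delta_mx 0 i; pose ej : 'rV[R]_n := delta_mx 0 j.
apply/eqP; rewrite -subr_eq0 -normr_le0; apply/ler_addgt0Pr => e e0; rewrite add0r.
have e20 : 0 < e / 2 by rewrite divr_gt0.
have cij : {for x, continuous (partial i (partial j f))}.
  exact: (Ck_continuous (Ck_partial i (Ck_partial j f2))).
have cji : {for x, continuous (partial j (partial i f))}.
  exact: (Ck_continuous (Ck_partial j (Ck_partial i f2))).
have [A [oA Ax hA]] : exists A : set 'rV[R]_n, [/\ open A, A x & forall y, A y ->
   `|partial i (partial j f) x - partial i (partial j f) y| < e / 2 /\
   `|partial j (partial i f) x - partial j (partial i f) y| < e / 2].
  have h1 := (@cvgrPdist_lt _ _ _ _ _ _ _).1 cij _ e20.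
  have h2 := (@cvgrPdist_lt _ _ _ _ _ _ _).1 cji _ e20.
  have : nbhs x [set y | `|partial i (partial j f) x - partial i (partial j f) y| < e / 2 /\
   `|partial j (partial i f) x - partial j (partial i f) y| < e / 2].
    exact: (@filterI _ (nbhs x) _ _ _ (h1 _) (h2 _)).
  by rewrite nbhsE => -[A [oA Ax] h]; exists A; split.
have [d1 d10 hd1] := open_parallelogram ei ej openU Ux.
have [d2 d20 hd2] := open_parallelogram ei ej oA Ax.
pose d := Num.min d1 d2.
have d0 : 0 < d by rewrite lt_min d10.
pose h := d / 2.
have h0 : 0 < h by rewrite divr_gt0.
have hd : h < d by rewrite /h; lra.
have hh : 0 < h < d by rewrite h0.
have H1 s t : `|s| < d -> `|t| < d -> U (x + s *: ei + t *: ej).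
  by rewrite !lt_min => /andP[? _] /andP[? _]; exact: hd1.
have H2 s t : `|s| < d -> `|t| < d -> U (x + s *: ej + t *: ei).
  by move=> ? ?; rewrite addrAC; exact: H1.
have H3 s t : `|s| < d -> `|t| < d -> A (x + s *: ei + t *: ej).
  by rewrite !lt_min => /andP[_ ?] /andP[_ ?]; exact: hd2.
have [s [t [s0 t0 E1]]] := second_difference f2 Ux d0 H1 hh.
have [s' [t' [s'0 t'0 E2]]] := second_difference f2 Ux d0 H2 hh.
have bd (u : R) : 0 < u < h -> `|u| < d.
  by move=> /andP[u0 uh]; rewrite gtr0_norm// (lt_trans uh).
have E : partial j (partial i f) (x + s *: ei + t *: ej) =
         partial i (partial j f) (x + s' *: ej + t' *: ei).
  have E3 : partial j (partial i f) (x + s *: ei + t *: ej) * h * h =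
         partial i (partial j f) (x + s' *: ej + t' *: ei) * h * h.
    apply: (etrans (esym E1)); apply: (etrans _ E2).
    rewrite [x + h *: delta_mx 0 j + h *: delta_mx 0 i]addrAC.
    by rewrite !opprB addrACA [RHS]addrACA; congr (_ + _); exact: addrC.
  have hn0 : h != 0 by rewrite gt_eqF.
  by have /(mulIf hn0)/(mulIf hn0) := E3.
have [_ a1] := hA _ (H3 s t (bd _ s0) (bd _ t0)).
have [+ _] := hA _ (H3 t' s' (bd _ t'0) (bd _ s'0)).
rewrite addrAC => a2; rewrite E in a1; exact: close_halves a2 a1.
Qed.

Lemma second_derivative_test f i x (e : R) : Ck U 2 f -> U x -> 0 < e ->
  (forall t : R, `|t| < e -> f x <= f (x + t *: delta_mx 0 i)) ->
  partial i f x = 0 /\ 0 <= partial i (partial i f) x.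
Proof.
move=> f2 Ux e0 fmin; pose ei : 'rV[R]_n := delta_mx 0 i.
have [d1 d10 hd1] := open_parallelogram ei ei openU Ux.
pose d := Num.min e d1.
have d0 : 0 < d by rewrite lt_min e0.
have hU (t : R) : `|t| < d -> U (x + t *: ei).
  rewrite lt_min => /andP[_ td].
  by have := hd1 t 0 td; rewrite scale0r addr0 normr0; exact.
have dl (t : R) : `|t| < d ->
   is_derive t 1 (fun t => f (x + t *: ei)) (partial i f (x + t *: ei)).
  by move=> td; exact: (is_derive_line (Ck_derivable i f2 (hU t td))).
have D0 : partial i f x = 0.
  have h : is_derive (0 : R) (1 : R) (fun t : R => f (x + t *: ei)) 0.
    apply: (@derive1_at_min _ _ (- d) d).
    - lra.
    - move=> t; rewrite in_itv /= -ltr_norml => /dl[]//.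
    - by rewrite in_itv /=; apply/andP; split; lra.
    - move=> t; rewrite in_itv /= -ltr_norml => td.
      rewrite scale0r addr0; apply: fmin; apply: lt_le_trans td _.
      by rewrite ge_min lexx.
  have [_] := h; have [|_ ->] := dl 0; first by rewrite normr0.
  by rewrite scale0r addr0.
split => //; rewrite leNgt; apply/negP => neg.
have d' : derivable (partial i f) x ei by exact: (Ck_derivable i (Ck_partial i f2)).
move: d' => /cvg_ex[l hl].
have ll : l = partial i (partial i f) x by rewrite /partial /derive (cvg_lim _ hl).
rewrite ll in hl.
(* A negative second derivative makes [partial i f] negative just after [x], so by the mean value
   theorem [f] would fall below its minimum. *)
have : \forall h \near (0 : R)^', h^-1 *: ((partial i f \o shift x) (h *: ei) - partial i f x) < 0.
  move/cvgrPdist_lt : hl => /(_ (- partial i (partial i f) x)).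
  rewrite oppr_gt0 => /(_ neg); apply: filterS => h.
  rewrite ltr_norml => /andP[]; set a := partial i (partial i f) x; set b := _ *: _.
  by rewrite opprK => ? ?; lra.
rewrite /= D0 => -[r /= r0 hr].
pose h := Num.min r d / 2.
have m0 : 0 < Num.min r d by rewrite lt_min r0.
have h0 : 0 < h by rewrite divr_gt0.
have [hr' hd'] : h < r /\ h < d.
  have : h < Num.min r d by rewrite /h; lra.
  by rewrite lt_min => /andP.
have [|c /andP[c0 ch]] := @MVT_line f x ei h h0.
  move=> t /andP[t0 th]; apply: (Ck_derivable i f2); apply: hU.
  by rewrite ger0_norm// (le_lt_trans th).
rewrite -/(partial i f _) => E.
have := hr c; rewrite /ball_ /= sub0r normrN gtr0_norm// => /(_ (lt_trans ch hr')).
rewrite gt_eqF// => /(_ isT); rewrite subr0 [c *: ei + x]addrC.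
rewrite -[_ *: _]/(_ * _) pmulr_rlt0 ?invr_gt0// => pn.
have : f x <= f (x + h *: ei).
  apply: fmin; rewrite gtr0_norm//; apply: lt_le_trans hd' _.
  by rewrite ge_min lexx.
rewrite -subr_ge0 E leNgt => /negP; apply.
by rewrite pmulr_llt0.
Qed.

End Second.

(** * The tensor in the ball chart *)

Section ChartFunctions.
Variables (R : realType) (n : nat) (v : 'rV[R]_n -> R).
Implicit Types (x : 'rV[R]_n) (i j k l : 'I_n).

(* The metric is [half_gap^-2] times the Euclidean one, and [scaled_tensor] is [half_gap] times the
   tensor Lambda of the theorem (see [hyp_tensorE]). *)
Definition half_gap x : R := (1 - sqnorm x) / 2.
Definition slope x : R := Num.sqrt (\sum_(i < n) partial i v x ^+ 2).
Definition scaled_tensor_entry i j x : R :=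
  half_gap x * partial j (partial i v) x - x 0 i * partial j v x - x 0 j * partial i v x
  + (\sum_(l < n) x 0 l * partial l v x - slope x) * (i == j)%:R.
Definition scaled_tensor x : 'M[R]_n := \matrix_(i, j) scaled_tensor_entry i j x.
Definition unit_gradient x : 'rV[R]_n := (slope x)^-1 *: differential v x.
(** Chosen so that the Codazzi defect of the tensor is its image under the tensor itself; projected
    on a nearly null frame the defect is then small. *)
Definition test_vector x : 'rV[R]_n := (half_gap x)^-1 *: (x - unit_gradient x).

End ChartFunctions.

Section Chart.
Variables (R : realType) (n : nat) (U : set 'rV[R]_n) (v : 'rV[R]_n -> R).
Hypothesis openU : open U.
Hypothesis vC : Ck U 4 v.
Hypothesis U_ball : forall x, U x -> sqnorm x < 1.
Hypothesis U_neg : forall x, U x -> v x < 0.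
Hypothesis U_slope : forall x, U x -> 0 < \sum_(i < n) partial i v x ^+ 2.
Implicit Types (x : 'rV[R]_n) (i j k l : 'I_n).

Lemma Ck_sqr (a : nat) f : Ck U a f -> Ck U a (fun x => f x ^+ 2).
Proof. by move=> kf; exact: (CkM openU kf kf). Qed.

Lemma partial_sqr i f x : Ck U 1 f -> U x ->
  partial i (fun x => f x ^+ 2) x = 2 * f x * partial i f x.
Proof.
move=> kf Ux; have := partialM i kf kf Ux.
by rewrite -[X in partial i X]/(fun x => f x ^+ 2) => ->; ring.
Qed.

Lemma partial_cst i (c : R) x : partial i (fun=> c) x = 0.
Proof. exact: derive_cst. Qed.

Lemma partial_scale i c f x : Ck U 1 f -> U x ->
  partial i (fun x => c * f x) x = c * partial i f x.
Proof.
move=> kf Ux; rewrite (partialM i (Ck_cst openU 1 c) kf Ux).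
by rewrite partial_cst mul0r add0r.
Qed.

Lemma partial_scaler i c f x : Ck U 1 f -> U x ->
  partial i (fun x => f x * c) x = partial i f x * c.
Proof.
move=> kf Ux; rewrite (partialM i kf (Ck_cst openU 1 c) Ux).
by rewrite partial_cst mulr0 addr0.
Qed.

Lemma partial_sum_ord (F : 'I_n -> 'rV[R]_n -> R) i x :
  (forall j, Ck U 1 (F j)) -> U x ->
  partial i (fun x => \sum_(j < n) F j x) x = \sum_(j < n) partial i (F j) x.
Proof. by move=> cF Ux; exact: (partial_sum openU). Qed.

Lemma Ck_differential (a : nat) i : (a <= 3)%N -> Ck U a (partial i v).
Proof. by move=> k3; apply: (Ck_le k3); exact: Ck_partial. Qed.

Lemma Ck_second (a : nat) i j : (a <= 2)%N -> Ck U a (partial i (partial j v)).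
Proof. by move=> k3; apply: (Ck_le k3); do 2 apply: Ck_partial. Qed.

Lemma Ck_half_gap (a : nat) : Ck U a (@half_gap R n).
Proof.
apply: CkM => //; last exact: Ck_cst.
apply: CkB => //; first exact: Ck_cst.
by apply: Ck_sum => // i; apply: Ck_sqr; exact: Ck_coord.
Qed.

Lemma half_gap_gt0 x : U x -> 0 < half_gap x.
Proof. by move=> /U_ball h; rewrite divr_gt0// subr_gt0. Qed.

Lemma partial_half_gap i x : U x -> partial i (@half_gap R n) x = - x 0 i.
Proof.
move=> Ux.
have cs : Ck U 1 (@sqnorm R n) by apply: Ck_sum => // j; apply: Ck_sqr; exact: Ck_coord.
have c1 := Ck_cst openU 1 (1 : R).
rewrite (partial_scaler i _ (CkB openU c1 cs) Ux) (partialB i c1 cs Ux) partial_cst.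
rewrite (partial_sum_ord i (fun j => Ck_sqr (Ck_coord openU 1 j)) Ux).
under eq_bigr => j _ do rewrite (partial_sqr i (Ck_coord openU 1 j) Ux) partial_coord.
rewrite (bigD1 i) //= eqxx big1 ?addr0 => [|j /negbTE ->]; last by rewrite mulr0.
rewrite /= mulr1 sub0r mulNr; congr (- _); by field.
Qed.

Lemma Ck_slope (a : nat) : (a <= 3)%N -> Ck U a (slope v).
Proof.
move=> k3; apply: Ck_sqrt => //.
by apply: Ck_sum => // i; apply: Ck_sqr; exact: Ck_differential.
Qed.

Lemma slope_gt0 x : U x -> 0 < slope v x.
Proof. by move=> /U_slope h; rewrite sqrtr_gt0. Qed.

Lemma slope_sqr x : U x -> slope v x ^+ 2 = \sum_(i < n) partial i v x ^+ 2.
Proof. by move=> /U_slope h; rewrite sqr_sqrtr// ltW. Qed.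

Lemma partial_slope i x : U x ->
  partial i (slope v) x = \sum_(l < n) unit_gradient v x 0 l * partial i (partial l v) x.
Proof.
move=> Ux; have p0 := slope_gt0 Ux.
(* Both sides are derivatives of the square of [slope], a polynomial in the first derivatives of
   [v]. *)
have H : 2 * slope v x * partial i (slope v) x
   = 2 * \sum_(l < n) partial l v x * partial i (partial l v) x.
  rewrite -partial_sqr//; last exact: Ck_slope.
  rewrite (partial_ext openU (g := fun x => \sum_(i < n) partial i v x ^+ 2) _ _ Ux); last exact: slope_sqr.
  rewrite (@partial_sum_ord (fun j x => partial j v x ^+ 2))//; last first.
    by move=> j; apply: Ck_sqr; exact: Ck_differential.
  rewrite mulr_sumr; apply: eq_bigr => l _; rewrite partial_sqr ?mulrA//.
  exact: Ck_differential.
have n2 : 2 * slope v x != 0 by rewrite mulf_neq0 ?gt_eqF.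
apply: (mulfI n2); rewrite H -mulrA; congr (_ * _); rewrite mulr_sumr.
by apply: eq_bigr => l _; rewrite !mxE mulrA mulVKf// gt_eqF.
Qed.

Lemma Ck_scaled_tensor (a : nat) i j : (a <= 2)%N -> Ck U a (scaled_tensor_entry v i j).
Proof.
move=> k2; have k3 : (a <= 3)%N by apply: leq_trans k2 _.
apply: CkD => //; last first.
  apply: CkM => //; last exact: Ck_cst.
  apply: CkB => //; last exact: Ck_slope.
  by apply: Ck_sum => // l; apply: CkM => //; [exact: Ck_coord|exact: Ck_differential].
apply: CkB => //; last by apply: CkM => //; [exact: Ck_coord|exact: Ck_differential].
apply: CkB => //; last by apply: CkM => //; [exact: Ck_coord|exact: Ck_differential].
by apply: CkM => //; [exact: Ck_half_gap|exact: Ck_second].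
Qed.

Let product_rule_terms (h d3 d2 djk dik pk dj di dk s a b c xk xi xj : R) :
  - xk * d2 + h * d3 - (a * dj + xi * djk) - (b * di + xj * dik) + (dk + s - pk) * c =
  h * d3 - xk * d2 - a * dj - xi * djk - b * di - xj * dik + (dk + s - pk) * c.
Proof. ring. Qed.

Lemma partial_scaled_tensor k i j x : U x ->
  partial k (scaled_tensor_entry v i j) x =
  half_gap x * partial k (partial j (partial i v)) x - x 0 k * partial j (partial i v) x
  - (i == k)%:R * partial j v x - x 0 i * partial k (partial j v) x
  - (j == k)%:R * partial i v x - x 0 j * partial k (partial i v) x
  + (partial k v x + \sum_(l < n) x 0 l * partial k (partial l v) x - partial k (slope v) x) * (i == j)%:R.
Proof.
move=> Ux.
have c1 := Ck_half_gap 1.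
have c2 i' j' : Ck U 1 (partial i' (partial j' v)) by exact: Ck_second.
have c3 i' : Ck U 1 (partial i' v) by exact: Ck_differential.
have c4 i' : Ck U 1 (fun x => x 0 i') by exact: Ck_coord.
have c5 : Ck U 1 (slope v) by exact: Ck_slope.
have c6 i' j' := CkM openU (c4 i') (c3 j').
have c7 := Ck_sum openU (index_enum 'I_n) xpredT (fun l => c6 l l).
have c8 := CkM openU c1 (c2 j i).
have c9 := CkB openU c7 c5.
have c10 := CkB openU c8 (c6 i j).
have c11 := CkB openU c10 (c6 j i).
have c12 := CkM openU c9 (Ck_cst openU 1 (i == j)%:R).
rewrite (partialD k c11 c12 Ux) (partialB k c10 (c6 _ _) Ux) (partialB k c8 (c6 _ _) Ux).
rewrite (partial_scaler k _ c9 Ux) (partialB k c7 c5 Ux) (partialM k c1 (c2 j i) Ux).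
rewrite (partialM k (c4 i) (c3 j) Ux) (partialM k (c4 j) (c3 i) Ux) partial_half_gap//.
rewrite (partial_sum_ord k (fun l => c6 l l) Ux).
under eq_bigr => l _ do rewrite (partialM k (c4 l) (c3 l) Ux) partial_coord.
rewrite big_split /= !partial_coord.
have -> : \sum_(i < n) (i == k)%:R * partial i v x = partial k v x.
  rewrite (bigD1 k) //= eqxx mul1r big1 ?addr0// => l /negbTE ->.
  by rewrite mul0r.
exact: product_rule_terms.
Qed.

End Chart.

(** * The Codazzi equation and the derivatives of the auxiliary vectors *)

Section ChartIdentities.
Variables (R : realType) (n : nat) (U : set 'rV[R]_n) (v : 'rV[R]_n -> R).
Hypothesis openU : open U.
Hypothesis vC : Ck U 4 v.
Hypothesis U_ball : forall x, U x -> sqnorm x < 1.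
Hypothesis U_slope : forall x, U x -> 0 < \sum_(i < n) partial i v x ^+ 2.
Implicit Types (x : 'rV[R]_n) (i j k l : 'I_n).

Definition hessian_mx x : 'M[R]_n := \matrix_(i, j) partial i (partial j v) x.
Definition gradient_image x : 'rV[R]_n := unit_gradient v x *m scaled_tensor v x.
Definition test_image x : 'rV[R]_n := test_vector v x *m scaled_tensor v x.

Local Notation W := (scaled_tensor v).
Local Notation eta := (unit_gradient v).
Local Notation y := (test_vector v).
Local Notation w := gradient_image.
Local Notation z := test_image.
Local Notation r x := ((half_gap x)^-1).
Local Notation p := (slope v).
Local Notation dv := (differential v).
Local Notation V2 := hessian_mx.

Lemma hessian_sym i j x : U x -> partial i (partial j v) x = partial j (partial i v) x.
Proof. by move=> Ux; apply: (schwarz openU) Ux; exact: (@Ck_le _ _ U 2 4). Qed.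

Lemma hessian_mx_sym x : U x -> (V2 x)^T = V2 x.
Proof. by move=> Ux; apply/matrixP => i j; rewrite !mxE; exact: hessian_sym. Qed.

Lemma slope_neq0 x : U x -> p x != 0.
Proof. by move=> Ux; rewrite gt_eqF//; exact: (slope_gt0 U_slope). Qed.

Lemma half_gap_neq0 x : U x -> half_gap x != 0.
Proof. by move=> Ux; rewrite gt_eqF//; exact: (half_gap_gt0 U_ball). Qed.

Lemma differentialE x : U x -> dv x = p x *: eta x.
Proof. by move=> Ux; rewrite /unit_gradient scalerA divff ?scale1r//; exact: slope_neq0. Qed.

Lemma dot_unit_gradient x : U x -> dot (eta x) (eta x) = 1.
Proof.
move=> Ux; rewrite /unit_gradient !dotE_lin.
have -> : dot (dv x) (dv x) = p x ^+ 2.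
  by rewrite (slope_sqr U_slope)//; apply: eq_bigr => i _; rewrite mxE expr2.
by move: (p x) (slope_neq0 Ux) => a a0; field.
Qed.

Lemma scaled_tensor_mx x : U x ->
  W x = half_gap x *: V2 x - x^T *m dv x - (dv x)^T *m x + (dot x (dv x) - p x)%:M.
Proof.
move=> Ux; apply/matrixP => i j; rewrite !mxE !big_ord1 !mxE /scaled_tensor_entry.
have -> : dot x (dv x) = \sum_(l < n) x 0 l * partial l v x.
  by apply: eq_bigr => l _; rewrite mxE.
rewrite -[(_ - p x) *+ _]mulr_natr (hessian_sym i j Ux); congr (_ - _ + _).
exact: mulrC.
Qed.

Lemma scaled_tensor_sym x : U x -> (W x)^T = W x.
Proof.
move=> Ux; rewrite scaled_tensor_mx// trmxD !trmxB !trmx_mul !trmxK tr_scalar_mx.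
have -> : (half_gap x *: V2 x)^T = half_gap x *: V2 x.
  by rewrite -[in RHS]hessian_mx_sym//; apply/matrixP => i j; rewrite !mxE.
by congr (_ + _); rewrite addrAC.
Qed.

Lemma dot_self_half_gap x : dot x x = 1 - 2 * half_gap x.
Proof.
rewrite /half_gap; have -> : sqnorm x = dot x x.
  by apply: eq_bigr => i _; rewrite expr2.
by field.
Qed.

Lemma slope_gradient x : U x -> \row_k partial k p x = eta x *m V2 x.
Proof.
move=> Ux; apply/rowP => k; rewrite [LHS]mxE [RHS]mxE (partial_slope openU vC U_slope)//.
by apply: eq_bigr => l _; rewrite [V2 x l k]mxE (hessian_sym k l Ux).
Qed.

Lemma slope_gradientE x : U x ->
  half_gap x *: (eta x *m V2 x) = w x + p x *: x + dv x.
Proof.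
move=> Ux; exact: (scaled_unit_gradient_image (dot_unit_gradient Ux) (differentialE Ux)
  (scaled_tensor_mx Ux)).
Qed.

Lemma test_imageE k x : U x -> z x 0 k =
  2 * partial k v x + \sum_(l < n) x 0 l * partial k (partial l v) x - partial k p x.
Proof.
move=> Ux.
have := test_vector_image (half_gap_neq0 Ux) (erefl _) (dot_self_half_gap x) (dot_unit_gradient Ux)
  (differentialE Ux) (scaled_tensor_mx Ux) (erefl _).
rewrite /test_image /test_vector => ->; rewrite mulmxBl -slope_gradient//.
have -> : x *m V2 x = \row_k \sum_(l < n) x 0 l * partial k (partial l v) x.
  by apply/rowP => j; rewrite !mxE; apply: eq_bigr => l _; rewrite mxE (hessian_sym l j Ux).
by rewrite !mxE addrA.
Qed.

Let Wk (i j : 'I_n) : Ck U 2 (scaled_tensor_entry v i j).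
Proof. exact: Ck_scaled_tensor. Qed.
Let W1 (i j : 'I_n) : Ck U 1 (scaled_tensor_entry v i j).
Proof. exact: Ck_scaled_tensor. Qed.

Let codazzi_algebra (h1 h2 h3 h4 h5 h6 h6' h7 h8 h9 s s' xi xj xk dik djk dij : R) :
  h1 * h2 - xk * h3 - dik * h7 - xi * h4 - djk * h8 - xj * h5 + (h9 + s - h6) * dij =
  h1 * h2 - xj * h5 - dij * h9 - xi * h4 - djk * h8 - xk * h3 + (h7 + s' - h6') * dik +
  dij * (2 * h9 + s - h6) - dik * (2 * h7 + s' - h6').
Proof. ring. Qed.

(** Third derivatives cancel by symmetry. The derivatives of [half_gap], of the coordinates and of
    [slope] leave terms in the Kronecker symbols only, which [test_imageE] recognises as [z]. *)
Lemma codazzi i j k x : U x ->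
  partial k (scaled_tensor_entry v i j) x = partial j (scaled_tensor_entry v i k) x
   + (i == j)%:R * z x 0 k - (i == k)%:R * z x 0 j.
Proof.
move=> Ux; rewrite !test_imageE// !(partial_scaled_tensor openU vC U_slope)//.
have -> : partial j (partial k (partial i v)) x = partial k (partial j (partial i v)) x.
  by apply: (schwarz openU) Ux; apply: (@Ck_le _ _ U 2 3) => //; exact: Ck_partial.
rewrite (hessian_sym j k Ux) [k == j]eq_sym.
exact: codazzi_algebra.
Qed.

Lemma Ck_inv_half_gap (a : nat) : Ck U a (fun x => r x).
Proof.
by apply: (CkV openU) => [x Ux|]; [exact: half_gap_neq0|exact: (Ck_half_gap openU)].
Qed.

Lemma partial_inv_half_gap k x : U x -> partial k (fun x => r x) x = x 0 k * r x ^+ 2.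
Proof.
move=> Ux; rewrite (partialV k (Ck_half_gap openU 1))//; last exact: half_gap_neq0.
by rewrite (partial_half_gap openU)// opprK exprVn.
Qed.

Lemma Ck_unit_gradient (a : nat) l : (a <= 3)%N -> Ck U a (fun x => eta x 0 l).
Proof.
move=> a3; apply: (Ck_ext openU (f := fun x => (slope v x)^-1 * partial l v x)).
  by move=> x _; rewrite !mxE.
apply: (CkM openU); last exact: (Ck_differential vC).
by apply: (CkV openU) => [x Ux|]; [exact: slope_neq0|exact: (Ck_slope openU vC U_slope)].
Qed.

Lemma partial_unit_gradient k l x : U x -> partial k (fun x => eta x 0 l) x =
  (p x)^-1 * (V2 x k l - eta x 0 l * (eta x *m V2 x) 0 k).
Proof.
move=> Ux.
have cp := Ck_slope openU vC U_slope (isT : (1 <= 3)%N).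
rewrite (partial_ext openU (g := fun x => (slope v x)^-1 * partial l v x) _ _ Ux); last first.
  by move=> t _; rewrite !mxE.
rewrite (partialM k (CkV openU slope_neq0 cp) (Ck_differential vC l (isT : (1 <= 3)%N)) Ux).
rewrite (partialV k cp slope_neq0 Ux) -slope_gradient// !mxE.
by move: (p x) (slope_neq0 Ux) (partial k p x) (partial l v x) (partial k _ x) => a a0 b c d; field.
Qed.

Lemma Ck_test_vector (a : nat) l : (a <= 3)%N -> Ck U a (fun x => y x 0 l).
Proof.
move=> a3; apply: (Ck_ext openU (f := fun x => r x * (x 0 l - eta x 0 l))).
  by move=> x _; rewrite [RHS]mxE [X in _ = _ * X]mxE [X in _ = _ * (_ + X)]mxE.
apply: (CkM openU); first exact: Ck_inv_half_gap.
by apply: (CkB openU); [exact: Ck_coord|exact: Ck_unit_gradient].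
Qed.

Definition jacobian_test x : 'M[R]_n := \matrix_(k, l) partial k (fun x => y x 0 l) x.
Definition jacobian_unit x : 'M[R]_n := \matrix_(k, l) partial k (fun x => eta x 0 l) x.

Lemma jacobian_testE x : U x -> jacobian_test x =
  (y x)^T *m y x - (dot (y x) (y x) / 2)%:M
  - (r x ^+ 2 / p x) *: (W x - (w x)^T *m eta x).
Proof.
move=> Ux.
apply: (test_vector_derivative (half_gap_neq0 Ux) (slope_neq0 Ux) (erefl _) (dot_self_half_gap x)
  (dot_unit_gradient Ux) (differentialE Ux) (scaled_tensor_mx Ux) (erefl _) (erefl _)).
move=> k l; rewrite [LHS]mxE.
rewrite (partial_ext openU (g := fun x => r x * (x 0 l - eta x 0 l)) _ _ Ux); last first.
  by move=> t _; rewrite [LHS]mxE [X in _ * X = _]mxE [X in _ * (_ + X) = _]mxE.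
have c1 := Ck_inv_half_gap 1.
have c2 := Ck_coord openU 1 l.
have c3 := Ck_unit_gradient l (isT : (1 <= 3)%N).
rewrite (partialM k c1 (CkB openU c2 c3) Ux) (partialB k c2 c3 Ux) partial_coord.
by rewrite partial_inv_half_gap// partial_unit_gradient// (eq_sym l k).
Qed.

Lemma Ck_gradient_image (a : nat) i : (a <= 2)%N -> Ck U a (fun x => w x 0 i).
Proof.
move=> a2; apply: (Ck_ext openU (f := fun x => \sum_(l < n) eta x 0 l * scaled_tensor_entry v l i x)).
  by move=> x _; rewrite [RHS]mxE; apply: eq_bigr => l _; rewrite [W x l i]mxE.
apply: (Ck_sum openU) => l; apply: (CkM openU).
  by apply: Ck_unit_gradient; apply: leq_trans a2 _.
exact: (Ck_scaled_tensor openU vC U_slope).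
Qed.

Lemma partial_row_image (f : 'rV[R]_n -> 'rV[R]_n) (J : 'M[R]_n) j i x : U x ->
  (forall l, Ck U 1 (fun x => f x 0 l)) ->
  (forall l, partial j (fun x => f x 0 l) x = J j l) ->
  partial j (fun x => (f x *m W x) 0 i) x =
  (f x *m \matrix_(a, b) partial j (scaled_tensor_entry v a b) x) 0 i + (J *m W x) j i.
Proof.
move=> Ux cf fJ.
rewrite (partial_ext openU (g := fun x => \sum_(l < n) f x 0 l * scaled_tensor_entry v l i x) _ _ Ux);
  last first.
  by move=> t _; rewrite mxE; apply: eq_bigr => l _; rewrite [W t l i]mxE.
rewrite (partial_sum_ord openU j (fun l => CkM openU (cf l) (W1 l i)) Ux).
rewrite [X in X + _]mxE [X in _ + X]mxE -big_split; apply: eq_bigr => l _ /=.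
rewrite (partialM j (cf l) (W1 l i) Ux) fJ addrC.
by rewrite [(\matrix_(_, _) _) l i]mxE [W x l i]mxE.
Qed.

End ChartIdentities.

(** * The trace equation differentiated twice *)

Section TraceEquation.
Variables (R : realType) (n : nat) (v : 'rV[R]_n -> R).
Implicit Types (x : 'rV[R]_n).
(* [coefL] is the trace of the endomorphism associated with Lambda; its differential is
   [coefF *: gradient_image + coefA *: differential v], and the differential of [coefA] is
   [coefA1 *: gradient_image + hess_coefK *: differential v]. *)
Definition hyp_slope x : R := half_gap x * slope v x.
Definition coefL x : R := (1 + hyp_slope x ^+ 2) * (- v x)^-1 - n%:R * hyp_slope x.
Definition coefF x : R := 2 * hyp_slope x * (- v x)^-1 - n%:R.
Definition coefA x : R := coefF x + (1 + hyp_slope x ^+ 2) * ((- v x)^-1) ^+ 2.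
Definition coefA1 x : R := 2 * (- v x)^-1 + 2 * hyp_slope x * ((- v x)^-1) ^+ 2.
Definition hess_coefK x : R := 2 * (- v x)^-1 + 4 * hyp_slope x * ((- v x)^-1) ^+ 2
  + 2 * (1 + hyp_slope x ^+ 2) * ((- v x)^-1) ^+ 3.
Definition tensor_partial x (k : 'I_n) : 'M[R]_n :=
  \matrix_(i, j) partial k (scaled_tensor_entry v i j) x.
Definition trace_hessian x : 'M[R]_n :=
  \matrix_(j, i) partial j (fun x => \tr (tensor_partial x i)) x.
Definition tensor_laplacian x : 'M[R]_n :=
  \matrix_(i, j) \sum_k partial k (partial k (scaled_tensor_entry v i j)) x.

Variable U : set 'rV[R]_n.
Hypothesis openU : open U.
Hypothesis vC : Ck U 4 v.
Hypothesis U_ball : forall x, U x -> sqnorm x < 1.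
Hypothesis U_neg : forall x, U x -> v x < 0.
Hypothesis U_slope : forall x, U x -> 0 < \sum_(i < n) partial i v x ^+ 2.
Hypothesis trace_eq : forall x, U x -> \tr (scaled_tensor v x) = (half_gap x)^-1 * coefL x.

Local Notation W := (scaled_tensor v).
Local Notation T := tensor_partial.
Local Notation eta := (unit_gradient v).
Local Notation y := (test_vector v).
Local Notation w := (gradient_image v).
Local Notation z := (test_image v).
Local Notation r x := ((half_gap x)^-1).
Local Notation p := (slope v).
Local Notation dv := (differential v).
Local Notation L := coefL.
Local Notation F := coefF.
Local Notation A := coefA.
Local Notation K := hess_coefK.
Local Notation A1 := coefA1.
Local Notation u x := ((- v x)^-1).

Let v1 : Ck U 1 v. Proof. exact: (@Ck_le _ _ U 1 4). Qed.

Let negv0 x : U x -> - v x != 0.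
Proof. by move=> /U_neg h; rewrite oppr_eq0 lt_eqF. Qed.

Lemma Ck_inv_neg (a : nat) : (a <= 4)%N -> Ck U a (fun x => u x).
Proof.
move=> a4; apply: (CkV openU negv0); apply: (CkN openU); exact: (@Ck_le _ _ U a 4).
Qed.
Let u1 := Ck_inv_neg (isT : (1 <= 4)%N).

Lemma partial_inv_neg k x : U x -> partial k (fun x => u x) x = dv x 0 k * u x ^+ 2.
Proof.
move=> Ux; rewrite (partialV k (CkN openU v1) negv0 Ux) (partialN k v1 Ux).
by rewrite opprK mxE exprVn.
Qed.

Lemma Ck_hyp_slope (a : nat) : (a <= 3)%N -> Ck U a hyp_slope.
Proof.
move=> a3; apply: (CkM openU); first exact: (Ck_half_gap openU).
exact: (Ck_slope openU vC U_slope).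
Qed.
Let q1 := Ck_hyp_slope (isT : (1 <= 3)%N).
Let qq1 := Ck_sqr openU q1.

(** The term [- p x] from differentiating [half_gap] cancels the one in [slope_gradientE]. *)
Lemma partial_hyp_slope k x : U x -> partial k hyp_slope x = w x 0 k + dv x 0 k.
Proof.
move=> Ux.
rewrite (partialM k (Ck_half_gap openU 1) (Ck_slope openU vC U_slope (isT : (1 <= 3)%N)) Ux).
rewrite (partial_half_gap openU)//.
have := slope_gradientE openU vC U_slope Ux.
rewrite -(slope_gradient openU vC U_slope Ux) => /rowP/(_ k).
rewrite ![(_ *: _ : 'rV[R]_n) 0 k]mxE ![(_ + _ : 'rV[R]_n) 0 k]mxE.
rewrite ![(_ *: _ : 'rV[R]_n) 0 k]mxE [X in _ * X = _ -> _]mxE.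
by move=> ->; move: (x 0 k) (p x) (w x 0 k) (dv x 0 k) => a b c d; ring.
Qed.

Lemma Ck_coef1 : Ck U 1 (fun x => 1 + hyp_slope x ^+ 2).
Proof. exact: (CkD openU (Ck_cst openU 1 1) qq1). Qed.

Lemma partial_coef1 k x : U x -> partial k (fun x => 1 + hyp_slope x ^+ 2) x =
  2 * hyp_slope x * (w x 0 k + dv x 0 k).
Proof.
move=> Ux; rewrite (partialD k (Ck_cst openU 1 1) qq1 Ux) partial_cst add0r.
by rewrite (partial_sqr k q1 Ux) partial_hyp_slope.
Qed.

Lemma Ck_coefL : Ck U 1 L.
Proof.
apply: (CkB openU); first exact: (CkM openU Ck_coef1 u1).
exact: (CkM openU (Ck_cst openU 1 _) q1).
Qed.

Lemma Ck_coefF : Ck U 1 F.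
Proof.
exact: (CkB openU (CkM openU (CkM openU (Ck_cst openU 1 2) q1) u1) (Ck_cst openU 1 _)).
Qed.

Lemma Ck_coefA : Ck U 1 A.
Proof.
apply: (CkD openU); first exact: Ck_coefF.
exact: (CkM openU Ck_coef1 (Ck_sqr openU u1)).
Qed.

Lemma partial_coefL k x : U x -> partial k L x = F x * w x 0 k + A x * dv x 0 k.
Proof.
move=> Ux.
rewrite (partialB k (CkM openU Ck_coef1 u1) (CkM openU (Ck_cst openU 1 n%:R) q1) Ux).
rewrite (partialM k Ck_coef1 u1 Ux) (partial_scale openU k n%:R q1 Ux).
rewrite partial_coef1// partial_inv_neg// partial_hyp_slope// /coefA /coefF.
by move: (hyp_slope x) (u x) (w x 0 k) (dv x 0 k) => a b c d; ring.
Qed.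

Lemma partial_coefF k x : U x -> partial k F x =
  2 * (w x 0 k + dv x 0 k) * u x + 2 * hyp_slope x * (dv x 0 k * u x ^+ 2).
Proof.
move=> Ux; have c2 := CkM openU (Ck_cst openU 1 2) q1.
rewrite (partialB k (CkM openU c2 u1) (Ck_cst openU 1 n%:R) Ux) partial_cst subr0.
rewrite (partialM k c2 u1 Ux) (partial_scale openU k 2 q1 Ux).
by rewrite partial_inv_neg// partial_hyp_slope.
Qed.

Lemma partial_coefA k x : U x -> partial k A x = A1 x * w x 0 k + K x * dv x 0 k.
Proof.
move=> Ux.
rewrite (partialD k Ck_coefF (CkM openU Ck_coef1 (Ck_sqr openU u1)) Ux).
rewrite (partialM k Ck_coef1 (Ck_sqr openU u1) Ux) (partial_sqr k u1 Ux).
rewrite partial_coef1// partial_inv_neg// partial_coefF// /hess_coefK /coefA1.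
by move: (hyp_slope x) (u x) (w x 0 k) (dv x 0 k) => a b c d; ring.
Qed.

Let Wk (i j : 'I_n) : Ck U 2 (scaled_tensor_entry v i j).
Proof. exact: (Ck_scaled_tensor openU vC U_slope). Qed.
Let W1 (i j : 'I_n) : Ck U 1 (scaled_tensor_entry v i j).
Proof. exact: (Ck_scaled_tensor openU vC U_slope). Qed.
Let r1 := Ck_inv_half_gap openU U_ball 1.

Lemma tensor_partialE x k i j : T x k i j = partial k (scaled_tensor_entry v i j) x.
Proof. by rewrite mxE. Qed.

Lemma trace_partialE i x : U x -> \tr (T x i) =
  L x * r x ^+ 2 * x 0 i + r x * (F x * w x 0 i + A x * dv x 0 i).
Proof.
move=> Ux.
have -> : \tr (T x i) = partial i (fun x => \tr (W x)) x.
  rewrite (partial_ext openU (g := fun x => \sum_a scaled_tensor_entry v a a x) _ _ Ux); last first.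
    by move=> t _; apply: eq_bigr => a _; rewrite mxE.
  rewrite (partial_sum_ord openU i (fun a => W1 a a) Ux); apply: eq_bigr => a _.
  exact: tensor_partialE.
rewrite (partial_ext openU i trace_eq Ux) (partialM i r1 Ck_coefL Ux).
rewrite (partial_inv_half_gap openU U_ball)// partial_coefL//.
by congr (_ + _); rewrite mulrC [x 0 i * _]mulrC mulrA.
Qed.

(** Second derivatives of [v] are eliminated in favour of the tensor by [hessian_from_tensor], which
    accounts for the last line; the layout is the one expected by [jet_identity]. *)
Lemma trace_hessianE x : U x -> trace_hessian x =
  r x ^+ 2 *: ((F x *: w x + A x *: dv x)^T *m x) + (2 * L x * r x ^+ 3) *: (x^T *m x)
  + (L x * r x ^+ 2)%:M + (r x ^+ 2 * F x) *: (x^T *m w x)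
  + r x *: ((\row_k partial k F x)^T *m w x)
  + (r x * F x) *: ((\matrix_(j, i) (eta x *m T x j) 0 i) + jacobian_unit v x *m W x)
  + (r x ^+ 2 * A x) *: (x^T *m dv x)
  + r x *: ((A1 x *: w x + K x *: dv x)^T *m dv x)
  + (r x * A x * r x) *: (W x + x^T *m dv x + (dv x)^T *m x - (dot x (dv x) - p x)%:M).
Proof.
move=> Ux; apply/matrixP => j i; rewrite [LHS]mxE.
rewrite (partial_ext openU j (trace_partialE i) Ux).
have w1 := Ck_gradient_image openU vC U_slope i (isT : (1 <= 2)%N).
have d1 : Ck U 1 (fun x => dv x 0 i).
  apply: (Ck_ext openU (f := partial i v)); first by move=> t _; rewrite mxE.
  exact: (Ck_differential vC).
have c1 := Ck_coord openU 1 i.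
have e1 := Ck_sqr openU r1.
have e2 := CkM openU Ck_coefL e1.
have e3 := CkM openU Ck_coefF w1.
have e4 := CkM openU Ck_coefA d1.
have e5 := CkD openU e3 e4.
rewrite (partialD j (CkM openU e2 c1) (CkM openU r1 e5) Ux).
rewrite (partialM j e2 c1 Ux) (partialM j Ck_coefL e1 Ux) (partialM j r1 e5 Ux).
rewrite (partialD j e3 e4 Ux) (partialM j Ck_coefF w1 Ux) (partialM j Ck_coefA d1 Ux).
rewrite (partial_sqr j r1 Ux) (partial_inv_half_gap openU U_ball)// partial_coefL// partial_coefA//.
rewrite partial_coord.
have -> : partial j (fun x => dv x 0 i) x = hessian_mx v x j i.
  rewrite mxE; apply: (partial_ext openU j _ Ux) => t _; by rewrite mxE.
have -> : hessian_mx v x j i =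
    r x * (W x j i + x 0 j * dv x 0 i + dv x 0 j * x 0 i - (dot x (dv x) - p x) * (j == i)%:R).
  exact: (hessian_from_tensor (half_gap_neq0 U_ball Ux) (erefl _) (scaled_tensor_mx openU vC Ux)).
have -> : partial j (fun x => w x 0 i) x = (eta x *m T x j) 0 i + (jacobian_unit v x *m W x) j i.
  apply: (partial_row_image (f := eta) openU vC U_slope _ Ux) => l; last by rewrite mxE.
  exact: (Ck_unit_gradient openU vC U_slope).
rewrite !mx_entry (eq_sym i j) [(\row_k partial k F x) 0 j]mxE.
have -> : (\matrix_(j, i) (eta x *m T x j) 0 i : 'M[R]_n) j i = (eta x *m T x j) 0 i by rewrite mxE.
move: ((jacobian_unit v x *m W x) j i) ((eta x *m T x j) 0 i) (partial j F x) => c3' c4 c5.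
move: (W x j i) (w x 0 i) (w x 0 j) (dv x 0 i) (dv x 0 j) => c6 c7 c8 c9 c10.
move: (dot x (dv x) - p x) (F x) (A x) (A1 x) (K x) (L x) (r x) ((j == i)%:R : R) (x 0 j) (x 0 i).
clear; move=> *; ring.
Qed.

Lemma tensor_codazzi x i j k : U x ->
  T x k i j = T x j i k + (i == j)%:R * z x 0 k - (i == k)%:R * z x 0 j.
Proof.
move=> Ux; apply: (etrans (tensor_partialE x k i j)).
apply: (etrans (codazzi openU vC U_ball U_slope i j k Ux)).
by congr (_ + _ - _); exact: (esym (tensor_partialE x j i k)).
Qed.

Lemma scaled_entry_sym i j x : U x -> scaled_tensor_entry v i j x = scaled_tensor_entry v j i x.
Proof.
move=> Ux; have /matrixP/(_ j i) := scaled_tensor_sym openU vC Ux.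
by rewrite ![_ j i]mxE [W x i j]mxE.
Qed.

Lemma Ck_test_image (a : nat) i : (a <= 2)%N -> Ck U a (fun x => z x 0 i).
Proof.
move=> a2; apply: (Ck_ext openU (f := fun x => \sum_(l < n) y x 0 l * scaled_tensor_entry v l i x)).
  by move=> x _; rewrite [RHS]mxE; apply: eq_bigr => l _; rewrite [W x l i]mxE.
apply: (Ck_sum openU) => l; apply: (CkM openU).
  by apply: (Ck_test_vector openU vC U_ball U_slope); apply: leq_trans a2 _.
exact: (Ck_scaled_tensor openU vC U_slope).
Qed.

Lemma partial_test_image j i x : U x -> partial j (fun x => z x 0 i) x =
  ((\matrix_(j, i) (y x *m T x j) 0 i : 'M[R]_n) + jacobian_test v x *m W x) j i.
Proof.
move=> Ux; rewrite [RHS]mxE [X in X + _]mxE.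
apply: (partial_row_image (f := y) openU vC U_slope _ Ux) => l; last by rewrite mxE.
exact: (Ck_test_vector openU vC U_ball U_slope).
Qed.

(** As in Simons type identities, the Codazzi equation is applied twice with an exchange of
    derivatives in between, which turns the Laplacian of the tensor into the Hessian of its trace
    and first derivatives of the defect. *)
Lemma tensor_laplacianE x : U x ->
  let dz := (\matrix_(j, i) (y x *m T x j) 0 i : 'M[R]_n) + jacobian_test v x *m W x in
  tensor_laplacian x = (trace_hessian x)^T - (n%:R - 1) *: dz^T + (\tr dz)%:M - dz.
Proof.
move=> Ux dz; apply/matrixP => i j; rewrite [LHS]mxE !mx_entry.
have z1 (l : 'I_n) := Ck_test_image l (isT : (1 <= 2)%N).
have dzE a b : dz a b = partial a (fun x => z x 0 b) x by rewrite partial_test_image.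
have step1 k : partial k (partial k (scaled_tensor_entry v i j)) x =
   partial j (partial k (scaled_tensor_entry v i k)) x + (i == j)%:R * dz k k - (i == k)%:R * dz k j.
  rewrite (partial_ext openU k (codazzi openU vC U_ball U_slope i j k) Ux).
  have a1 := Ck_partial j (Wk i k).
  have a2 := CkM openU (Ck_cst openU 1 (i == j)%:R) (z1 k).
  have a3 := CkM openU (Ck_cst openU 1 (i == k)%:R) (z1 j).
  rewrite (partialB k (CkD openU a1 a2) a3 Ux) (partialD k a1 a2 Ux).
  rewrite (partial_scale openU k _ (z1 k) Ux) (partial_scale openU k _ (z1 j) Ux).
  by rewrite !dzE (schwarz openU k j (Wk i k) Ux).
under eq_bigr => k _ do rewrite step1.
rewrite sumrB big_split /= -mulr_sumr -mxtrace_sum.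
have -> : \sum_k (i == k)%:R * dz k j = dz i j.
  rewrite (bigD1 i) //= eqxx mul1r big1 ?addr0// => k; rewrite eq_sym => /negbTE ->.
  by rewrite mul0r.
(* The second use of Codazzi: the divergence of the tensor is the gradient of its trace minus
   [(n - 1) z]. *)
have -> : \sum_k partial j (partial k (scaled_tensor_entry v i k)) x =
   trace_hessian x j i - (n%:R - 1) * dz j i.
  have t1 (k : 'I_n) : Ck U 1 (partial k (scaled_tensor_entry v i k)) by exact: (Ck_partial k (Wk i k)).
  rewrite -(partial_sum_ord openU j t1 Ux).
  have tt1 : Ck U 1 (fun x => \tr (T x i)).
    apply: (Ck_ext openU (f := fun x => \sum_k partial i (scaled_tensor_entry v k k) x)).
      by move=> t _; apply: eq_bigr => k _; rewrite mxE.
    by apply: (Ck_sum openU) => k; exact: (Ck_partial i (Wk k k)).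
  have z2 := CkM openU (Ck_cst openU 1 (n%:R - 1)) (z1 i).
  rewrite [trace_hessian x j i]mxE dzE -(partial_scale openU j _ (z1 i) Ux) -(partialB j tt1 z2 Ux).
  apply: (partial_ext openU j _ Ux) => t Ut.
  transitivity (\sum_k (T t i k k + (k == i)%:R * z t 0 k - z t 0 i)).
    apply: eq_bigr => k _.
    rewrite (partial_ext openU k (fun s Us => scaled_entry_sym i k Us) Ut).
    by rewrite (codazzi openU vC U_ball U_slope k i k Ut) eqxx mul1r [T t i k k]mxE.
  rewrite sumrB big_split /= sumr_const card_ord.
  have -> : \sum_k (k == i)%:R * z t 0 k = z t 0 i.
    rewrite (bigD1 i) //= eqxx mul1r big1 ?addr0// => k /negbTE ->.
    by rewrite mul0r.
  by rewrite -[z t 0 i *+ n]mulr_natl mxtrace_sum mulrBl mul1r opprB addrA.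
have dzx a b : dz a b = (\matrix_(j, i) (y x *m T x j) 0 i : 'M[R]_n) a b + (jacobian_test v x *m W x) a b.
  exact: addmx_entry.
by rewrite -!dzx [\tr dz * _]mulrC.
Qed.

End TraceEquation.

Lemma compact_bounded_on (R : realType) (n : nat) (U K : set 'rV[R]_n) (f : 'rV[R]_n -> R) :
  Ck U 0 f -> compact K -> K `<=` U -> bounded_on K f.
Proof.
move=> cf cK KU.
have wc : {within K, continuous f}.
  by apply: continuous_in_subspaceT => x; rewrite inE => Kx; apply: (Ck_continuous cf); exact: KU.
have [M [_ hM]] := compact_bounded (continuous_compact wc cK).
by exists (M + 1) => x Kx; apply: (hM (M + 1)); [rewrite ltrDl|exists x].
Qed.

(** Testing the form on the sum and the difference of two basis vectors bounds twice an off-diagonal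
    entry by two diagonal ones. *)
Lemma psd_entry_le (R : realFieldType) (n : nat) (O : 'M[R]_n) : O^T = O ->
  (forall a : 'rV[R]_n, 0 <= dot (a *m O) a) -> forall a b, `|O a b| <= \tr O.
Proof.
move=> sO psd a b.
have dd i : 0 <= O i i.
  have := psd (delta_mx 0 i); rewrite -rowE /dot (bigD1 i) //= big1.
    by rewrite !mxE !eqxx mulr1 addr0.
  by move=> j /negbTE ji; rewrite !mxE ji andbF mulr0.
have le i : O i i <= \tr O.
  by rewrite mxtrace_sum (bigD1 i) //= lerDl sumr_ge0.
have E i j : dot (delta_mx 0 i *m O) (delta_mx 0 j) = O i j.
  rewrite -rowE /dot (bigD1 j) //= big1; first by rewrite !mxE !eqxx mulr1 addr0.
  by move=> k /negbTE kj; rewrite !mxE kj andbF mulr0.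
have Oba : O b a = O a b by rewrite -[in LHS]sO mxE.
have h1 := psd (delta_mx 0 a + delta_mx 0 b).
have h2 := psd (delta_mx 0 a - delta_mx 0 b).
rewrite mulmxDl !dotE_lin !E Oba in h1; rewrite mulmxBl !dotE_lin !E Oba in h2.
have := le a; have := le b; rewrite ler_norml; move: (O a b) (O a a) (O b b) (\tr O) h1 h2.
by clear => ? ? ? ? ? ? ? ?; apply/andP; split; lra.
Qed.

Lemma trace_frame_ge0 (R : realFieldType) (n m : nat) (E : 'M[R]_(m, n)) (M : 'M[R]_n) :
  (forall a : 'rV[R]_n, 0 <= dot (a *m M) a) -> 0 <= \tr (E^T *m E *m M).
Proof.
move=> psd; rewrite -mulmxA mxtrace_mulC; apply: sumr_ge0 => a _.
have -> : (E *m M *m E^T) a a = dot (row a E *m M) (row a E).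
  by rewrite mxE; apply: eq_bigr => j _; rewrite -row_mul !mxE.
exact: psd.
Qed.

(** * The differential inequality *)

Section DifferentialInequality.
Variables (R : realType) (n m : nat) (U K : set 'rV[R]_n) (v : 'rV[R]_n -> R).
Hypothesis n2 : (2 <= n)%N.
Hypothesis m0 : (0 < m)%N.
Hypothesis openU : open U.
Hypothesis vC : Ck U 4 v.
Hypothesis U_ball : forall x, U x -> sqnorm x < 1.
Hypothesis U_neg : forall x, U x -> v x < 0.
Hypothesis U_lb : forall x, U x -> - v x < (2 * n%:R)^-1.
Hypothesis U_slope : forall x, U x -> 0 < \sum_(i < n) partial i v x ^+ 2.
Hypothesis trace_eq : forall x, U x -> \tr (scaled_tensor v x) = (half_gap x)^-1 * coefL v x.
Hypothesis psd : forall x (a : 'rV[R]_n), U x -> 0 <= dot (a *m scaled_tensor v x) a.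
Hypothesis cK : compact K.
Hypothesis KU : K `<=` U.

Local Notation W := (scaled_tensor v).
Local Notation T := (tensor_partial v).
Local Notation eta := (unit_gradient v).
Local Notation y := (test_vector v).
Local Notation w := (gradient_image v).
Local Notation z := (test_image v).
Local Notation r x := ((half_gap x)^-1).
Local Notation p := (slope v).
Local Notation dv := (differential v).
Local Notation L := (coefL v).
Local Notation F := (coefF v).
Local Notation A := (coefA v).

Definition test_curve (x : 'rV[R]_n) (E : 'M[R]_(m, n)) k : 'M[R]_(m, n) :=
  test_direction (T x) E (y x) (E^T *m E) (- (r x * L x)^-1) k.

Lemma hyp_slope_gt0 x : U x -> 0 < hyp_slope v x.
Proof.
by move=> Ux; rewrite mulr_gt0//; [exact: (half_gap_gt0 U_ball)|exact: (slope_gt0 U_slope)].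
Qed.

Lemma coefL_gt0 x : U x -> 0 < L x.
Proof.
move=> Ux; have N2 : (2 : R) <= n%:R by rewrite ler_nat.
have s0 : 0 < - v x by rewrite oppr_gt0 U_neg.
by have [] := bracket_estimate N2 (hyp_slope_gt0 Ux) s0 (U_lb Ux).
Qed.

(** The index includes the frame: it will be found by minimisation, so constants must be uniform in
    it as well as in the point. *)
Let I := ('rV[R]_n * 'M[R]_(m, n))%type.
Let S (i : I) := [/\ K i.1, i.2 *m i.2^T = 1%:M &
   (i.2^T *m i.2) *m W i.1 = W i.1 *m (i.2^T *m i.2)].

Let bnd f : Ck U 0 f -> bounded_on S (fun i => f i.1).
Proof. by move=> cf; have [C hC] := compact_bounded_on cf cK KU; exists C => i []/hC. Qed.

Let bndE : bounded_mx_on S (fun i => i.2).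
Proof.
move=> a b; exists 1 => i [_ EE _].
have : (i.2 *m i.2^T) a a = 1 by rewrite EE mxE eqxx.
rewrite mxE (bigD1 b) //= mxE => h.
rewrite -(@ler_pXn2r _ 2%N)// ?nnegrE// expr1n real_normK ?num_real// expr2 -h lerDl.
by apply: sumr_ge0 => j _; rewrite mxE -expr2 sqr_ge0.
Qed.

(** [jet_identity] splits the left side, [main_term_le] handles the main term and
    [remainder_estimate] the rest. Compactness of [K], and the bound 1 on the entries of a frame,
    provide the constant. *)
Lemma curvature_inequality : exists C, forall x (E : 'M[R]_(m, n)), K x -> E *m E^T = 1%:M ->
  (E^T *m E) *m W x = W x *m (E^T *m E) ->
  \tr (E^T *m E *m tensor_laplacian v x)
   + \sum_k (4 * \tr (E *m T x k *m (test_curve x E k)^T)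
             + 2 * \tr (test_curve x E k *m W x *m (test_curve x E k)^T))
  <= C * (\tr (E^T *m E *m W x) + \sum_k `|\tr (E^T *m E *m T x k)|).
Proof.
have bP : bounded_mx_on S (fun i => i.2^T *m i.2).
  apply: bounded_mulmx bndE => a b; apply: (bounded_ext _ (bndE b a)) => i _.
  by rewrite mxE.
have u0 (a : nat) : (a <= 4)%N -> Ck U a (fun x => (- v x)^-1).
  by move=> a4; exact: (Ck_inv_neg openU vC U_neg).
have hq : Ck U 1 (hyp_slope v) by exact: (Ck_hyp_slope openU vC U_slope).
have cA1 : Ck U 0 (coefA1 v).
  have q0 := CkW hq.
  apply: (CkD openU); first by apply: (CkM openU) (u0 0%N isT); exact: Ck_cst.
  apply: (CkM openU); first exact: (CkM openU (Ck_cst openU 0 2) q0).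
  exact: (CkM openU (u0 0%N isT) (u0 0%N isT)).
have cF := Ck_coefF openU vC U_neg U_slope.
have cA := Ck_coefA openU vC U_neg U_slope.
have cL := Ck_coefL openU vC U_neg U_slope.
have rL0 x : U x -> r x * L x != 0.
  by move=> Ux; rewrite gt_eqF// mulr_gt0 ?coefL_gt0// invr_gt0; exact: (half_gap_gt0 U_ball).
have crL : Ck U 0 (fun x => (r x * L x)^-1).
  apply: (CkV openU rL0); apply: (CkM openU); last exact: CkW.
  exact: (Ck_inv_half_gap openU U_ball).
have c1 (f : 'rV[R]_n -> R) : Ck U 1 f -> Ck U 0 f by exact: CkW.
have [] := @remainder_estimate R I S n m (fun i => W i.1) (fun i => T i.1) (fun i => i.2^T *m i.2)
  (fun i => i.1) (fun i => y i.1) (fun i => z i.1) (fun i => eta i.1) (fun i => dv i.1)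
  (fun i => w i.1) (fun i => \row_k partial k F i.1) (fun i => jacobian_test v i.1)
  (fun i => jacobian_unit v i.1) (fun i => r i.1) (fun i => p i.1) (fun i => L i.1)
  (fun i => F i.1) (fun i => A i.1) (fun i => coefA1 v i.1).
- move=> i a b [Ki EE PW]; apply: psd_entry_le => [|c].
    rewrite PW trmx_mul (scaled_tensor_sym openU vC (KU Ki)) trmx_mul trmxK.
    by [].
  (* [P W = P W P] is a congruence of [W], hence nonnegative, so its trace bounds its entries. *)
  have PP := proj_idem EE (erefl _); have sP := projT (erefl (i.2^T *m i.2)).
  move: (i.2^T *m i.2) PP sP PW => P PP sP PW.
  rewrite -PP -[P *m P *m _]mulmxA PW !mulmxA dot_mulmx sP.
  exact: psd (KU Ki).
- by move=> i [Ki _ _]; apply: trace_frame_ge0 => a; exact: psd (KU Ki).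
- by move=> i [].
- by [].
- by [].
- move=> a b; apply: (bounded_ext _ (bnd _)) => [i _|]; last first.
    by apply: (@Ck_scaled_tensor _ _ _ _ openU vC U_slope 0 a b).
  by rewrite mxE.
- exact: bP.
- by move=> a b; rewrite (ord1 a); exact: (bnd (Ck_coord openU 0 b)).
- by move=> a b; rewrite (ord1 a); exact: (bnd (@Ck_test_vector _ _ _ _ openU vC U_ball U_slope 0 b isT)).
- by move=> a b; rewrite (ord1 a); exact: (bnd (@Ck_unit_gradient _ _ _ _ openU vC U_slope 0 b isT)).
- move=> a b; apply: (bounded_ext _ (bnd (@Ck_differential _ _ _ _ vC 0 b isT))) => i _.
  by rewrite mxE.
- move=> a b; apply: (bounded_ext _ (bnd (Ck_partial b cF))) => i _.
  by rewrite mxE.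
- move=> a b; have c := @Ck_test_vector _ _ _ _ openU vC U_ball U_slope 1 b isT.
  apply: (bounded_ext _ (bnd (Ck_partial a c))) => i _.
  by rewrite mxE.
- move=> a b; have c := @Ck_unit_gradient _ _ _ _ openU vC U_slope 1 b isT.
  apply: (bounded_ext _ (bnd (Ck_partial a c))) => i _.
  by rewrite mxE.
- move=> k a b; have c := @Ck_scaled_tensor _ _ _ _ openU vC U_slope 1 a b isT.
  apply: (bounded_ext _ (bnd (Ck_partial k c))) => i _.
  by rewrite mxE.
- exact: (bnd (Ck_inv_half_gap openU U_ball 0)).
- exact: (bnd (CkV openU (slope_neq0 U_slope) (@Ck_slope _ _ _ _ openU vC U_slope 0 isT))).
- exact: (bnd (c1 _ cL)).
- exact: (bnd crL).
- exact: (bnd (c1 _ cF)).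
- exact: (bnd (c1 _ cA)).
- exact: (bnd cA1).
move=> C hC; exists C => x E Kx EE PW.
have Ux := KU Kx.
have PE := erefl (E^T *m E).
apply: (le_trans _ (hC (x, E) _)) => //=.
rewrite (@jet_identity R n m (W x) (T x) E (E^T *m E) x (y x) (z x) (eta x) (dv x) (w x)
  (\row_k partial k F x) (trace_hessian v x) (jacobian_test v x) (jacobian_unit v x)
  (tensor_laplacian v x) (r x) (p x) (L x) (F x) (A x) (coefA1 v x) (hess_coefK v x)) //; first last.
- exact: (trace_hessianE openU vC U_ball U_neg U_slope trace_eq).
- exact: (tensor_laplacianE openU vC U_ball U_slope).
- apply/rowP => k; rewrite mxE (trace_partialE openU vC U_ball U_neg U_slope trace_eq)//.
  by rewrite !mx_entry.
- exact: (jacobian_testE openU vC U_ball U_slope).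
- exact: trace_eq.
- exact: (differentialE U_slope).
- exact: (dot_unit_gradient U_slope).
- by rewrite dot_self_half_gap; have := half_gap_neq0 U_ball Ux; move: (half_gap x) => h h0; field.
- by rewrite gt_eqF// coefL_gt0.
- exact: (slope_neq0 U_slope).
- by rewrite invr_neq0//; exact: (half_gap_neq0 U_ball).
- by move=> i j k; exact: (tensor_codazzi openU vC U_ball U_slope i j k Ux).
- move=> k; apply/matrixP => i j; rewrite !mxE; apply: (partial_ext openU k _ Ux) => t Ut.
  exact: (scaled_entry_sym openU vC).
- exact: (scaled_tensor_sym openU vC).
rewrite lerD2r.
have -> : \tr (E^T *m E *m W x) = \tr (E^T *m E *m W x) by [].
apply: (@main_term_le R n m (W x) (E^T *m E) (eta x) (dv x) (w x) (r x) (p x) (- v x) (hyp_slope v x)) => //.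
- exact: (scaled_tensor_sym openU vC).
- exact: projT.
- exact: (proj_idem EE).
- exact: (dot_unit_gradient U_slope).
- exact: (differentialE U_slope).
- exact: (slope_gt0 U_slope).
- by rewrite invr_gt0; exact: (half_gap_gt0 U_ball).
- by rewrite oppr_gt0 U_neg.
- exact: U_lb.
- by rewrite invrK mulrC.
- by rewrite /coefA exprVn.
- by rewrite /hess_coefK !exprVn.
- exact: trace_eq.
- by apply: trace_frame_ge0 => a; exact: psd.
Qed.

End DifferentialInequality.

(** * A strong minimum principle for traces on frames *)

Section CompactZeros.
Variables (T : topologicalType) (R : realType).
Implicit Types (P : set T) (F : T -> R).

Lemma compact_zero_set P F : compact P -> {within P, continuous F} ->
  compact (P `&` F @^-1` [set 0]).
Proof.
move=> cP /continuous_closedP/(_ [set 0]) h.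
have /closed_subspaceP[V cV VP] : closed (F @^-1` [set 0] : set (subspace P)) by apply: h; exact: closed_eq.
by rewrite setIC -VP setIC; exact: compact_closedI.
Qed.

Lemma continuous_at_sum (I : Type) (s : seq I) (G : I -> T -> R) (p : T) :
  (forall i, {for p, continuous (G i)}) -> {for p, continuous (fun q => \sum_(i <- s) G i q)}.
Proof.
move=> cG; elim: s => [|i s IH].
  have -> : (fun q => \sum_(i <- [::]) G i q) = (fun=> 0) by apply/funext => q; rewrite big_nil.
  exact: cst_continuous.
have -> : (fun q => \sum_(j <- i :: s) G j q) = (fun q => G i q + \sum_(j <- s) G j q).
  by apply/funext => q; rewrite big_cons.
by apply: continuousD => //; exact: cG.
Qed.

End CompactZeros.

(** * Euclidean balls in the topology of the sup norm *)

Section Balls.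
Variables (R : realType) (n : nat).
Implicit Types (x y : 'rV[R]_n) (A : set 'rV[R]_n).

Lemma bounded_entries A (M : R) : 0 <= M -> (forall x i, A x -> `|x 0 i| <= M) -> bounded_set A.
Proof.
move=> M0 h; exists M; split; first exact: ger0_real.
move=> y My x Ax; rewrite /= [`|x|]mx_normrE; apply: bigmax_le => [|[a i] _ /=].
  by rewrite (le_trans M0)// ltW.
by rewrite ord1 (le_trans (h _ _ Ax))// ltW.
Qed.

Lemma sqnorm_ge0 x : 0 <= sqnorm x.
Proof. by apply: sumr_ge0 => i _; exact: sqr_ge0. Qed.

Lemma sqnorm_coord x i : x 0 i ^+ 2 <= sqnorm x.
Proof.
by rewrite /sqnorm (bigD1 i) //= lerDl sumr_ge0// => j _; exact: sqr_ge0.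
Qed.

Lemma Ck_sqnorm (k : nat) y : Ck setT k (fun x => sqnorm (x - y)).
Proof.
have oT : open [set: 'rV[R]_n] by exact: openT.
apply: (Ck_sum oT) => i.
have c : Ck setT k (fun x : 'rV[R]_n => x 0 i - y 0 i).
  by apply: (CkB oT); [exact: Ck_coord|exact: Ck_cst].
apply: (Ck_ext oT _ (CkM oT c c)) => x _.
by rewrite !mxE expr2.
Qed.

Lemma sqnorm_continuous y : continuous (fun x => sqnorm (x - y)).
Proof. by move=> x; exact: (Ck_continuous (Ck_sqnorm 0 y)). Qed.

Lemma compact_euclidean_ball y (d : R) : compact [set x | sqnorm (x - y) <= d].
Proof.
apply: bounded_closed_compact.
  apply: (@bounded_entries _ (Num.sqrt `|d| + \sum_i `|y 0 i|)).
    by rewrite addr_ge0 ?sqrtr_ge0 ?sumr_ge0.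
  move=> x i /= xy; rewrite -[x 0 i](subrK (y 0 i)) (le_trans (ler_normD _ _))//.
  apply: lerD; last by rewrite (bigD1 i) //= lerDl sumr_ge0.
  rewrite -sqrtr_sqr ler_wsqrtr// (le_trans _ (ler_norm _))// (le_trans _ xy)//.
  by have := sqnorm_coord (x - y) i; rewrite !mxE.
apply: (@preimage_closed _ _ (fun x => sqnorm (x - y)) [set t | t <= d]); last exact: closed_le.
by move=> x _; exact: sqnorm_continuous.
Qed.

Lemma nbhs_sqnorm x A : nbhs x A -> exists2 d : R, 0 < d & forall y, sqnorm (y - x) <= d -> A y.
Proof.
move=> /nbhs_ballP[e /= e0 eA]; exists ((e / 2) ^+ 2); first by rewrite exprn_gt0// divr_gt0.
move=> y xy; apply: eA; rewrite mx_norm_ball /ball_ /= -normrN opprB [`|_|]mx_normrE.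
apply: bigmax_lt => // -[a i] _ /=; rewrite ord1.
have : ((y - x) 0 i) ^+ 2 <= (e / 2) ^+ 2 by rewrite (le_trans (sqnorm_coord _ _)).
by rewrite ltr_norml; move: ((y - x) 0 i) => z zz; apply/andP; split; nra.
Qed.

Lemma sqnorm_nbhs x (d : R) : 0 < d -> nbhs x [set y | sqnorm (y - x) < d].
Proof.
move=> d0; have := @sqnorm_continuous x x [set t | t < d]; apply.
apply: open_nbhs_nbhs; split; first exact: open_lt.
by rewrite /= subrr /sqnorm big1// => i _; rewrite mxE expr0n.
Qed.

End Balls.

Section Frames.
Variables (R : realType) (n m : nat).
Implicit Types (E : 'M[R]_(m, n)) (w : 'I_n -> 'I_n -> 'rV[R]_n -> R).

(** Frames are flattened to row vectors, so that closed bounded sets of them are compact. *)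
Definition frames : set 'rV[R]_(m * n) :=
  [set u | mulmx (vec_mx u : 'M[R]_(m, n)) (trmx (vec_mx u)) = 1%:M].

Lemma frame_entry E a j : E *m E^T = 1%:M -> `|E a j| <= 1.
Proof.
move=> /matrixP/(_ a a); rewrite !mxE eqxx (bigD1 j) //= mxE => h.
have : E a j ^+ 2 <= 1.
  by rewrite expr2 -[leRHS]h lerDl sumr_ge0// => k _; rewrite mxE -expr2 sqr_ge0.
by rewrite ler_norml; move: (E a j) => z zz; apply/andP; split; nra.
Qed.

Lemma compact_frames : compact frames.
Proof.
apply: bounded_closed_compact.
  apply: (@bounded_entries _ _ _ 1) => // u a /= uu.
  rewrite -[u]vec_mxK; case/mxvec_indexP: a => a j; rewrite mxvecE.
  exact: frame_entry.
have oT : open [set: 'rV[R]_(m * n)] by exact: openT.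
pose f (u : 'rV[R]_(m * n)) : R := \sum_a \sum_b
  (\sum_j u 0 (mxvec_index a j) * u 0 (mxvec_index b j) - (a == b)%:R) ^+ 2.
have cf : continuous f.
  move=> u; apply: (@Ck_continuous _ _ setT 0) => //.
  apply: (Ck_sum oT) => a; apply: (Ck_sum oT) => b.
  have c : Ck setT 0 (fun u : 'rV[R]_(m * n) =>
      \sum_j u 0 (mxvec_index a j) * u 0 (mxvec_index b j) - (a == b)%:R).
    apply: (CkB oT); last exact: Ck_cst.
    by apply: (Ck_sum oT) => j; apply: (CkM oT); exact: Ck_coord.
  by apply: (Ck_ext oT _ (CkM oT c c)) => x _; rewrite expr2.
have -> : frames = f @^-1` [set 0].
  apply/seteqP; split => u /=.
    move=> uu; apply: big1 => a _; apply: big1 => b _.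
    move/matrixP: uu => /(_ a b); rewrite !mxE => <-.
    apply/eqP; rewrite sqrf_eq0 subr_eq0; apply/eqP; apply: eq_bigr => j _.
    by rewrite [trmx _ _ _]mxE !mxE.
  move=> /eqP; rewrite psumr_eq0 => [/allP h|a _]; last by apply: sumr_ge0 => b _; exact: sqr_ge0.
  apply/matrixP => a b; have := h a (mem_index_enum a).
  rewrite psumr_eq0 => [/allP/(_ b (mem_index_enum b))|c _]; last exact: sqr_ge0.
  rewrite sqrf_eq0 subr_eq0 => /eqP; rewrite !mxE => <-; apply: eq_bigr => j _.
  by rewrite [trmx _ _ _]mxE !mxE.
by apply: preimage_closed; [move=> u _; exact: cf|exact: closed_eq].
Qed.

Definition frame_trace w (x : 'rV[R]_n) E : R := \sum_a \sum_i \sum_j E a i * w i j x * E a j.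

Lemma frame_traceE w x E : frame_trace w x E = \tr (E *m (\matrix_(i, j) w i j x) *m E^T).
Proof.
apply: eq_bigr => a _; rewrite mxE exchange_big; apply: eq_bigr => j _ /=.
by rewrite !mxE mulr_suml; apply: eq_bigr => i _; rewrite !mxE.
Qed.

Variables (K : set 'rV[R]_n) (w : 'I_n -> 'I_n -> 'rV[R]_n -> R).
Hypothesis cK : compact K.
Hypothesis cw : forall i j x, K x -> {for x, continuous (w i j)}.

Let Phi (p : 'rV[R]_n * 'rV[R]_(m * n)) := frame_trace w p.1 (vec_mx p.2).

Let Phi_continuous p : K p.1 -> {for p, continuous Phi}.
Proof.
move=> Kp; apply: continuous_at_sum => a; apply: continuous_at_sum => i; apply: continuous_at_sum => j.
have c b k : {for p, continuous (fun q : 'rV[R]_n * 'rV[R]_(m * n) => (vec_mx q.2 : 'M[R]_(m, n)) b k)}.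
  have -> : (fun q : 'rV[R]_n * 'rV[R]_(m * n) => (vec_mx q.2 : 'M[R]_(m, n)) b k) =
      (fun u : 'rV[R]_(m * n) => u 0 (mxvec_index b k)) \o snd.
    by apply/funext => q /=; rewrite mxE.
  apply: continuous_comp; first exact: cvg_snd.
  exact: coord_continuous.
apply: continuousM => //; apply: continuousM => //.
by apply: (@continuous_comp _ _ _ fst (w i j)); [exact: cvg_fst|exact: cw].
Qed.

(** The set is the projection of a closed part of the compact product of [K] with the frames; this
    gives closedness of the degeneracy set. *)
Lemma compact_frame_zeros :
  compact (K `&` [set x | exists E, E *m E^T = 1%:M /\ frame_trace w x E = 0]).
Proof.
have cP := compact_setX cK compact_frames.
have wPhi : {within K `*` frames, continuous Phi}.
  by apply: continuous_in_subspaceT => p; rewrite inE => -[Kp _]; exact: Phi_continuous.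
have cZ := compact_zero_set cP wPhi.
have wf : {within (K `*` frames) `&` Phi @^-1` [set 0], continuous (@fst 'rV[R]_n 'rV[R]_(m * n))}.
  by apply: continuous_subspaceT => p; exact: cvg_fst.
suff -> : K `&` [set x | exists E, E *m E^T = 1%:M /\ frame_trace w x E = 0] =
    fst @` ((K `*` frames) `&` Phi @^-1` [set 0]) by exact: continuous_compact.
apply/seteqP; split => [x [Kx [E [EE E0]]]|x [[y u] [[/= Ky uu] Phi0] <-]].
  by exists (x, mxvec E) => //; split; [split => //=|]; rewrite /Phi /frames /= mxvecK.
by split => //; exists (vec_mx u).
Qed.

(** Minimising over points and frames together avoids differentiating the minimum over frames. [x0]
    and [E0] only witness that the product is inhabited. *)
Lemma frame_minimum (h : 'rV[R]_n -> R) (x0 : 'rV[R]_n) (E0 : 'M[R]_(m, n)) :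
  (forall x, K x -> {for x, continuous h}) -> K x0 -> E0 *m E0^T = 1%:M ->
  exists x E, [/\ K x, E *m E^T = 1%:M & forall y F, K y -> F *m F^T = 1%:M ->
    frame_trace w x E - h x <= frame_trace w y F - h y].
Proof.
move=> ch K0 EE0; have cP := compact_setX cK compact_frames.
have wPhi : {within K `*` frames, continuous (fun p => Phi p - h p.1)}.
  apply: continuous_in_subspaceT => p; rewrite inE => -[Kp _].
  apply: continuousB; first exact: Phi_continuous.
  by apply: (@continuous_comp _ _ _ fst h); [exact: cvg_fst|exact: ch].
have [|[x u]] := compact_EVT_min _ cP wPhi.
  by exists (x0, mxvec E0); split => //; rewrite /frames /= mxvecK.
rewrite inE => -[/= Kx uu] hmin; exists x, (vec_mx u); split => // y F Ky FF.
have := hmin (y, mxvec F); rewrite inE /Phi /= mxvecK; apply.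
by split => //=; rewrite /frames /= mxvecK.
Qed.

End Frames.

Section Frobenius.
Variables (R : realType) (n : nat) (U : set 'rV[R]_n).
Hypothesis openU : open U.
Implicit Types (w : 'I_n -> 'I_n -> 'rV[R]_n -> R) (x : 'rV[R]_n) (A : 'M[R]_n).

Definition frobenius A w x : R := \sum_i \sum_j A i j * w i j x.

Lemma frobeniusE A w x : frobenius A w x = \tr (A^T *m \matrix_(i, j) w i j x).
Proof.
rewrite /frobenius exchange_big; apply: eq_bigr => j _; rewrite mxE; apply: eq_bigr => i _.
by rewrite !mxE.
Qed.

Lemma Ck_frobenius (a : nat) A w : (forall i j, Ck U a (w i j)) -> Ck U a (frobenius A w).
Proof.
move=> cw; apply: (Ck_sum openU) => i; apply: (Ck_sum openU) => j.
by apply: (CkM openU) => //; exact: Ck_cst.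
Qed.

Lemma partial_frobenius A w k x : (forall i j, Ck U 1 (w i j)) -> U x ->
  partial k (frobenius A w) x = frobenius A (fun i j => partial k (w i j)) x.
Proof.
move=> cw Ux.
have c1 i j : Ck U 1 (fun x => A i j * w i j x) by apply: (CkM openU) => //; exact: Ck_cst.
have c2 i : Ck U 1 (fun x => \sum_j A i j * w i j x) by exact: (Ck_sum openU).
apply: (etrans (partial_sum openU _ _ k c2 Ux)); apply: eq_bigr => i _.
apply: (etrans (partial_sum openU _ _ k (c1 i) Ux)); apply: eq_bigr => j _.
exact: (partial_scale openU k _ (cw i j) Ux).
Qed.

Lemma partial2_frobenius A w k x : (forall i j, Ck U 2 (w i j)) -> U x ->
  partial k (partial k (frobenius A w)) x = frobenius A (fun i j => partial k (partial k (w i j))) x.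
Proof.
move=> cw Ux.
have cw1 i j : Ck U 1 (w i j) by exact: CkW.
have cdw i j : Ck U 1 (partial k (w i j)) by exact: Ck_partial.
apply: (etrans (partial_ext openU k (fun y Uy => partial_frobenius A k cw1 Uy) Ux)).
exact: (partial_frobenius A k cdw Ux).
Qed.

Variables (f0 f1 f2 : 'rV[R]_n -> R) (k : 'I_n) (c : R).
Hypothesis c0 : Ck U 2 f0.
Hypothesis c1 : Ck U 2 f1.
Hypothesis c2 : Ck U 2 f2.

(** The curve parameter is the displacement [x 0 k - c] of the point along coordinate [k]. A
    variation of the frame thus becomes a function on [U], and its second variation an iterated
    partial derivative. *)
Definition quadratic_curve x : R := f0 x + (x 0 k - c) * (f1 x + (x 0 k - c) * f2 x).

Let t x := x 0 k - c.

Let Ck_t (a : nat) : Ck U a t.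
Proof. by apply: (CkB openU); [exact: Ck_coord|exact: Ck_cst]. Qed.

Let partial_t x : U x -> partial k t x = 1.
Proof.
move=> Ux; rewrite (partialB k (Ck_coord openU 1 k) (Ck_cst openU 1 c) Ux).
by rewrite partial_coord partial_cst eqxx subr0.
Qed.

Lemma Ck_quadratic_curve : Ck U 2 quadratic_curve.
Proof.
have ct := Ck_t 2; apply: (CkD openU c0); apply: (CkM openU ct); apply: (CkD openU c1).
exact: (CkM openU ct c2).
Qed.

Lemma partial2_quadratic_curve x : U x -> x 0 k = c ->
  partial k (partial k quadratic_curve) x = partial k (partial k f0) x + 2 * partial k f1 x + 2 * f2 x.
Proof.
move=> Ux xc; have ct := Ck_t 1.
have [d0 d1 d2] : [/\ Ck U 1 f0, Ck U 1 f1 & Ck U 1 f2] by split; exact: CkW.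
have [e0 e1 e2] : [/\ Ck U 1 (partial k f0), Ck U 1 (partial k f1) & Ck U 1 (partial k f2)].
  by split; exact: Ck_partial.
pose g x := f1 x + t x * f2 x.
have pM f y : Ck U 1 f -> U y -> partial k (fun x => t x * f x) y = f y + t y * partial k f y.
  by move=> cf Uy; rewrite (partialM k ct cf Uy) partial_t// mul1r.
have cg : Ck U 1 g := CkD openU d1 (CkM openU ct d2).
have dg y : U y -> partial k g y = partial k f1 y + (f2 y + t y * partial k f2 y).
  by move=> Uy; rewrite (partialD k d1 (CkM openU ct d2) Uy) pM.
have dq y : U y -> partial k quadratic_curve y = partial k f0 y + (g y + t y * partial k g y).
  by move=> Uy; rewrite (partialD k d0 (CkM openU ct cg) Uy) pM.
have cdg : Ck U 1 (partial k g).
  have := Ck_partial k (CkD openU c1 (CkM openU (Ck_t 2) c2)); exact.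
rewrite (partial_ext openU k dq Ux).
rewrite (partialD k e0 (CkD openU cg (CkM openU ct cdg)) Ux).
rewrite (partialD k cg (CkM openU ct cdg) Ux) pM// dg//.
have -> : t x = 0 by rewrite /t xc subrr.
by move: (partial k _ _) (partial k _ _) (partial k f2 x) => a b d; rewrite !mul0r !addr0; ring.
Qed.

End Frobenius.

(** * The Hopf barrier *)

Section Barrier.
Variables (R : realType) (n : nat) (y : 'rV[R]_n) (al rh : R).

Let oT : open [set: 'rV[R]_n] := openT.

Definition barrier (x : 'rV[R]_n) : R := expR (- al * sqnorm (x - y)) - expR (- al * rh).

Lemma partial_sqnorm k x : partial k (fun x => sqnorm (x - y)) x = 2 * (x 0 k - y 0 k).
Proof.
have c (a : nat) i : Ck setT a (fun x : 'rV[R]_n => x 0 i - y 0 i).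
  by apply: (CkB oT); [exact: Ck_coord|exact: Ck_cst].
have -> : (fun x => sqnorm (x - y)) = (fun x => \sum_i (x 0 i - y 0 i) ^+ 2).
  by apply/funext => z; apply: eq_bigr => i _; rewrite !mxE.
have Ux : setT x by [].
apply: (etrans (partial_sum oT _ _ k (fun i => Ck_sqr oT (c 1%N i)) Ux)).
rewrite (bigD1 k)//= big1.
  rewrite (partial_sqr k (c 1%N k) Ux) (partialB k (Ck_coord oT 1 k) (Ck_cst oT 1 _) Ux).
  by rewrite partial_coord partial_cst eqxx subr0 addr0 mulr1.
move=> i ik; rewrite (partial_sqr k (c 1%N i) Ux) (partialB k (Ck_coord oT 1 i) (Ck_cst oT 1 _) Ux).
by rewrite partial_coord partial_cst (negbTE ik) subr0 mulr0.
Qed.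

Let Ck_e (a : nat) : Ck setT a (fun x => expR (- al * sqnorm (x - y))).
Proof.
apply: (Ck_expR oT); apply: (CkM oT); [exact: Ck_cst|exact: Ck_sqnorm].
Qed.

Lemma Ck_barrier (a : nat) : Ck setT a barrier.
Proof. by apply: (CkB oT); [exact: Ck_e|exact: Ck_cst]. Qed.

Lemma partial_barrier k x :
  partial k barrier x = - (2 * al) * ((x 0 k - y 0 k) * expR (- al * sqnorm (x - y))).
Proof.
have Ux : setT x by [].
rewrite (partialB k (Ck_e 1) (Ck_cst oT 1 _) Ux) partial_cst subr0.
rewrite (partial_expR k (CkM oT (Ck_cst oT 1 _) (Ck_sqnorm 1 y)) Ux).
rewrite (partial_scale oT k (- al) (Ck_sqnorm 1 y) Ux) partial_sqnorm.
by move: (expR _) => e; ring.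
Qed.

Lemma partial2_barrier k x : partial k (partial k barrier) x =
  (4 * al ^+ 2 * (x 0 k - y 0 k) ^+ 2 - 2 * al) * expR (- al * sqnorm (x - y)).
Proof.
have Ux : setT x by [].
have c : Ck setT 1 (fun x : 'rV[R]_n => x 0 k - y 0 k).
  by apply: (CkB oT); [exact: Ck_coord|exact: Ck_cst].
have -> : partial k barrier = (fun x => - (2 * al) * ((x 0 k - y 0 k) * expR (- al * sqnorm (x - y)))).
  by apply/funext => z; exact: partial_barrier.
rewrite (partial_scale oT k _ (CkM oT c (Ck_e 1)) Ux) (partialM k c (Ck_e 1) Ux).
rewrite (partial_expR k (CkM oT (Ck_cst oT 1 _) (Ck_sqnorm 1 y)) Ux).
rewrite (partial_scale oT k (- al) (Ck_sqnorm 1 y) Ux) partial_sqnorm.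
rewrite (partialB k (Ck_coord oT 1 k) (Ck_cst oT 1 _) Ux) partial_coord partial_cst eqxx.
by move: (expR _) => e /=; ring.
Qed.

Lemma barrier_lt0 x : 0 < al -> (barrier x < 0) = (rh < sqnorm (x - y)).
Proof. by move=> al0; rewrite subr_lt0 ltr_expR !mulNr ltrN2 ltr_pM2l. Qed.

Lemma barrier_le x : barrier x <= expR (- al * sqnorm (x - y)).
Proof. by rewrite lerBlDr lerDl expR_ge0. Qed.

Lemma barrier_le1 x : 0 < al -> barrier x <= 1.
Proof.
move=> al0; rewrite (le_trans (barrier_le x))// -[leRHS]expR0 ler_expR mulNr oppr_le0.
by rewrite mulr_ge0 ?sqnorm_ge0// ltW.
Qed.

(** The Laplacian contributes [4 al^2 s], at least [al * (al * rh)] since [s >= rh / 4]. All other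
    terms are at most [al * (2 n + C + C (n + 4 rh))] up to the exponential, using [al >= 1] and
    [s <= 4 rh]. The value of [al] leaves the positive margin [al * rh]. *)
Lemma barrier_subsolution (C : R) x : 0 <= C -> 0 < rh ->
  rh / 4 <= sqnorm (x - y) <= 4 * rh ->
  al = 1 + (2 * n%:R + C + C * (n%:R + 4 * rh)) / rh ->
  C * (barrier x + \sum_k `|partial k barrier x|) < \sum_k partial k (partial k barrier) x.
Proof.
move=> C0 rh0 /andP[s1 s2] alE; set s := sqnorm (x - y) in s1 s2.
set e := expR (- al * s); have e0 : 0 < e by exact: expR_gt0.
have N0 : 0 <= n%:R :> R by [].
have al1 : 1 <= al.
  rewrite alE lerDl divr_ge0//; last exact: ltW.
  by rewrite !addr_ge0 ?mulr_ge0// addr_ge0// mulr_ge0// ltW.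
have alr : al * rh = rh + (2 * n%:R + C + C * (n%:R + 4 * rh)).
  by rewrite alE mulrDl mul1r divfK// gt_eqF.
have sE : s = \sum_k (x 0 k - y 0 k) ^+ 2 by apply: eq_bigr => i _; rewrite !mxE.
have -> : \sum_k partial k (partial k barrier) x = (4 * al ^+ 2 * s - 2 * al * n%:R) * e.
  under eq_bigr do rewrite partial2_barrier -/s -/e.
  by rewrite -mulr_suml sumrB -mulr_sumr -sE sumr_const card_ord [in RHS]mulr_natr.
have le1 : \sum_k `|partial k barrier x| <= al * (n%:R + s) * e.
  have -> : al * (n%:R + s) * e = \sum_k al * (1 + (x 0 k - y 0 k) ^+ 2) * e.
    rewrite -mulr_suml -mulr_sumr big_split /= sumr_const card_ord -sE.
    by [].
  apply: ler_sum => k _; rewrite partial_barrier -/s -/e !normrM normrN !normrM.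
  rewrite (gtr0_norm e0) (ger0_norm (le_trans ler01 al1)) ger0_norm//.
  rewrite mulrA ler_pM2r//.
  have := sqr_ge0 (`|x 0 k - y 0 k| - 1); rewrite sqrrB real_normK ?num_real// mulr1.
  by move: `|_| (_ ^+ 2) al al1 => a b d d1 h; rewrite [2 * d]mulrC -mulrA ler_pM2l; lra.
have : C * (barrier x + \sum_k `|partial k barrier x|) <= C * ((1 + al * (n%:R + s)) * e).
  by apply: ler_wpM2l => //; rewrite mulrDl mul1r lerD ?barrier_le.
move=> /le_lt_trans; apply; rewrite mulrA ltr_pM2r//.
move: (n%:R : R) N0 alr => N N0 alr.
have h1 : C * (1 + al * (N + s)) <= al * (C + C * (N + 4 * rh)).
  have : C * 1 <= C * al by rewrite ler_wpM2l.
  have : C * (al * s) <= C * (al * (4 * rh)) by rewrite ler_wpM2l// ler_wpM2l//; lra.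
  by move=> h h'; apply: le_trans (_ : C * al + C * (al * N) + C * (al * (4 * rh)) <= _); lra.
apply: le_lt_trans h1 _.
have h2 : al * (al * rh) <= 4 * al ^+ 2 * s.
  have -> : 4 * al ^+ 2 * s = al * (al * (4 * s)) by ring.
  by do 2 (rewrite ler_wpM2l//; first lra); lra.
have h3 : al * (rh + (2 * N + C + C * (N + 4 * rh))) <= 4 * al ^+ 2 * s by rewrite -alr.
have h4 : 0 < al * rh by rewrite mulr_gt0//; lra.
by move: h3; move: (4 * al ^+ 2 * s) => q; lra.
Qed.

End Barrier.

Section Touching.
Variables (R : realType) (n : nat).
Implicit Types (x y z : 'rV[R]_n) (Z U : set 'rV[R]_n).

Lemma sqnorm_parallelogram x y : sqnorm (x + y) + sqnorm (x - y) = 2 * sqnorm x + 2 * sqnorm y.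
Proof.
rewrite /sqnorm -big_split !mulr_sumr -big_split; apply: eq_bigr => i _ /=.
by rewrite !mxE; ring.
Qed.

Lemma sqnormD_le x y : sqnorm (x + y) <= 2 * sqnorm x + 2 * sqnorm y.
Proof. by rewrite -sqnorm_parallelogram lerDl sqnorm_ge0. Qed.

Lemma sqnormZ (a : R) x : sqnorm (a *: x) = a ^+ 2 * sqnorm x.
Proof. by rewrite mulr_sumr; apply: eq_bigr => i _; rewrite mxE exprMn. Qed.

Lemma sqnormN x : sqnorm (- x) = sqnorm x.
Proof. by apply: eq_bigr => i _; rewrite mxE sqrrN. Qed.

Lemma sqnorm_le0 x : sqnorm x <= 0 -> x = 0.
Proof.
move=> h; apply/rowP => i; rewrite mxE; apply/eqP; rewrite -sqrf_eq0.
by rewrite eq_le sqr_ge0 (le_trans (sqnorm_coord x i) h).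
Qed.

(* The ball whose diameter joins a point off [Z] to a nearest point of [Z] meets [Z] at the latter
   only. *)
Lemma touching_ball U Z x0 : open U -> (forall K, compact K -> K `<=` U -> compact (K `&` Z)) ->
  U x0 -> Z x0 -> ~ nbhs x0 Z ->
  exists y xs (rh : R), [/\ 0 < rh, Z xs, sqnorm (xs - y) = rh,
    forall z, Z z -> sqnorm (z - y) <= rh -> z = xs &
    forall x, sqnorm (x - xs) <= rh / 4 -> U x].
Proof.
move=> oU cZ Ux0 Zx0 nZ.
have [d d0 dU] : exists2 d : R, 0 < d & forall y, sqnorm (y - x0) <= d -> U y.
  by apply: nbhs_sqnorm; exact: open_nbhs_nbhs.
(* The factor 100 leaves room for the losses of [sqnormD_le], so that the touching ball stays within
   squared distance [d] of [x0]. *)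
have d100 : 0 < d / 100 by rewrite divr_gt0.
have [y' y'x nZy'] : exists2 y', sqnorm (y' - x0) < d / 100 & ~ Z y'.
  apply/not_exists2P => h; apply: nZ; apply: filterS (sqnorm_nbhs x0 d100) => y /= xy.
  by have [|/contrapT] := h y.
have cK := cZ _ (@compact_euclidean_ball R n x0 d) dU.
have x0x0 : sqnorm (x0 - x0) = 0.
  by rewrite subrr /sqnorm big1// => i _; rewrite mxE expr0n.
have [|z1] := compact_EVT_min _ cK (continuous_subspaceT (@sqnorm_continuous R n y')).
  by exists x0; split => //=; rewrite x0x0 ltW.
rewrite inE => -[/= z1x Zz1] zmin; set D := sqnorm (z1 - y').
have D0 : 0 < D.
  rewrite lt_def sqnorm_ge0 andbT; apply/eqP => D0; apply: nZy'.
  have z1y : z1 - y' = 0 by apply: sqnorm_le0; rewrite -/D D0.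
  by move/eqP: z1y; rewrite subr_eq0 => /eqP <-.
have Dd : D < d / 100.
  apply: le_lt_trans y'x; rewrite -sqnormN opprB; apply: zmin.
  by rewrite inE; split => //=; rewrite x0x0 ltW.
pose y := 2^-1 *: (y' + z1).
have h2 : 2^-1 ^+ 2 = 4^-1 :> R by rewrite expr2 -invfM -natrM.
have y1 : z1 - y = 2^-1 *: (z1 - y').
  by apply/rowP => i; rewrite !mxE; field.
have y2 : y - y' = 2^-1 *: (z1 - y').
  by apply/rowP => i; rewrite !mxE; field.
exists y, z1, (D / 4); split => //; first by rewrite divr_gt0.
- by rewrite y1 sqnormZ h2 mulrC.
- move=> z Zz zy.
  have zx : sqnorm (z - x0) <= d.
    have -> : z - x0 = (z - y) + ((y - y') + (y' - x0)).
      by apply/rowP => i; rewrite !mxE; ring.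
    have := sqnormD_le (z - y) ((y - y') + (y' - x0)).
    have := sqnormD_le (y - y') (y' - x0); rewrite {2}y2 sqnormZ h2 -/D.
    move: (sqnorm _) (sqnorm _) (sqnorm _) (sqnorm (y' - x0)) zy y'x => a b c e *; lra.
  have := zmin z; rewrite inE => /(_ (conj zx Zz)); rewrite -/D => Dz.
  (* The two diagonals are [z - y'] and [z - z1]. Their squares add up to at most [D], and the first
     is at least [D] by the choice of [z1], so the second vanishes. *)
  have := sqnorm_parallelogram (z - y) (y - y').
  rewrite {3}y2 sqnormZ h2 -/D.
  have -> : z - y + (y - y') = z - y' by apply/rowP => i; rewrite !mxE; ring.
  have -> : z - y - (y - y') = z - z1 by apply/rowP => i; rewrite !mxE; field.
  move=> h; apply/eqP; rewrite -subr_eq0; apply/eqP/sqnorm_le0.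
  by move: (sqnorm _) (sqnorm _) (sqnorm _) h zy Dz => a b c; lra.
move=> x xz; apply: dU.
have -> : x - x0 = (x - z1) + ((z1 - y') + (y' - x0)).
  by apply/rowP => i; rewrite !mxE; ring.
have := sqnormD_le (x - z1) ((z1 - y') + (y' - x0)).
have := sqnormD_le (z1 - y') (y' - x0); rewrite -/D.
by move: (sqnorm _) (sqnorm _) (sqnorm _) (sqnorm (y' - x0)) xz y'x => a b c e *; lra.
Qed.

Lemma sqnorm_annulus x y z (rh : R) : 0 < rh -> sqnorm (z - y) = rh -> sqnorm (x - z) < rh / 4 ->
  rh / 4 <= sqnorm (x - y) <= 4 * rh.
Proof.
move=> rh0 zy; have := sqnormD_le (x - z) (z - y); have := sqnormD_le (x - y) (- (x - z)).
rewrite sqnormN.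
have -> : x - y - (x - z) = z - y by apply/rowP => i; rewrite !mxE; ring.
have -> : x - z + (z - y) = x - y by apply/rowP => i; rewrite !mxE; ring.
rewrite zy; move: (sqnorm _) (sqnorm _) => a b a1 a2 xa.
by apply/andP; split; lra.
Qed.

End Touching.

Lemma Ck_subset (R : realType) (n : nat) (U V : set 'rV[R]_n) (a : nat) f : V `<=` U -> Ck U a f -> Ck V a f.
Proof.
move=> VU; elim: a f => [|a IH] f; first by move=> [cf _]; split => // x /VU; exact: cf.
move=> [cf [df pf]]; split; first by move=> x /VU; exact: cf.
by split => [i x /VU|i]; [exact: df|exact: IH (pf i)].
Qed.

Section MinimumPrinciple.
Variables (R : realType) (n m : nat) (U : set 'rV[R]_n) (w : 'I_n -> 'I_n -> 'rV[R]_n -> R).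
Hypothesis openU : open U.
Hypothesis wC : forall i j, Ck U 2 (w i j).
Hypothesis wS : forall i j x, U x -> w i j x = w j i x.
Hypothesis wpsd : forall x, U x -> psdmx (\matrix_(i, j) w i j x).

Let W x : 'M[R]_n := \matrix_(i, j) w i j x.
Let T x k : 'M[R]_n := \matrix_(i, j) partial k (w i j) x.
Let Lap x : 'M[R]_n := \matrix_(i, j) \sum_k partial k (partial k (w i j)) x.

(** Only frames commuting with [W] are tested, because a minimising frame is stationary, and a
    single family of variations per frame suffices because minimality can be tested along any
    curve. *)
Hypothesis elliptic : forall K, compact K -> K `<=` U -> exists C : R,
  forall x (E : 'M[R]_(m, n)), K x -> E *m E^T = 1%:M -> (E^T *m E) *m W x = W x *m (E^T *m E) ->
  exists2 c : 'I_n -> 'M[R]_(m, n), forall k, E *m (c k)^T = 0 &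
  \tr (E^T *m E *m Lap x) + \sum_k (4 * \tr (E *m T x k *m (c k)^T) + 2 * \tr (c k *m W x *m (c k)^T))
  <= C * (\tr (E^T *m E *m W x) + \sum_k `|\tr (E^T *m E *m T x k)|).

Let W_sym x : U x -> (W x)^T = W x.
Proof. by move=> Ux; apply/matrixP => i j; rewrite !mxE wS. Qed.

Let T_sym x k : U x -> (T x k)^T = T x k.
Proof.
move=> Ux; apply/matrixP => i j; rewrite mxE [LHS]mxE [RHS]mxE.
by apply: (partial_ext openU k _ Ux) => y Uy; exact: wS.
Qed.

Lemma frobenius_gram (w' : 'I_n -> 'I_n -> 'rV[R]_n -> R) x (A B : 'M[R]_(m, n)) :
  frobenius (A^T *m B) w' x = \tr (A *m (\matrix_(i, j) w' i j x) *m B^T).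
Proof. by rewrite frobeniusE trmx_mul trmxK [RHS]mxtrace_mulC mulmxA. Qed.

Lemma frobeniusD (w' : 'I_n -> 'I_n -> 'rV[R]_n -> R) x (A B : 'M[R]_n) :
  frobenius (A + B) w' x = frobenius A w' x + frobenius B w' x.
Proof. by rewrite !frobeniusE trmxD mulmxDl mxtraceD. Qed.

Definition frame_curve (E C : 'M[R]_(m, n)) k (c : R) := quadratic_curve
  (frobenius (E^T *m E) w) (frobenius (E^T *m C + C^T *m E) w) (frobenius (C^T *m C) w) k c.

Lemma frame_curveE E C k c x :
  frame_curve E C k c x = frame_trace w x (E + (x 0 k - c) *: C).
Proof.
rewrite frame_traceE /frame_curve /quadratic_curve frobeniusD !frobenius_gram.
have tC : ((x 0 k - c) *: C)^T = (x 0 k - c) *: C^T by apply/matrixP => i j; rewrite !mxE.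
rewrite trmxD tC !mulmxDl !mulmxDr !mxtraceD -!scalemxAl -!scalemxAr !mxtraceZ.
by move: (\tr _) (\tr _) (\tr _) (\tr _) (x 0 k - c) => a b d e t; ring.
Qed.

Lemma Ck_frame_curve E C k c : Ck U 2 (frame_curve E C k c).
Proof. by apply: (Ck_quadratic_curve openU); exact: (Ck_frobenius openU). Qed.

Lemma partial2_frame_curve E C k x : U x ->
  partial k (partial k (frame_curve E C k (x 0 k))) x =
  \tr (E^T *m E *m \matrix_(i, j) partial k (partial k (w i j)) x)
  + (4 * \tr (E *m T x k *m C^T) + 2 * \tr (C *m W x *m C^T)).
Proof.
move=> Ux; have cc A := Ck_frobenius openU A wC.
rewrite (partial2_quadratic_curve openU (cc _) (cc _) (cc _) Ux erefl).
rewrite (partial2_frobenius openU _ k wC Ux) (partial_frobenius openU _ k (fun i j => CkW (wC i j)) Ux).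
rewrite frobeniusD !frobenius_gram -/(T x k) -/(W x).
have -> : \tr (C *m T x k *m E^T) = \tr (E *m T x k *m C^T).
  by rewrite -mxtrace_tr trmx_mul trmxK [(C *m _)^T]trmx_mul T_sym// mulmxA.
have -> X : \tr (E *m X *m E^T) = \tr (E^T *m E *m X) by rewrite mxtrace_mulC mulmxA.
by move: (\tr _) (\tr _) (\tr _) => a b d; ring.
Qed.

Let f_trace x (E : 'M[R]_(m, n)) : \tr (E *m W x *m E^T) = frame_trace w x E.
Proof. by rewrite frame_traceE. Qed.

Let frame_trace_ge0 x (E : 'M[R]_(m, n)) : U x -> 0 <= frame_trace w x E.
Proof. by move=> Ux; rewrite frame_traceE; apply: trace_gram_ge0; exact: wpsd. Qed.

Let frame_gram x (E : 'M[R]_(m, n)) : \tr (E *m x *m E^T) = \tr (E^T *m E *m x).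
Proof. by rewrite mxtrace_mulC mulmxA. Qed.

(* First and second order conditions at an interior minimum of [tr (E W E^T) - h] over points and
   frames. *)
Lemma frame_minimum_conditions (h : 'rV[R]_n -> R) (V : set 'rV[R]_n) x (E : 'M[R]_(m, n)) :
  Ck setT 2 h -> open V -> V `<=` U -> V x -> E *m E^T = 1%:M ->
  (forall y (F : 'M[R]_(m, n)), V y -> F *m F^T = 1%:M ->
    frame_trace w x E - h x <= frame_trace w y F - h y) ->
  (forall k, \tr (E^T *m E *m T x k) = partial k h x) /\
  (forall k C, E *m C^T = 0 -> partial k (partial k h) x <=
    \tr (E^T *m E *m \matrix_(i, j) partial k (partial k (w i j)) x)
    + (4 * \tr (E *m T x k *m C^T) + 2 * \tr (C *m W x *m C^T))).
Proof.
move=> hC oV VU Vx EE xmin; have Ux := VU _ Vx.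
have hU : Ck U 2 h by apply: Ck_subset hC.
(* [E + t C] is no longer orthonormal, but by [frame_correction] some frame at the same point has a
   trace at most as large, so the minimum persists along the curve. *)
have test k C : E *m C^T = 0 ->
    partial k (fun y => frame_curve E C k (x 0 k) y - h y) x = 0 /\
    0 <= partial k (partial k (fun y => frame_curve E C k (x 0 k) y - h y)) x.
  move=> EC; have [e e0 eV] := open_parallelogram (delta_mx 0 k) 0 oV Vx.
  apply: (second_derivative_test openU (CkB openU (Ck_frame_curve E C k (x 0 k)) hU) Ux e0) => t te.
  have Vt : V (x + t *: delta_mx 0 k) by have := eV t 0; rewrite scaler0 addr0; apply; rewrite ?normr0.
  rewrite !frame_curveE subrr scale0r addr0.
  have -> : (x + t *: delta_mx 0 k) 0 k - x 0 k = t.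
    by rewrite !mxE !eqxx mulr1 addrC addKr.
  have tC : (t *: C)^T = t *: C^T by apply/matrixP => i j; rewrite !mxE.
  have EtC : E *m (t *: C)^T = 0 by rewrite tC -scalemxAr EC scaler0.
  have [F FF] := frame_correction EE EtC (wpsd (VU _ Vt)).
  rewrite -!frame_traceE => le; apply: le_trans (xmin _ _ Vt FF) _.
  by rewrite lerD2r.
have c1 k C : Ck U 1 (frame_curve E C k (x 0 k)) := CkW (Ck_frame_curve E C k (x 0 k)).
have h1 : Ck U 1 h := CkW hU.
split=> [k|k C EC].
  (* The constant curve, [C = 0], gives the first order condition. *)
  have [] := test k 0 _; first by rewrite trmx0 mulmx0.
  rewrite (partialB k (c1 k 0) h1 Ux) => /eqP; rewrite subr_eq0 => /eqP <- _.
  have ext y : U y -> frame_curve E 0 k (x 0 k) y = frobenius (E^T *m E) w y.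
    by move=> _; rewrite frame_curveE scaler0 addr0 frame_traceE frobenius_gram.
  rewrite (partial_ext openU k ext Ux) (partial_frobenius openU _ k (fun i j => CkW (wC i j)) Ux).
  by rewrite frobenius_gram frame_gram.
have [_] := test k C EC.
have ext y : U y -> partial k (fun y => frame_curve E C k (x 0 k) y - h y) y =
    partial k (frame_curve E C k (x 0 k)) y - partial k h y.
  by move=> Uy; exact: (partialB k (c1 k C) h1 Uy).
rewrite (partial_ext openU k ext Ux).
rewrite (partialB k (Ck_partial k (Ck_frame_curve E C k (x 0 k))) (Ck_partial k hU) Ux).
by rewrite subr_ge0 (partial2_frame_curve E C k Ux).
Qed.

(** Near the touching point the trace over frames is compared with a small multiple of the barrier.
    At an interior minimum of the difference the conditions of first and second order, combined with
    [elliptic], contradict the strict inequality for the barrier. *)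
Lemma frame_zeros_nbhs x0 : U x0 ->
  (exists E : 'M[R]_(m, n), E *m E^T = 1%:M /\ frame_trace w x0 E = 0) ->
  nbhs x0 [set x | exists E : 'M[R]_(m, n), E *m E^T = 1%:M /\ frame_trace w x E = 0].
Proof.
set Z := [set x | _]; move=> Ux0 Zx0; apply: contrapT => nZ.
have cw (K : set 'rV[R]_n) : K `<=` U -> forall i j x, K x -> {for x, continuous (w i j)}.
  by move=> KU i j x /KU Ux; exact: (Ck_continuous (wC i j)).
have cZ (K : set 'rV[R]_n) : compact K -> K `<=` U -> compact (K `&` Z).
  by move=> cK KU; apply: compact_frame_zeros cK _; exact: cw.
have [y [xs [rh [rh0 [E0 [EE0 E00]] xsy uniq KU]]]] := touching_ball openU cZ Ux0 Zx0 nZ.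
have cK := @compact_euclidean_ball R n xs (rh / 4); set K := [set x | _] in cK.
have rh4 : 0 < rh / 4 by rewrite divr_gt0.
have xx : sqnorm (xs - xs) = 0.
  by rewrite subrr /sqnorm big1// => i _; rewrite mxE expr0n.
(* A nonnegative constant allows the trace to be replaced by its upper bound [h]. *)
have [C0 hC0] := elliptic cK KU; pose C := Num.max C0 0.
have C_ge0 : 0 <= C by rewrite le_max lexx orbT.
pose al := 1 + (2 * n%:R + C + C * (n%:R + 4 * rh)) / rh.
have al0 : 0 < al.
  rewrite ltr_wpDr// divr_ge0//; last exact: ltW.
  by rewrite !addr_ge0 ?mulr_ge0// addr_ge0// mulr_ge0// ltW.
(* The part of the sphere bounding [K] that lies in the closed touching ball. The only zero in that
   ball is the centre [xs] of [K], so by compactness the trace has a positive lower bound [c] on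
   [K1]. *)
pose K1 := [set x | sqnorm (x - y) <= rh] `&` [set x | sqnorm (x - xs) = rh / 4].
have cK1 : compact K1.
  have cl : closed ((fun x : 'rV[R]_n => sqnorm (x - xs)) @^-1` [set rh / 4]).
    by apply: preimage_closed; [move=> x _; exact: sqnorm_continuous|exact: closed_eq].
  exact: compact_closedI (@compact_euclidean_ball R n y rh) cl.
have K1U : K1 `<=` U by move=> x [_ /= xE]; apply: KU; rewrite xE.
have [c c0 cmin] : exists2 c, 0 < c & forall (x : 'rV[R]_n) (F : 'M[R]_(m, n)),
    K1 x -> F *m F^T = 1%:M -> c <= frame_trace w x F.
  have [[x1 Kx1]|K10] := pselect (exists x, K1 x); last first.
    by exists 1 => // x F Kx; case: K10; exists x.
  have h0 (x : 'rV[R]_n) : K1 x -> {for x, continuous (fun=> 0 : R)}.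
    by move=> _; exact: cst_continuous.
  have [x [E [Kx EE xmin]]] := frame_minimum cK1 (cw _ K1U) h0 Kx1 EE0.
  exists (frame_trace w x E) => [|x' F Kx' FF].
    rewrite lt_def frame_trace_ge0 ?andbT; last exact: K1U.
    apply/eqP => E1; have xE : x = xs by apply: uniq (Kx.1); exists E.
    by have := Kx.2; rewrite /= xE xx => /eqP; rewrite lt_eqF.
  by have := xmin _ _ Kx' FF; rewrite !subr0.
(* As the barrier is at most 1, [h < c] on [K1], and [h < 0] on the rest of the sphere. The minimum
   is at most its value 0 at [xs], hence is attained inside. *)
pose h x := c / 2 * barrier y al rh x.
have hC : Ck setT 2 h.
  by apply: (CkM openT); [exact: (Ck_cst openT)|exact: Ck_barrier].
have hcont x : K x -> {for x, continuous h} by move=> _; exact: (Ck_continuous hC).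
have Kxs : K xs by rewrite /K /= xx ltW.
have [x [E [Kx EE xmin]]] := frame_minimum cK (cw _ KU) hcont Kxs EE0.
have Ux := KU _ Kx.
have c2 : 0 < c / 2 by rewrite divr_gt0.
have hxs : h xs = 0 by rewrite /h /barrier xsy subrr mulr0.
have le0 : frame_trace w x E <= h x.
  by have := xmin _ _ Kxs EE0; rewrite E00 hxs subrr subr_le0.
have xint : sqnorm (x - xs) < rh / 4.
  rewrite lt_neqAle Kx andbT; apply/eqP => xE.
  have [xy|xy] := leP (sqnorm (x - y)) rh.
    have := cmin _ _ (conj xy xE) EE; have := barrier_le1 y rh x al0.
    rewrite -(ler_pM2l c2) mulr1 -/(h x) => h1 h2.
    by have := le_trans h2 (le_trans le0 h1); lra.
  have : h x < 0 by rewrite /h pmulr_rlt0 ?barrier_lt0.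
  by have := frame_trace_ge0 E Ux; lra.
pose V := [set z | sqnorm (z - xs) < rh / 4].
have oV : open V.
  have : open ((fun x : 'rV[R]_n => sqnorm (x - xs)) @^-1` [set t | t < rh / 4]).
    by apply: open_comp; [move=> z _; exact: sqnorm_continuous|exact: open_lt].
  exact.
have VU : V `<=` U by move=> z /= /ltW; exact: KU.
have [first second] := frame_minimum_conditions hC oV VU xint EE
  (fun z F (Vz : V z) FF => xmin z F (ltW Vz) FF).
have com : E^T *m E *m W x = W x *m (E^T *m E).
  apply: minimal_frame_stationary EE (W_sym Ux) (wpsd Ux) _ => F FF.
  by have := xmin _ _ Kx FF; rewrite lerD2r !frame_traceE.
have [D ED ineq] := hC0 x E Kx EE com.
have h1 k z : partial k h z = c / 2 * partial k (barrier y al rh) z.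
  exact: (partial_scale openT k _ (Ck_barrier y al rh 1)).
have h2 k : partial k (partial k h) x = c / 2 * partial k (partial k (barrier y al rh)) x.
  have -> : partial k h = fun z => c / 2 * partial k (barrier y al rh) z by apply/funext => z; exact: h1.
  exact: (partial_scale openT k _ (Ck_partial k (Ck_barrier y al rh 2))).
have LapE : \tr (E^T *m E *m Lap x) =
    \sum_k \tr (E^T *m E *m \matrix_(i, j) partial k (partial k (w i j)) x).
  have -> : Lap x = \sum_k \matrix_(i, j) partial k (partial k (w i j)) x.
    by apply/matrixP => i j; rewrite summxE mxE; apply: eq_bigr => k _; rewrite mxE.
  by rewrite mulmx_sumr raddf_sum.
have sum2 : c / 2 * \sum_k partial k (partial k (barrier y al rh)) x <=
    \tr (E^T *m E *m Lap x) + \sum_k (4 * \tr (E *m T x k *m (D k)^T) + 2 * \tr (D k *m W x *m (D k)^T)).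
  rewrite LapE -big_split mulr_sumr; apply: ler_sum => k _ /=.
  by rewrite -h2; exact: second.
have trW : \tr (E^T *m E *m W x) = frame_trace w x E by rewrite -frame_gram f_trace.
have sum1 : \sum_k `|\tr (E^T *m E *m T x k)| = c / 2 * \sum_k `|partial k (barrier y al rh) x|.
  rewrite mulr_sumr; apply: eq_bigr => k _.
  by rewrite first h1 normrM gtr0_norm.
have bound : C0 * (\tr (E^T *m E *m W x) + \sum_k `|\tr (E^T *m E *m T x k)|) <=
    C * (c / 2 * (barrier y al rh x + \sum_k `|partial k (barrier y al rh) x|)).
  rewrite trW sum1; set S := \sum_k _; apply: (@le_trans _ _ (C * (frame_trace w x E + c / 2 * S))).
    apply: ler_wpM2r; last by rewrite le_max lexx.
    by rewrite addr_ge0 ?frame_trace_ge0// mulr_ge0 ?sumr_ge0// ltW.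
  by apply: ler_wpM2l => //; rewrite [leRHS]mulrDr lerD2r.
have dist := sqnorm_annulus rh0 xsy xint.
have := barrier_subsolution C_ge0 rh0 dist erefl.
have := le_trans sum2 (le_trans ineq bound).
by rewrite mulrCA ler_pM2l// leNgt => /negP.
Qed.

End MinimumPrinciple.

(** * The Poincare ball and the theorem *)

Section Chart.
Variables (R : realType) (n : nat).
Implicit Types (x : 'rV[R]_n) (i j k l : 'I_n).

Let U_ball x : hyp_space x -> sqnorm x < 1. Proof. by []. Qed.

Lemma open_hyp_space : open (@hyp_space R n).
Proof.
have c : continuous (@sqnorm R n).
  move=> x; apply: (@Ck_continuous _ _ setT 0) => //.
  by apply: (Ck_sum openT) => i; apply: (Ck_sqr openT); exact: (Ck_coord openT).
have : open (@sqnorm R n @^-1` [set t | t < 1]) by apply: open_comp; [move=> x _; exact: c|exact: open_lt].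
exact.
Qed.

Let openB := open_hyp_space.

Lemma hyp_metricE x : hyp_metric x = ((half_gap x)^-1 ^+ 2)%:M.
Proof. by rewrite /hyp_metric /half_gap invf_div expr_div_n -natrX. Qed.

Lemma invmx_hyp_metric x : invmx (hyp_metric x) = (half_gap x ^+ 2)%:M.
Proof. by rewrite hyp_metricE invmx_scalar exprVn invrK. Qed.

Lemma partial_hyp_metric i j l x : hyp_space x ->
  partial i (fun y => hyp_metric y j l) x = (j == l)%:R * (2 * x 0 i * (half_gap x)^-1 ^+ 3).
Proof.
move=> Bx; have g0 (y : 'rV[R]_n) : hyp_space y -> half_gap y != 0.
  by move=> By; exact: lt0r_neq0 (half_gap_gt0 U_ball By).
have cg := Ck_half_gap openB 1.
have ext (y : 'rV[R]_n) : hyp_space y -> hyp_metric y j l = (j == l)%:R * (half_gap y)^-1 ^+ 2.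
  by move=> _; rewrite hyp_metricE mxE mulrC mulr_natr.
rewrite (partial_ext openB i ext Bx).
have cV := CkV openB g0 cg.
rewrite (partial_scale openB i _ (Ck_sqr openB cV) Bx) (partial_sqr i cV Bx).
rewrite (partialV i cg g0 Bx) (partial_half_gap openB i Bx).
by congr (_ * _); have := g0 x Bx; move: (half_gap x) => h h0; field.
Qed.

Lemma christoffelE k i j x : hyp_space x -> christoffel hyp_metric k i j x =
  (half_gap x)^-1 * ((j == k)%:R * x 0 i + (i == k)%:R * x 0 j - (i == j)%:R * x 0 k).
Proof.
move=> Bx; have h0 : half_gap x != 0 by exact: lt0r_neq0 (half_gap_gt0 U_ball Bx).
rewrite /christoffel (bigD1 k) //= big1 => [|l lk].
  rewrite !partial_hyp_metric// invmx_hyp_metric mxE eqxx mulr1n.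
  by move: (half_gap x) (_ == _)%:R (_ == _)%:R (_ == _)%:R h0 => h a b c h0; field.
by rewrite invmx_hyp_metric mxE eq_sym (negbTE lk) mulr0n mul0r.
Qed.

Variables (U : set 'rV[R]_n) (v : 'rV[R]_n -> R).
Hypothesis openU : open U.
Hypothesis UB : U `<=` @hyp_space R n.
Hypothesis vC : Ck U 2 v.

Lemma hessianE x : U x -> hessian hyp_metric v x = \matrix_(i, j)
  (partial i (partial j v) x - (half_gap x)^-1 *
    (x 0 i * partial j v x + x 0 j * partial i v x - (i == j)%:R * \sum_l x 0 l * partial l v x)).
Proof.
move=> Ux; apply/matrixP => i j; rewrite [LHS]mxE [RHS]mxE; congr (_ - _).
have E k : christoffel hyp_metric k i j x * partial k v x =
    (half_gap x)^-1 * (x 0 i * ((j == k)%:R * partial k v x) + x 0 j * ((i == k)%:R * partial k v x)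
    - (i == j)%:R * (x 0 k * partial k v x)).
  by rewrite christoffelE; [move: (partial k v x) => a; ring|exact: UB].
rewrite (eq_bigr _ (fun k _ => E k)) -mulr_sumr sumrB big_split /= -!mulr_sumr.
have S a : \sum_k (a == k)%:R * partial k v x = partial a v x.
  by rewrite (bigD1 a) //= big1 ?eqxx ?mul1r ?addr0// => k ka; rewrite eq_sym (negbTE ka) mul0r.
by rewrite !S.
Qed.

Lemma gradient_normE x : U x -> gradient_norm hyp_metric v x = hyp_slope v x.
Proof.
move=> Ux; have h0 := half_gap_gt0 U_ball (UB Ux).
rewrite /gradient_norm /metric_norm /gradient invmx_hyp_metric hyp_metricE !mul_mx_scalar.
have -> : ((half_gap x)^-1 ^+ 2 *: (half_gap x ^+ 2 *: differential v x) *m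
    (half_gap x ^+ 2 *: differential v x)^T) 0 0 = half_gap x ^+ 2 * \sum_i partial i v x ^+ 2.
  rewrite mxE mulr_sumr; apply: eq_bigr => i _; rewrite !mxE.
  by move: (partial i v x) (half_gap x) h0 => a h /lt0r_neq0 h0; field.
by rewrite sqrtrM ?exprn_ge0 ?ltW// sqrtr_sqr gtr0_norm.
Qed.

Definition hyp_tensor x : 'M[R]_n :=
  hessian hyp_metric v x - gradient_norm hyp_metric v x *: hyp_metric x.

Lemma hyp_tensorE x : U x -> hyp_tensor x = (half_gap x)^-1 *: scaled_tensor v x.
Proof.
move=> Ux; have h0 := lt0r_neq0 (half_gap_gt0 U_ball (UB Ux)).
rewrite /hyp_tensor hessianE// gradient_normE// hyp_metricE; apply/matrixP => i j.
rewrite !mxE [scaled_tensor_entry _ _ _ _]/scaled_tensor_entry (schwarz openU i j vC Ux).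
rewrite /hyp_slope.
move: (partial j (partial i v) x) (partial j v x) (partial i v x) (\sum_l _) (slope v x) => a b c d s.
move: (half_gap x) h0 => h h0.
by case: (i == j); rewrite ?mulr1n ?mulr0n; field.
Qed.

Lemma raise_hyp_tensorE x : U x -> raise hyp_metric hyp_tensor x = half_gap x *: scaled_tensor v x.
Proof.
move=> Ux; have h0 := lt0r_neq0 (half_gap_gt0 U_ball (UB Ux)).
rewrite /raise hyp_tensorE// invmx_hyp_metric mul_scalar_mx scalerA.
by congr (_ *: _); move: (half_gap x) h0 => h h0; field.
Qed.

Lemma trace_scaled_tensor x : U x ->
  \tr (scaled_tensor v x) = (half_gap x)^-1 * (laplacian hyp_metric v x - n%:R * hyp_slope v x).
Proof.
move=> Ux; have h0 := lt0r_neq0 (half_gap_gt0 U_ball (UB Ux)).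
have := congr1 mxtrace (raise_hyp_tensorE Ux).
rewrite /raise /hyp_tensor mulmxBr mxtraceB mxtraceZ -/(raise hyp_metric (hessian hyp_metric v) x).
rewrite -/(laplacian hyp_metric v x) -scalemxAr invmx_hyp_metric hyp_metricE -scalar_mxM.
rewrite mxtraceZ mxtrace_scalar gradient_normE// => E.
apply: (mulfI h0); rewrite -E [RHS]mulrA mulfV// mul1r; congr (_ - _).
by rewrite -exprMn mulfV// expr1n mulrC.
Qed.

End Chart.

(** * Constancy of the rank on a connected set *)

Section ConstantRank.
Variables (R : realType) (n : nat) (O : set 'rV[R]_n) (v : 'rV[R]_n -> R).
Hypothesis n2 : (2 <= n)%N.
Hypothesis openO : open O.
Hypothesis vC : Ck O 4 v.
Hypothesis O_ball : forall x, O x -> sqnorm x < 1.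
Hypothesis O_neg : forall x, O x -> v x < 0.
Hypothesis O_lb : forall x, O x -> - v x < (2 * n%:R)^-1.
Hypothesis trace_eq : forall x, O x -> \tr (scaled_tensor v x) = (half_gap x)^-1 * coefL v x.
Hypothesis psd : forall x, O x -> psdmx (scaled_tensor v x).

Let dC (a : nat) i : (a <= 3)%N -> Ck O a (partial i v).
Proof. by move=> a3; exact: Ck_le a3 (Ck_partial i vC). Qed.

Lemma minimum_partial (f : 'rV[R]_n -> R) x k : Ck O 2 f -> O x -> (forall y, O y -> f x <= f y) ->
  partial k f x = 0.
Proof.
move=> cf Ox fmin; have [e e0 eO] := open_parallelogram (delta_mx 0 k) 0 openO Ox.
have [|//] := @second_derivative_test _ _ _ openO f k x e cf Ox e0.
move=> t te; apply: fmin; have := eO t 0; rewrite scaler0 addr0; apply => //.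
by rewrite normr0.
Qed.

(** The tensor without [slope], its only term that may fail to be smooth at critical points of
    [v]. *)
Definition smooth_entry i j (y : 'rV[R]_n) : R := half_gap y * partial j (partial i v) y
  - y 0 i * partial j v y - y 0 j * partial i v y + (\sum_(l < n) y 0 l * partial l v y) * (i == j)%:R.

Lemma scaled_tensor_entryE i j y :
  scaled_tensor_entry v i j y = smooth_entry i j y - slope v y * (i == j)%:R.
Proof. by rewrite /scaled_tensor_entry mulrBl addrA. Qed.

Lemma Ck_smooth_entry i j : Ck O 2 (smooth_entry i j).
Proof.
have d2 a : Ck O 2 (partial a v) := @dC 2 a isT.
have xC a : Ck O 2 (fun y : 'rV[R]_n => y 0 a) := Ck_coord openO 2 a.
apply: (CkD openO); last first.
  apply: (CkM openO); last exact: Ck_cst.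
  by apply: (Ck_sum openO) => l; exact: (CkM openO).
apply: (CkB openO); last exact: (CkM openO).
apply: (CkB openO); last exact: (CkM openO).
apply: (CkM openO); [exact: Ck_half_gap|exact: (Ck_partial j (Ck_partial i vC))].
Qed.

(** Valid at critical points too, where [slope] is still continuous; closedness of the degeneracy
    set relies on this. *)
Lemma scaled_tensor_entry_continuous i j x : O x -> {for x, continuous (scaled_tensor_entry v i j)}.
Proof.
move=> Ox.
have -> : scaled_tensor_entry v i j = (fun y => smooth_entry i j y - slope v y * (i == j)%:R).
  by apply/funext => y; exact: scaled_tensor_entryE.
apply: continuousB; first exact: (Ck_continuous (Ck_smooth_entry i j) Ox).
apply: continuousM; last exact: cst_continuous.
apply: (@continuous_comp _ _ _ (fun y => \sum_l partial l v y ^+ 2) Num.sqrt); last exact: sqrt_continuous.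
have c : Ck O 0 (fun y => \sum_l partial l v y ^+ 2).
  apply: (Ck_sum openO) => l; exact: (Ck_sqr openO (@dC 0 l isT)).
exact: (Ck_continuous c Ox).
Qed.

(* Along [e] the non-smooth term [- slope v] of the tensor is dominated by a smooth function
   vanishing at [x]; at a critical point this forces the second derivatives of [v] to vanish. *)
Lemma null_vector_noncritical x (e : 'rV[R]_n) : O x -> e != 0 -> dot (e *m scaled_tensor v x) e = 0 ->
  0 < \sum_i partial i v x ^+ 2.
Proof.
move=> Ox e0 eW; rewrite lt_def sumr_ge0 ?andbT => [|i _]; last exact: sqr_ge0.
apply/eqP => /eqP; rewrite psumr_eq0 => [/allP dv|i _]; last exact: sqr_ge0.
have {}dv i : partial i v x = 0.
  by have := dv i (mem_index_enum i); rewrite sqrf_eq0 => /eqP.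
have slope0 : slope v x = 0.
  by rewrite /slope big1 ?sqrtr0// => i _; rewrite dv expr0n.
pose q := dot e e.
have q0 : 0 < q by rewrite lt_def dot_ge0 andbT; apply: contra e0 => /eqP/dot_eq0 ->.
pose f := frobenius (e^T *m e) smooth_entry.
have cf : Ck O 2 f := Ck_frobenius openO _ Ck_smooth_entry.
have fE y : f y = dot (e *m scaled_tensor v y) e + slope v y * q.
  rewrite /f frobenius_gram.
  have -> : \matrix_(i, j) smooth_entry i j y = scaled_tensor v y + (slope v y)%:M.
    by apply/matrixP => i j; rewrite !mxE scaled_tensor_entryE mulr_natr subrK.
  rewrite mulmxDr mulmxDl mxtraceD mul_mx_scalar -scalemxAl mxtraceZ.
  by rewrite !mxtrace11 -!dotE.
have fx : f x = 0 by rewrite fE eW slope0 mul0r addr0.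
have fs y : O y -> slope v y * q <= f y by move=> Oy; rewrite fE lerDr; exact: psd.
have f0 k : partial k f x = 0.
  apply: minimum_partial cf Ox _ => y Oy; rewrite fx (le_trans _ (fs y Oy))//.
  by rewrite mulr_ge0 ?sqrtr_ge0// ltW.
(* Since [|partial j v| <= slope v], the function [f - q * partial j v] is also nonnegative and
   vanishes at [x]; comparing its gradient with that of [f] leaves the second derivatives of [v]. *)
have hess0 k j : partial k (partial j v) x = 0.
  have cd : Ck O 2 (partial j v) := @dC 2 j isT.
  have cqd : Ck O 2 (fun y => q * partial j v y) := CkM openO (Ck_cst openO 2 q) cd.
  have := @minimum_partial (fun y => f y - q * partial j v y) x k (CkB openO cf cqd) Ox.
  rewrite (partialB k (CkW cf) (CkW cqd) Ox) (partial_scale openO k q (CkW cd) Ox) f0 => h.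
  have /eqP : 0 - q * partial k (partial j v) x = 0.
    apply: h => y Oy; rewrite fx dv mulr0 subr0 subr_ge0 (le_trans _ (fs y Oy))// mulrC ler_pM2r//.
    rewrite (le_trans (ler_norm _))// -sqrtr_sqr ler_wsqrtr// (bigD1 j)//= lerDl.
    by rewrite sumr_ge0// => i _; exact: sqr_ge0.
  by rewrite sub0r oppr_eq0 mulf_eq0 gt_eqF//= => /eqP.
have tr0 : \tr (scaled_tensor v x) = 0.
  rewrite [scaled_tensor v x](_ : _ = 0) ?mxtrace0//; apply/matrixP => i j.
  rewrite !mxE /scaled_tensor_entry hess0 !dv slope0 big1 => [|l _]; last by rewrite dv mulr0.
  by rewrite !mulr0 !subr0 add0r mul0r.
have := trace_eq Ox; rewrite tr0 /coefL /hyp_slope slope0 !mulr0 expr0n addr0 subr0 mul1r => /esym/eqP.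
rewrite gt_eqF// mulr_gt0// invr_gt0 ?oppr_gt0 ?O_neg//.
exact: (half_gap_gt0 O_ball Ox).
Qed.

Local Notation entries := (scaled_tensor_entry v).
Definition null_frames m : set 'rV[R]_n :=
  [set x | exists E : 'M[R]_(m, n), E *m E^T = 1%:M /\ frame_trace entries x E = 0].

(** The minimum principle needs a tensor of class C^2, available on the open set [U] where the slope
    is positive. As [m > 0], a null frame has a row, which is a null vector, and so [x] lies in
    [U]. *)
Lemma null_frames_nbhs m x : (0 < m)%N -> O x -> null_frames m x -> nbhs x (null_frames m).
Proof.
move=> m0 Ox Zx; pose U := O `&` [set y | 0 < \sum_i partial i v y ^+ 2].
have openU : open U.
  rewrite openE => y [Oy y0]; apply: filterI; first exact: open_nbhs_nbhs.
  have c : Ck O 0 (fun y => \sum_i partial i v y ^+ 2).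
    apply: (Ck_sum openO) => i; exact: (Ck_sqr openO (@dC 0 i isT)).
  apply: (Ck_continuous c Oy [set t | 0 < t]).
  by apply: open_nbhs_nbhs; split => //; exact: open_gt.
have UO : U `<=` O by move=> y [].
have vU : Ck U 4 v := Ck_subset UO vC.
have U_slope y : U y -> 0 < \sum_(i < n) partial i v y ^+ 2 by case.
have Ux : U x.
  split => //; case: Zx => E [EE E0].
  have tE : \sum_i dot (row i E *m scaled_tensor v x) (row i E) = 0.
    by rewrite -trace_gram -frame_traceE.
  pose a : 'I_m := Ordinal m0.
  apply: (@null_vector_noncritical x (row a E)) => //.
    apply: contraTneq isT => a0; have /matrixP/(_ a a) := EE.
    rewrite mxE big1 => [|j _]; first by rewrite mxE eqxx => /eqP; rewrite eq_sym oner_eq0.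
    by have /rowP/(_ j) := a0; rewrite !mxE => ->; rewrite mul0r.
  move/eqP: tE; rewrite psumr_eq0 => [/allP h|j _]; last exact: psd.
  by have /eqP := h a (mem_index_enum a).
have wC i j : Ck U 2 (entries i j) by apply: (Ck_scaled_tensor openU vU U_slope).
have wS i j y : U y -> entries i j y = entries j i y by exact: (scaled_entry_sym openU vU).
have wpsd y : U y -> psdmx (\matrix_(i, j) entries i j y) by move=> /UO; exact: psd.
apply: (frame_zeros_nbhs openU wC wS wpsd _ Ux Zx) => K cK KU.
have [C hC] := curvature_inequality n2 m0 openU vU (fun y Uy => O_ball (UO y Uy))
  (fun y Uy => O_neg (UO y Uy)) (fun y Uy => O_lb (UO y Uy)) U_slope
  (fun y Uy => trace_eq (UO y Uy)) (fun y a Uy => psd (UO y Uy) a) cK KU.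
exists C => y E Ky EE com; exists (test_curve v y E); last exact: hC.
by move=> k; exact: test_direction_orthogonal.
Qed.

(** Inside a closed ball contained in [O] the set is compact by [compact_frame_zeros], hence closed
    near [x]. *)
Lemma null_frames_closure m x : O x -> closure (null_frames m) x -> null_frames m x.
Proof.
move=> Ox cx.
have [d d0 dO] : exists2 d : R, 0 < d & forall y, sqnorm (y - x) <= d -> O y.
  by apply: nbhs_sqnorm; exact: open_nbhs_nbhs.
have cK := @compact_euclidean_ball R n x d; set K := [set y | _] in cK.
have wcont i j y : K y -> {for y, continuous (entries i j)}.
  by move=> /dO; exact: scaled_tensor_entry_continuous.
have /(compact_closed (@norm_hausdorff _ _)) clo := compact_frame_zeros (m := m) cK wcont.
suff : (K `&` null_frames m) x by case.
apply: clo => B nB; have nK : nbhs x K.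
  by apply: filterS (sqnorm_nbhs x d0) => y /= /ltW.
have [y [Zy [By Ky]]] := cx _ (filterI nB nK).
by exists y.
Qed.

Lemma scaled_tensor_constant_rank x y : connected O -> O x -> O y ->
  \rank (scaled_tensor v x) = \rank (scaled_tensor v y).
Proof.
move=> conn Ox Oy.
have sym z : O z -> (scaled_tensor v z)^T = scaled_tensor v z by exact: (scaled_tensor_sym openO vC).
have key m z : O z -> null_frames m z <-> (m <= n - \rank (scaled_tensor v z))%N.
  move=> Oz; rewrite -(null_frame m (sym z Oz) (psd Oz)).
  by split=> -[E [EE E0]]; exists E; split => //; move: E0; rewrite frame_traceE.
(* Exchanging [a] and [b] turns this inequality of coranks into equality. Corank 0 is immediate;
   positive corank gives [m > 0], as openness requires. *)
have le a b : O a -> O b -> (n - \rank (scaled_tensor v a) <= n - \rank (scaled_tensor v b))%N.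
  move=> Oa Ob; pose m := (n - \rank (scaled_tensor v a))%N; rewrite -/m.
  have [->//|m0] := posnP m.
  suff OZ : O `&` null_frames m = O by apply/(key m b Ob); rewrite -OZ in Ob; case: Ob.
  apply: conn.
  - by exists a; split => //; apply/(key m a Oa).
  - exists (O `&` null_frames m); last by rewrite setIA setIid.
    rewrite openE => z [Oz Zz]; apply: filterI; first exact: open_nbhs_nbhs.
    exact: null_frames_nbhs.
  exists (closure (null_frames m)); first exact: closed_closure.
  apply/seteqP; split => z [Oz Zz]; split => //; first exact: subset_closure.
  exact: null_frames_closure.
have /eqP E : (n - \rank (scaled_tensor v x) == n - \rank (scaled_tensor v y))%N.
  by rewrite eqn_leq !le.
by rewrite -(subKn (rank_leq_row (scaled_tensor v x))) E subKn// rank_leq_row.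
Qed.

End ConstantRank.

Theorem proposition5p1 (R : realType) (n : nat) (hn : (2 <= n)%N)
    (Omega : set 'rV[R]_n) (v : 'rV[R]_n -> R)
    (Omega_domain : hyp_domain Omega)
    (Omega_bounded : hyp_bounded Omega)
    (Omega_smooth : hyp_smooth_boundary Omega)
    (v_smooth : smooth_on Omega v)
    (v_eq : forall x, Omega x ->
       laplacian hyp_metric v x
       = - ((1 + gradient_norm hyp_metric v x ^+ 2) / v x))
    (v_bounds : forall x, Omega x -> - (2 * n%:R)^-1 < v x < 0) :
  let Lambda := fun x =>
    hessian hyp_metric v x - gradient_norm hyp_metric v x *: hyp_metric x in
  nonneg_tensor_on Omega Lambda -> constant_rank_on hyp_metric Omega Lambda.
Proof.
move=> Lambda; rewrite -/(hyp_tensor v) in Lambda * => psdL.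
have [OB openO conn] := Omega_domain.
have vC : Ck Omega 4 v := Ck_smooth 4 v_smooth.
have v2 : Ck Omega 2 v := Ck_smooth 2 v_smooth.
have neg x : Omega x -> v x < 0 by move=> /v_bounds/andP[].
have lb x : Omega x -> - v x < (2 * n%:R)^-1 by move=> /v_bounds/andP[h _]; rewrite ltrNl.
have ball x : Omega x -> sqnorm x < 1 := OB x.
have gap x : Omega x -> 0 < half_gap x := half_gap_gt0 ball (x := x).
(* The equation for [v] replaces the Laplacian by a function of [v] and the norm of its gradient. *)
have trace_eq x : Omega x -> \tr (scaled_tensor v x) = (half_gap x)^-1 * coefL v x.
  move=> Ox; rewrite (trace_scaled_tensor openO OB v2 Ox) v_eq// (gradient_normE v OB Ox).
  by rewrite /coefL invrN mulrN.
have psd x : Omega x -> psdmx (scaled_tensor v x).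
  move=> Ox a; have := psdL x a Ox.
  have -> : Lambda x = (half_gap x)^-1 *: scaled_tensor v x := hyp_tensorE openO OB v2 Ox.
  rewrite -scalemxAr -scalemxAl mxE -dotE.
  by rewrite pmulr_rge0// invr_gt0 gap.
have rank x y := @scaled_tensor_constant_rank _ _ _ _ hn openO vC ball neg lb trace_eq psd x y conn.
(* The endomorphism attached to Lambda is [half_gap] times the tensor, and a nonzero factor
   preserves the rank. *)
have spec x : Omega x -> has_rank_at hyp_metric Lambda x (\rank (scaled_tensor v x)).
  move=> Ox; have h0 := lt0r_neq0 (gap x Ox).
  have sym : (half_gap x *: scaled_tensor v x)^T = half_gap x *: scaled_tensor v x.
    by apply/matrixP => i j; rewrite !mxE (scaled_entry_sym openO vC)//.
  have [s sE sr] := symmetric_eigenvalues sym.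
  exists s; last by rewrite sr mxrank_scale_nz.
  by rewrite /eigenvalues_at -sE -(raise_hyp_tensorE openO OB v2 Ox).
(* For empty [Omega] any number serves as the rank. *)
have [[x0 O0]|none] := pselect (exists x, Omega x); last first.
  by exists 0%N => x Ox; case: none; exists x.
by exists (\rank (scaled_tensor v x0)) => x Ox; rewrite -(rank x x0 Ox O0); exact: spec.
Qed.
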